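(* Let $3\le k\le \frac N2$. Write $G=\mathrm{Gr}(k,\mathbb C^N)$. Then $\Sigma_{1,G}=\Theta_{1,G}=G$, $\Sigma_{2,G}=\Theta_{2,G}$, and $\sigma_2(G)$ is the disjoint union of the $\mathrm{SL}(N)$-orbits $$G,\quad \Sigma_{2,G}=\Theta_{2,G},\quad \Sigma_{3,G},\dots,\Sigma_{k,G},\quad \Theta_{3,G},\dots,\Theta_{k,G}.$$ Moreover the following inclusions hold: $G\subset\overline{\Sigma_{2,G}}$; $\Theta_{l,G}\subset\overline{\Theta_{l+1,G}}$ for $2\le l\le k-1$; $\Sigma_{l,G}\subset\overline{\Sigma_{l+1,G}}$ for $3\le l\le k-1$; and $\Theta_{l,G}\subset\overline{\Sigma_{l,G}}$ for $3\le l\le k$. In particular, $\Theta_{k,G}$ is the dense orbit in $\tau(G)$, and $\Sigma_{k,G}$ is the dense orbit in $\sigma_2(G)$.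
   Context: $G=\mathrm{Gr}(k,\mathbb C^N)\subset\mathbb P(\bigwedge^k\mathbb C^N)$ is the Grassmannian of $k$-dimensional subspaces in its Plücker embedding; $p=[v_1\wedge\dots\wedge v_k]$ corresponds to $H_p=\langle v_1,\dots,v_k\rangle$. $\mathrm{SL}(N)$ acts naturally on $\mathbb P(\bigwedge^k\mathbb C^N)$. $\sigma_2(G)$ is the Zariski closure of the set of points lying in the span of at most two points of $G$. $\tau(G)=\bigcup_{p\in G}T_pG$ with $T_pG$ the embedded projective tangent space, whose affine cone is $\hat T_pG=\bigwedge^{k-1}H_p\wedge\mathbb C^N$; $\hat T_pG/\langle p\rangle\simeq\mathrm{Hom}(H_p,\mathbb C^N/H_p)$. The Hamming distance $d(p,q)$ of $p\ne q$ in $G$ is the minimum $r$ for which there exist $p=p_0,\dots,p_r=q$ in $G$ such that each line $\langle p_i,p_{i+1}\rangle$ is contained in $G$. For $1\le l\le k$: $\Sigma_{l,G}$ is the set of points $[u+v]$ with $u,v$ nonzero decomposable vectors in $\bigwedge^k\mathbb C^N$ and $d([u],[v])=l$; $\Theta_{l,G}$ is the set of points $[t]\in\tau(G)$ such that, for some $p\in G$, $t\in\hat T_pG$ and the image of $t$ in $\mathrm{Hom}(H_p,\mathbb C^N/H_p)$ has rank $l$. Bars denote Zariski closure. *)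

(* Defs.v *)
From mathcomp Require Import all_boot all_order all_algebra.
From mathcomp Require Export classical_sets reals complex mpoly.

Set Implicit Arguments.
Unset Strict Implicit.
Unset Printing Implicit Defensive.

Import GRing.Theory.
Local Open Scope ring_scope.
Local Open Scope classical_set_scope.

Section Grassmannian.
Variables (K : fieldType) (k N : nat).

(* The standard basis of the k-th exterior power of K^N is indexed by the
   increasing k-tuples i_1 < ... < i_k; there are 'C(N, k) of them by
   card_ltn_sorted_tuples. *)
Definition incr_tuples : {set k.-tuple 'I_N} :=
  [set t : k.-tuple 'I_N | sorted ltn [seq val i | i <- t]]%SET.

Definition idx (a : 'I_#|incr_tuples|) : 'I_k -> 'I_N := tnth (enum_val a).

Definition extpow := 'rV[K]_#|incr_tuples|.

(* v_1 /\ ... /\ v_k for the rows v_1, ..., v_k of M: its coordinates in the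
   standard basis are the maximal minors of M. *)
Definition wedge (M : 'M[K]_(k, N)) : extpow := \row_a \det (colsub (idx a) M).

Definition decomposable (u : extpow) : Prop := exists M, u = wedge M.

(* The action of g on the exterior power is the linear map sending
   e_{i_1} /\ ... /\ e_{i_k} to g e_{i_1} /\ ... /\ g e_{i_k}.  Vectors are
   stored as rows, so g e_i is the i-th row of g^T. *)
Definition extpow_mx (g : 'M[K]_N) : 'M[K]_#|incr_tuples| :=
  \matrix_a wedge (rowsub (idx a) g^T).

Definition extpow_act (g : 'M[K]_N) : 'End(extpow) :=
  linfun (mulmxr (extpow_mx g)).

(* Points of the projective space P(extpow) are the one-dimensional subspaces
   L of extpow, so [v] is <[v]>%VS for nonzero v; subsets of P(extpow) are sets
   of such subspaces. *)
Definition is_point (L : {vspace extpow}) : Prop := \dim L = 1%N.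

Definition is_SL_orbit (A : set {vspace extpow}) : Prop :=
  exists2 L, is_point L &
    A = [set (extpow_act g @: L)%VS | g in [set g | \det g = 1]].

Definition zariski_closed (Z : set {vspace extpow}) : Prop :=
  exists2 F : set {mpoly K[#|incr_tuples|]},
    (forall f, F f -> exists d, f \is d.-homog) &
    Z = [set L | is_point L /\
                 forall f x, F f -> x \in L -> f.@[fun a => x 0 a] = 0].

Definition zclosure (A : set {vspace extpow}) : set {vspace extpow} :=
  smallest zariski_closed A.

(* H_p is represented by a matrix M whose rows form a basis of it. *)
Definition Gr : set {vspace extpow} :=
  [set <[wedge M]>%VS | M in [set M : 'M[K]_(k, N) | row_free M]].

Definition sigma2 : set {vspace extpow} :=
  zclosure [set L | is_point L /\
                    exists p q, [/\ Gr p, Gr q & (L <= p + q)%VS]].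

Definition linear_span (A : set extpow) : set extpow :=
  [set x | forall U : {vspace extpow}, (forall a, A a -> a \in U) -> x \in U].

(* The affine cone over the tangent space at p = [wedge M], that is, the
   product of the (k-1)-st exterior power of H_p with K^N: it is spanned by the
   wedges of k vectors all of which, except perhaps the last, lie in H_p. *)
Definition tangent_cone (M : 'M[K]_(k, N)) : set extpow :=
  linear_span [set wedge A | A in [set A : 'M[K]_(k, N) |
    forall i : 'I_k, (i.+1 < k)%N -> (row i A <= M)%MS]].

Definition tau : set {vspace extpow} :=
  [set L | is_point L /\
           exists2 M : 'M[K]_(k, N), row_free M &
             forall t, t \in L -> tangent_cone M t].

(* For M with rows v_1, ..., v_k and W with rows w_1, ..., w_k:
   \sum_i v_1 /\ ... /\ w_i /\ ... /\ v_k, with w_i in place of v_i. *)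
Definition tangent_vector (M W : 'M[K]_(k, N)) : extpow :=
  \sum_(i < k) wedge (\matrix_(j < k) row j (if j == i then W else M)).

(* The isomorphism from the tangent cone modulo p onto Hom(H_p, K^N / H_p) is
   induced by tangent_vector M W |-> (v_i |-> w_i mod H_p).  The quotient
   K^N / H_p is realized as the image of cokermx M, whose kernel (acting on
   rows) is the row space H_p of M; the i-th row of phi is the image of v_i. *)
Definition tangent_hom (M : 'M[K]_(k, N)) (t : extpow) (phi : 'M[K]_(k, N)) :=
  exists2 W, t = tangent_vector M W & phi = W *m cokermx M.

Definition line_in_Gr (p q : {vspace extpow}) : Prop :=
  forall L, is_point L -> (L <= p + q)%VS -> Gr L.

Definition line_chain (p q : {vspace extpow}) (r : nat) : Prop :=
  exists c : nat -> {vspace extpow},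
    [/\ c 0%N = p, c r = q,
        forall i, (i <= r)%N -> Gr (c i) &
        forall i, (i < r)%N -> c i <> c i.+1 /\ line_in_Gr (c i) (c i.+1)].

(* d(p, q) = r *)
Definition hamming_dist (p q : {vspace extpow}) (r : nat) : Prop :=
  [/\ p <> q, line_chain p q r &
      forall r', line_chain p q r' -> (r <= r')%N].

Definition Sigma (l : nat) : set {vspace extpow} :=
  [set L | exists u v,
     [/\ decomposable u /\ u <> 0, decomposable v /\ v <> 0,
         hamming_dist <[u]>%VS <[v]>%VS l & L = <[u + v]>%VS]].

Definition Theta (l : nat) : set {vspace extpow} :=
  [set L | tau L /\
     exists M t phi,
       [/\ row_free M, L = <[t]>%VS, tangent_cone M t,
           tangent_hom M t phi & \rank phi = l]].

Definition strata : seq (set {vspace extpow}) :=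
  Gr :: [seq Sigma l | l <- index_iota 2 k.+1]
     ++ [seq Theta l | l <- index_iota 3 k.+1].

Definition is_dense_orbit (O X : set {vspace extpow}) : Prop :=
  [/\ is_SL_orbit O, O `<=` X & X `<=` zclosure O].

End Grassmannian.

(* Main.v *)
From HB Require Import structures.
Require Import Defs.
From mathcomp Require Import all_boot all_order all_algebra fingroup perm.
From mathcomp Require Import boolp classical_sets reals complex mpoly fraction zify ring.

(** A vector t of the exterior power is studied through the alternating form
    C |-> <t, C> on k covectors, which for t = v_1 /\ ... /\ v_k is det (M C).
    The covectors which annihilate this form have codimension k on G and k + l on
    Sigma_l and Theta_l when l >= 2.  If t is tangent at p, then <t, C> vanishes as
    soon as two of the covectors vanish on H_p; this is never the case on Sigma_l
    with l >= 3.  So the strata are disjoint, and bases adapted to the pair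
    (H_u, H_v), respectively to H_p and the map H_p -> K^N / H_p, show that each of
    them is an orbit; the inclusions between closures come from explicit curves.

    The main point is that every point t of the Zariski closure of the secants is
    on a secant or on a tangent.  Let F be the fraction field of the polynomials in
    the entries of two generic matrices M and M'.  Polynomial identities between the
    coordinates of the generic secant point wedge M + wedge M' hold at t, so mapping
    these coordinates to those of t defines a ring morphism, which extends to a
    K-valued place of F (Chevalley).  After normalizing M and M' at a minor of
    largest valuation, the point becomes a wedge M + b wedge M' with integral M and
    M'.  If a and b are integral, t is on the secant through the reductions of M and
    M'.  Otherwise both matrices reduce, up to a unit, to the same A, and expanding
    wedge (M + (M' - M)) shows that t is tangent at A.  The same argument applied to
    a generic tangent vector shows that tau is closed, hence that Theta_k is not
    dense in sigma_2. *)

Set Implicit Arguments.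
Unset Strict Implicit.
Unset Printing Implicit Defensive.

Import Order.TTheory GRing.Theory Num.Theory.
Local Open Scope ring_scope.
Local Open Scope classical_set_scope.

(** * Places *)

(** The dimension of the support takes the same value on Sigma_l and Theta_l, so every step that
    must tell these two apart, disjointness as well as the uniqueness of the dense orbit of sigma_2,
    goes through tangency. A bound on this dimension is given by minors, hence passes to closures;
    this distinguishes the dense orbit of tau from the other orbits in it. Where l >= 2 is required,
    the reason is that for l = 1 the sum of the two wedges is again decomposable, with support of
    dimension k instead of k + 1. A point of a Zariski closure comes with no curve leading to it,
    and a place supplies the limit instead. All that it offers is that at least one of x and 1 / x
    has a value; this is enough, because only finitely many minors and the two coefficients of the
    secant have to be compared. Orbits are computed for GL, since the normal forms only give
    invertible matrices; on lines GL and SL have the same orbits because the base field has N-th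
    roots. *)

Section Places.
Variables (F : fieldType) (K : closedFieldType).
Implicit Types (G : set (F * K)) (x y : F) (c d : K).

(** The graph of a ring morphism to K from a subring of F. Encoding the subring and the morphism in
    one set turns extension into inclusion, as Zorn's lemma wants; the last clause makes the values
    unique. *)
Definition partial_hom G :=
  [/\ G (1, 1),
      forall x c y d, G (x, c) -> G (y, d) -> G (x - y, c - d),
      forall x c y d, G (x, c) -> G (y, d) -> G (x * y, c * d) &
      forall c, G (0, c) -> c = 0].

(* G is the graph of a K-valued place: an x without a finite value is infinite,
   in the sense that its inverse has the value 0. *)
Definition place G :=
  partial_hom G /\ forall x, (exists c, G (x, c)) \/ G (x^-1, 0).

Section PartialHom.
Variables (G : set (F * K)) (hG : partial_hom G).

Lemma phom1 : G (1, 1). Proof. by case: hG. Qed.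
Lemma phomB x c y d : G (x, c) -> G (y, d) -> G (x - y, c - d).
Proof. by case: hG => _ h _ _; apply: h. Qed.
Lemma phomM x c y d : G (x, c) -> G (y, d) -> G (x * y, c * d).
Proof. by case: hG => _ _ h _; apply: h. Qed.
Lemma phom_eq0 c : G (0, c) -> c = 0. Proof. by case: hG => _ _ _; apply. Qed.
Lemma phom0 : G (0, 0).
Proof. by have := phomB phom1 phom1; rewrite !subrr. Qed.
Lemma phomN x c : G (x, c) -> G (- x, - c).
Proof. by move=> h; have := phomB phom0 h; rewrite !sub0r. Qed.
Lemma phomD x c y d : G (x, c) -> G (y, d) -> G (x + y, c + d).
Proof. by move=> h1 h2; have := phomB h1 (phomN h2); rewrite !opprK. Qed.
Lemma phom_inj x c d : G (x, c) -> G (x, d) -> c = d.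
Proof.
by move=> h1 h2; apply/eqP; rewrite -subr_eq0; apply/eqP/phom_eq0;
   have := phomB h1 h2; rewrite subrr.
Qed.
Lemma phomX x c n : G (x, c) -> G (x ^+ n, c ^+ n).
Proof.
move=> h; elim: n => [|n IH]; first by rewrite !expr0; exact: phom1.
by rewrite !exprS; apply: phomM.
Qed.
Lemma phom_sum I (r : seq I) (P : pred I) (f : I -> F) (g : I -> K) :
  (forall i, P i -> G (f i, g i)) ->
  G (\sum_(i <- r | P i) f i, \sum_(i <- r | P i) g i).
Proof.
move=> h; elim/big_rec2: _ => [|i x y Pi IH]; first exact: phom0.
exact: phomD (h i Pi) IH.
Qed.
Lemma phom_prod I (r : seq I) (P : pred I) (f : I -> F) (g : I -> K) :
  (forall i, P i -> G (f i, g i)) ->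
  G (\prod_(i <- r | P i) f i, \prod_(i <- r | P i) g i).
Proof.
move=> h; elim/big_rec2: _ => [|i x y Pi IH]; first exact: phom1.
exact: phomM (h i Pi) IH.
Qed.

Definition phom_poly (P : {poly F}) (p : {poly K}) := forall i, G (P`_i, p`_i).

Lemma phom_polyB P p Q q :
  phom_poly P p -> phom_poly Q q -> phom_poly (P - Q) (p - q).
Proof. by move=> h1 h2 i; rewrite !coefB; apply: phomB. Qed.

Lemma phom_polyM P p Q q :
  phom_poly P p -> phom_poly Q q -> phom_poly (P * Q) (p * q).
Proof. by move=> h1 h2 i; rewrite !coefM; apply: phom_sum => j _; apply: phomM. Qed.

Lemma phom_polyC x c : G (x, c) -> phom_poly x%:P c%:P.
Proof. by move=> h i; rewrite !coefC; case: ifP => // _; exact: phom0. Qed.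

Lemma phom_polyXn n : phom_poly 'X^n 'X^n.
Proof.
move=> i; rewrite !coefXn; case: eqP => _; [exact: phom1|exact: phom0].
Qed.

(* The ideal of k[X] obtained by reducing the polynomials which vanish at x,
   where k is the field of values of G. *)
Definition relations x : set {poly K} :=
  [set p | exists2 P, phom_poly P p & P.[x] = 0].

Lemma relationsB x p q : relations x p -> relations x q -> relations x (p - q).
Proof.
move=> [P h1 e1] [Q h2 e2]; exists (P - Q); first exact: phom_polyB.
by rewrite hornerD hornerN e1 e2 subrr.
Qed.

Lemma relationsM x p q : (exists Q, phom_poly Q q) -> relations x p ->
  relations x (q * p).
Proof.
move=> [Q h1] [P h2 e]; exists (Q * P); first exact: phom_polyM.
by rewrite hornerM e mulr0.
Qed.

(** The extension sends P.[x] to p.[c], where p is a reduction of P. The hypothesis says exactly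
    that 0 then has no value but 0, so that this is well defined. *)
Lemma extend_partial_hom x c : (forall p, relations x p -> root p c) ->
  exists2 G', partial_hom G' & G `<=` G' /\ G' (x, c).
Proof.
move=> h; exists [set z | exists P p, [/\ phom_poly P p, z.1 = P.[x] & z.2 = p.[c]]].
  split=> /=.
  - exists 1, 1; split; rewrite ?hornerE //.
    exact: (phom_polyXn 0).
  - move=> y d y' d' [P [p [h1 -> ->]]] [Q [q [h2 -> ->]]].
    exists (P - Q), (p - q); rewrite !hornerE; split=> //; exact: phom_polyB.
  - move=> y d y' d' [P [p [h1 -> ->]]] [Q [q [h2 -> ->]]].
    exists (P * Q), (p * q); rewrite !hornerE; split=> //; exact: phom_polyM.
  - move=> d [P [p [h1 e ->]]]; apply/eqP; apply: h; exists P => //.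
split.
  move=> [y d] Gyd; exists y%:P, d%:P; rewrite !hornerE; split=> //; exact: phom_polyC.
exists 'X, 'X; rewrite !hornerE; split=> //; exact: (phom_polyXn 1).
Qed.

End PartialHom.


Lemma maximal_partial_hom G0 : partial_hom G0 ->
  exists G, [/\ partial_hom G, G0 `<=` G &
    forall G', partial_hom G' -> G `<=` G' -> G' `<=` G].
Proof.
move=> h0.
(* The union with G0 takes care of the empty chain, whose union is empty. *)
have [|A [hA maxA]] := @Zorn_bigcup _ [set A | partial_hom (G0 `|` A)].
  move=> C CP totC; set U := \bigcup_(X in C) X.
  (* The closure properties involve at most two pairs, and these lie in a common member of the
     chain. *)
  have two z1 z2 : (G0 `|` U) z1 -> (G0 `|` U) z2 -> exists H,
      [/\ partial_hom H, H `<=` G0 `|` U, H z1 & H z2].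
    have sub X : C X -> G0 `|` X `<=` G0 `|` U.
      by move=> CX z [?|?]; [left|right; exists X].
    move=> [g1|[X1 C1 g1]] [g2|[X2 C2 g2]].
    - by exists G0; split=> // z ?; left.
    - by exists (G0 `|` X2); split; [exact: CP|exact: sub|left|right].
    - by exists (G0 `|` X1); split; [exact: CP|exact: sub|right|left].
    - have [s|s] := totC _ _ C1 C2.
      + by exists (G0 `|` X2); split; [exact: CP|exact: sub|right; apply: s|right].
      + by exists (G0 `|` X1); split; [exact: CP|exact: sub|right|right; apply: s].
  split.
  - by left; apply: phom1.
  - move=> x c y d z1 z2; have [H [hH HU H1 H2]] := two _ _ z1 z2.
    by apply: HU; apply: phomB.
  - move=> x c y d z1 z2; have [H [hH HU H1 H2]] := two _ _ z1 z2.
    by apply: HU; apply: phomM.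
  - move=> c z; have [H [hH _ H1 _]] := two _ _ z z.
    exact: phom_eq0 H1.
exists (G0 `|` A); split=> // G' hG' sG' z Gz.
apply: contrapT => nz; apply: (maxA G').
  split; first by move=> t At; apply: sG'; right.
  by move=> E; apply: nz; right; apply: E.
by rewrite /= (_ : G0 `|` G' = G') //; apply/setUidPr => t ht; apply: sG'; left.
Qed.

(** * Chevalley's theorem: a maximal partial morphism is a place *)

Section Maximal.
Variables (G : set (F * K)) (hG : partial_hom G).
Hypothesis maxG : forall G', partial_hom G' -> G `<=` G' -> G' `<=` G.

Lemma maximal_mem x c : (forall p, relations G x p -> root p c) -> G (x, c).
Proof.
move=> /(extend_partial_hom hG) [G' hG' [sG' G'x]]; exact: maxG G'x.
Qed.

(** If P.[x^-1] = 0, multiplication by x ^+ n clears the denominators and shows that 0 has the value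
    c ^+ n * p.[c^-1]. So c^-1 is a root of all relations of x^-1, and maximality applies. *)
Lemma maximal_inv x c : G (x, c) -> c != 0 -> G (x^-1, c^-1).
Proof.
move=> Gxc c0; apply: maximal_mem => p [P hP].
have x0 : x != 0 by apply: contraNneq c0 => x0; move: Gxc; rewrite x0 => /(phom_eq0 hG) ->.
pose n := maxn (size P) (size p).
rewrite (@horner_coef_wide _ n) ?leq_maxl // => E; apply/rootP.
rewrite (@horner_coef_wide _ n) ?leq_maxr //.
have: G (x ^+ n * \sum_(i < n) P`_i * x^-1 ^+ i, c ^+ n * \sum_(i < n) p`_i * c^-1 ^+ i).
  rewrite !big_distrr /=; apply: phom_sum => // i _.
  have aux (L : fieldType) (y a : L) : y != 0 -> y ^+ n * (a * y^-1 ^+ i) = y ^+ (n - i) * a.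
    move=> y0; rewrite mulrCA exprVn -expfB_cond ?(negPf y0) ?add0n 1?mulrC //.
    exact: ltnW.
  rewrite !aux //; apply: phomM => //; exact: phomX.
rewrite E mulr0 => /(phom_eq0 hG) /eqP; rewrite mulf_eq0 expf_eq0 (negPf c0) andbF /=.
by move/eqP.
Qed.

(** The values of G form a field by [maximal_inv], and the relations an ideal of polynomials over
    it. A relation of least size is not constant, so it has a root in K, and Euclidean division by
    it makes this a root of all relations. *)
Lemma relations_root x :
  (forall p, relations G x p -> (size p <= 1)%N -> p = 0) ->
  exists c, forall p, relations G x p -> root p c.
Proof.
move=> noconst.
have [zero|] := pselect (forall p, relations G x p -> p = 0).
  by exists 0 => p /zero ->; exact: root0.
move=> /existsNP [p0 /not_implyP [rp0 /eqP p00]].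
have [g [rg g0 ming]] : exists g, [/\ relations G x g, g != 0 &
    forall p, relations G x p -> p != 0 -> (size g <= size p)%N].
  pose Q n := `[< exists2 p, relations G x p & p != 0 /\ size p = n >].
  have exQ : exists n, Q n by exists (size p0); apply/asboolP; exists p0.
  case: (ex_minnP exQ) => n /asboolP [g rg [g0 sg]] minn.
  exists g; split=> // p rp pn0; rewrite sg; apply: minn; apply/asboolP.
  by exists p.
have sg1 : size g != 1%N.
  by apply/eqP => sg; move/eqP: g0; apply; apply: noconst; rewrite ?sg.
have /closed_rootP [c rc] := sg1; exists c => p.
have [n] := ubnP (size p); elim: n p => // n IH p; rewrite ltnS => sp rp.
have [->|pn0] := eqVneq p 0; first exact: root0.
have sgp := ming _ rp pn0.
pose e := lead_coef p / lead_coef g.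
pose q := e%:P * 'X^(size p - size g) * g.
have lg0 : lead_coef g != 0 by rewrite lead_coef_eq0.
(* The division must stay over the field of values: the quotient of the leading coefficients is a
   value of G, as both of them are. *)
have rq : relations G x q.
  apply: relationsM => //.
  have [P hP _] := rp; have [P' hP' _] := rg.
  exists ((P`_(size p).-1 / P'`_(size g).-1)%:P * 'X^(size p - size g)).
  apply: phom_polyM => //; last exact: phom_polyXn.
  by apply: phom_polyC => //; apply: phomM => //; apply: maximal_inv.
have szq : (size (p - q)%R < size p)%N.
  have sX : size ('X^(size p - size g) * g) = size p.
    by rewrite size_monicM ?monicXn // size_polyXn addSn subnK.
  have sq : (size q <= size p)%N.
    by rewrite /q -mulrA mul_polyC (leq_trans (size_scale_leq _ _)) ?sX.
  have : (size (p - q)%R <= size p)%N.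
    by rewrite (leq_trans (size_polyD _ _)) // size_polyN geq_max leqnn.
  rewrite leq_eqVlt => /orP [/eqP E|//].
  have : lead_coef (p - q) = 0.
    rewrite lead_coefE E coefB -lead_coefE.
    rewrite /q -mulrA coefCM -[in X in _`_X.-1]sX -lead_coefE.
    by rewrite lead_coefM lead_coefXn mul1r divfK // subrr.
  move/eqP; rewrite lead_coef_eq0 => /eqP E0.
  by rewrite E0 size_poly0 lt0n size_poly_eq0.
have := IH (p - q) (leq_trans szq sp) (relationsB hG rp rq).
rewrite /root hornerD hornerN /q hornerM (rootP rc) mulr0 oppr0 addr0.
by [].
Qed.

(* The ideal generated by the kernel of G in G[x] contains 1. *)
Definition unit_relation x n :=
  exists m : {poly F}, [/\ phom_poly G m 0, (size m <= n.+1)%N & m.[x] = 1].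

(** If P.[x] = 0 and P reduces to a constant c <> 0, then P[_0 is invertible with an inverse that
    has a value, and all coefficients of 1 - P / P]_0 have the value 0. *)
Lemma unit_relationP x :
  (exists c, forall p, relations G x p -> root p c) \/ exists n, unit_relation x n.
Proof.
have [h|] := pselect (forall p, relations G x p -> (size p <= 1)%N -> p = 0).
  by left; apply: relations_root.
move=> /existsNP [p /not_implyP [[P hP e] /not_implyP [/size1_polyC sp p0]]]; right.
set c := p`_0 in sp.
have c0 : c != 0 by apply/eqP => c0; apply: p0; rewrite sp c0.
have Pc : G (P`_0, c) by apply: hP.
have Pn0 : P`_0 != 0 by apply: contraNneq c0 => E; move: Pc; rewrite E => /(phom_eq0 hG) ->.
exists (size P), (1 - (P`_0)^-1 *: P); split.
- move=> i; rewrite coefB coefZ coef1 coef0.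
  have -> : 0 = (i == 0)%:R - c^-1 * p`_i.
    by rewrite sp coefC; case: eqP; rewrite ?mulr0 ?subrr // mulVf ?subrr.
  apply: phomB => //; first by case: eqP => _; [exact: phom1|exact: phom0].
  by apply: phomM => //; apply: maximal_inv.
- rewrite (leq_trans (size_polyD _ _)) // size_polyN size_poly1 geq_max /=.
  by rewrite (leq_trans (size_scale_leq _ _)).
- by rewrite hornerD hornerN hornerZ e mulr0 subr0 hornerC.
Qed.

Lemma unit_relation_lower x n n' : x != 0 -> (n' <= n)%N -> (0 < n)%N ->
  unit_relation x n -> unit_relation x^-1 n' -> unit_relation x n.-1.
Proof.
move=> x0 le n0 [m [hm sm em]] [v [hv sv ev]].
(* The constant term of 1 - v is a unit, so v.[x^-1] = 1 expresses x ^+ n through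
   lower powers of x, which eliminates the top term of the relation for x. *)
have G1v : G (1 - v`_0, 1).
  rewrite -[X in G (_, X)]subr0; apply: phomB => //; first exact: phom1.
  by have := hv 0; rewrite coef0.
have v10 : 1 - v`_0 != 0.
  by apply/eqP => E; move: G1v; rewrite E => /(phom_eq0 hG) /eqP; rewrite oner_eq0.
pose w j := v`_j / (1 - v`_0).
have Gw j : G (w j, 0).
  rewrite -(mul0r (1 : K)^-1); apply: phomM => //; first by have := hv j; rewrite coef0.
  by apply: maximal_inv; rewrite ?oner_eq0.
have e1 : \sum_(j < n') w j.+1 * x^-1 ^+ j.+1 = 1.
  rewrite /w; under eq_bigr do rewrite mulrAC; rewrite -mulr_suml.
  move: ev; rewrite (horner_coef_wide _ sv) big_ord_recl expr0 mulr1 => ev.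
  by rewrite -[X in X / _](addKr v`_0) [X in (- _ + X) / _]ev addrC divff.
have Sn : \sum_(j < n') w j.+1 * x ^+ (n - j.+1) = x ^+ n.
  rewrite -[RHS]mulr1 -e1 mulr_sumr; apply: eq_bigr => j _.
  rewrite mulrCA exprVn -expfB_cond ?(negPf x0) ?add0n //.
  exact: leq_trans (ltn_ord j) le.
exists (\poly_(i < n) m`_i + m`_n *: \sum_(j < n') w j.+1 *: 'X^(n - j.+1)); split.
- move=> i; rewrite coefD coefZ coef_sum coef_poly coef0.
  rewrite -[X in G (_, X)]addr0; apply: phomD => //.
    case: ifP => _; last exact: phom0.
    by have := hm i; rewrite coef0.
  rewrite -(mulr0 (0 : K)); apply: phomM => //; first by have := hm n; rewrite coef0.
  have -> : (0 : K) = \sum_(j < n') 0 * ((i == (n - j.+1)%N)%:R) by rewrite big1 // => j _; rewrite mul0r.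
  apply: phom_sum => // j _; rewrite coefZ coefXn; apply: phomM => //.
  by case: eqP => _; [exact: phom1|exact: phom0].
- rewrite prednK // (leq_trans (size_polyD _ _)) // geq_max size_poly /=.
  rewrite (leq_trans (size_scale_leq _ _)) //; apply: (leq_trans (size_sum _ _ _)).
  apply/bigmax_leqP => j _; rewrite (leq_trans (size_scale_leq _ _)) // size_polyXn.
  by rewrite ltn_subrL n0.
- rewrite hornerD hornerZ horner_sum.
  under eq_bigr do rewrite hornerZ hornerXn.
  rewrite Sn -em (horner_coef_wide _ sm) big_ord_recr /=; congr (_ + _).
  by rewrite horner_poly.
Qed.

(** The longer of the two relations can be shortened by means of the other one. At length 0 the
    element 1 itself would have the value 0. *)
Lemma no_unit_relations x n n' : x != 0 ->
  unit_relation x n -> unit_relation x^-1 n' -> False.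
Proof.
have [s] := ubnP (n + n'); elim: s x n n' => // s IH x n n'; rewrite ltnS => les x0.
wlog le : x n n' les x0 / (n' <= n)%N.
  move=> wl u u'; have [h|/ltnW h] := leqP n' n; first exact: wl u u'.
  apply: (wl x^-1 n' n); rewrite ?invr_eq0 1?addnC ?invrK //.
move=> u u'; have [n0|n0] := posnP n; last first.
  apply: (IH x n.-1 n') => //; last exact: unit_relation_lower le n0 u u'.
  by apply: leq_trans les; rewrite ltn_add2r prednK.
move: u; rewrite n0 => -[m [hm /size1_polyC sm]]; rewrite sm hornerC => e.
have := hm 0; rewrite e coef0 => /(phom_inj hG (phom1 hG)) /eqP.
by rewrite oner_eq0.
Qed.

(** One of x and x^-1 gets a value. A nonzero value of x^-1 can be inverted, so x lacks a value only
    if that of x^-1 is 0. *)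
Lemma maximal_place : place G.
Proof.
split=> // x.
have [->|x0] := eqVneq x 0; first by left; exists 0; exact: phom0.
have [[c hc]|[n u]] := unit_relationP x; first by left; exists c; exact: maximal_mem.
have [[c hc]|[n' u']] := unit_relationP x^-1; last by case: (no_unit_relations x0 u u').
have Gc := maximal_mem hc.
have [c0|c0] := eqVneq c 0; first by right; rewrite -c0.
by left; exists c^-1; rewrite -[x]invrK; exact: maximal_inv.
Qed.

End Maximal.

Lemma place_extension G0 : partial_hom G0 -> exists2 G, place G & G0 `<=` G.
Proof.
by move=> /maximal_partial_hom [G [hG s maxG]]; exists G => //; exact: maximal_place.
Qed.

End Places.

(** * Minors and the Cauchy-Binet formula *)

Section CauchyBinet.
Variables (R : comNzRingType) (k N : nat).
Implicit Types (M : 'M[R]_(k, N)) (C : 'M[R]_(N, k)).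

Lemma idx_inj (a : 'I_#|incr_tuples k N|) : injective (idx a).
Proof.
have := enum_valP a; rewrite inE => s_sorted.
have u : uniq (enum_val a).
  have : uniq [seq val i | i <- enum_val a].
    apply: (sorted_uniq _ _ s_sorted); [exact: ltn_trans|exact: ltnn].
  exact: map_uniq.
exact/tuple_uniqP.
Qed.

Lemma codom_idx (a : 'I_#|incr_tuples k N|) : codom (idx a) = enum_val a.
Proof. by rewrite codomE -map_tnth_enum. Qed.

Lemma idx_image_inj (a b : 'I_#|incr_tuples k N|) :
  idx a @: 'I_k = idx b @: 'I_k -> a = b.
Proof.
move=> E; apply: enum_val_inj; apply/val_inj => /=.
apply: (inj_map val_inj); apply: (irr_sorted_eq ltn_trans ltnn).
- by have := enum_valP a; rewrite inE.
- by have := enum_valP b; rewrite inE.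
suff mem_idx (c : 'I_#|incr_tuples k N|) x : (x \in map val (enum_val c)) = [exists y in idx c @: 'I_k, x == val y].
  by move=> x; rewrite !mem_idx E.
apply/mapP/exists_inP => [[y yc ->]|[_ /imsetP [i _ ->] /eqP ->]].
  move: yc; rewrite -codom_idx => /codomP [i ->]; exists (idx c i) => //.
  exact: imset_f.
by exists (idx c i) => //; rewrite -codom_idx codom_f.
Qed.

(** Every injection of ['I_k] into ['I_N] is in a unique way a permutation followed by an increasing
    tuple, which is found by sorting its values. *)
Definition idx_perm (p : 'I_#|incr_tuples k N| * 'S_k) : {ffun 'I_k -> 'I_N} :=
  [ffun i => idx p.1 (p.2 i)].

Lemma idx_perm_inj : injective idx_perm.
Proof.
move=> [a s] [b t] E.
have img (c : 'I_#|incr_tuples k N|) (u : 'S_k) : idx_perm (c, u) @: 'I_k = idx c @: 'I_k.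
  apply/setP => x; apply/imsetP/imsetP => [[i _ ->]|[i _ ->]].
    by exists (u i); rewrite ?ffunE.
  by exists ((u^-1)%g i); rewrite ?ffunE //= permKV.
have ab : a = b by apply: idx_image_inj; rewrite -(img _ s) -(img _ t) E.
subst b; congr (_, _); apply/permP => i.
by move/ffunP: E => /(_ i); rewrite !ffunE => /idx_inj.
Qed.

Lemma idx_perm_image : idx_perm @: {: 'I_#|incr_tuples k N| * 'S_k} = [set f : {ffun _} | injectiveb f]%SET.
Proof.
apply/setP => f; rewrite inE; apply/imsetP/injectiveP => [[[a s] _ ->] i j|injf].
  by rewrite !ffunE /= => /idx_inj/perm_inj.
pose r := sort (fun x y : 'I_N => x <= y)%N (codom f).
have szr : size r == k by rewrite size_sort size_codom card_ord.
have ur : uniq r by rewrite sort_uniq; apply/injectiveP.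
have sr : sorted ltn [seq val i | i <- r].
  rewrite ltn_sorted_uniq_leq (map_inj_uniq val_inj) ur /= sorted_map.
  by apply: sort_sorted => x y; exact: leq_total.
have rI : Tuple szr \in incr_tuples k N by rewrite inE.
pose a := enum_rank_in rI (Tuple szr).
have Ea : enum_val a = Tuple szr by rewrite enum_rankK_in.
have fr i : f i \in codom (idx a).
  by rewrite codom_idx Ea mem_sort codom_f.
pose s i := iinv (fr i).
have sP i : idx a (s i) = f i by exact: f_iinv.
have s_inj : injective s by move=> i j E; apply: injf; rewrite -!sP E.
exists (a, perm s_inj) => //; apply/ffunP => i; rewrite ffunE /= permE.
by rewrite sP.
Qed.

Lemma det_alternate_rows n (A : 'M[R]_n) i j : i != j -> row i A = row j A -> \det A = 0.
Proof.
move=> ij E; apply: (determinant_alternate ij) => l.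
by move/rowP: E => /(_ l); rewrite !mxE.
Qed.

(** By multilinearity the determinant is a sum over all maps f from rows to columns. A map that is
    not injective repeats a row of C; the others are grouped by their increasing tuple through
    [idx_perm]. *)
Lemma Cauchy_Binet M C :
  \det (M *m C) =
  \sum_(a < #|incr_tuples k N|) \det (colsub (idx a) M) * \det (rowsub (idx a) C).
Proof.
transitivity (\sum_(f : {ffun 'I_k -> 'I_N}) (\prod_i M i (f i)) * \det (rowsub f C)).
  rewrite /determinant; under [RHS]eq_bigr do rewrite big_distrr /=.
  rewrite exchange_big; apply: eq_bigr => /= s _.
  under [RHS]eq_bigr do rewrite mulrCA; rewrite -big_distrr /=; congr (_ * _).
  transitivity (\prod_i \sum_j (M i j * C j (s i))).
    by apply: eq_bigr => i _; rewrite mxE.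
  rewrite bigA_distr_bigA /=; apply: eq_bigr => f _; rewrite big_split /=.
  by congr (_ * _); apply: eq_bigr => i _; rewrite mxE.
rewrite (bigID (fun f : {ffun _} => injectiveb f)) /= addrC big1 ?add0r; last first.
  move=> f /injectivePn [i [j ij E]].
  rewrite (det_alternate_rows ij) ?mulr0 //.
  by apply/rowP => l; rewrite !mxE E.
rewrite (eq_bigl (mem [set f : {ffun _} | injectiveb f]%SET)); last by move=> f; rewrite /= inE.
rewrite -idx_perm_image big_imset /=; last by move=> p q _ _; exact: idx_perm_inj.
rewrite (eq_bigl xpredT); last by move=> p; rewrite inE.
rewrite -(pair_bigA _ (fun a s => (\prod_i M i (idx_perm (a, s) i)) * \det (rowsub (idx_perm (a, s)) C))) /=.
apply: eq_bigr => a _; rewrite /determinant [in RHS]big_distrl /=.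
apply: eq_bigr => s _; rewrite -/(determinant _).
have -> : rowsub (idx_perm (a, s)) C = row_perm s (rowsub (idx a) C).
  by apply/matrixP => i j; rewrite !mxE ffunE.
rewrite row_permE det_mulmx det_perm mulrCA mulrA; congr (_ * _ * _).
by apply: eq_bigr => i _; rewrite mxE ffunE.
Qed.

End CauchyBinet.

Section DeterminantExpansion.
Variables (R : comNzRingType) (k : nat).

Definition mixrows n (J : {set 'I_k}) (A B : 'M[R]_(k, n)) : 'M[R]_(k, n) :=
  \matrix_(i, j) if i \in J then B i j else A i j.

Lemma mixrows_mulmx n m (J : {set 'I_k}) (A B : 'M[R]_(k, n)) (C : 'M[R]_(n, m)) :
  mixrows J A B *m C = mixrows J (A *m C) (B *m C).
Proof.
apply/matrixP => i j; rewrite !mxE; case: ifP => iJ; rewrite ?mxE;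
  by apply: eq_bigr => l _; rewrite !mxE iJ.
Qed.

Lemma det_addmx (A B : 'M[R]_k) : \det (A + B) = \sum_J \det (mixrows J A B).
Proof.
rewrite /determinant exchange_big /=; apply: eq_bigr => s _.
rewrite -big_distrr /=; congr (_ * _).
under eq_bigr do rewrite mxE addrC.
by rewrite bigA_distr; apply: eq_bigr => J _; apply: eq_bigr => i _; rewrite mxE.
Qed.
End DeterminantExpansion.

(** * Alternating forms *)

Section Differential.
Variables (R : comNzRingType) (k : nat).
Implicit Types (A B P : 'M[R]_k).

Definition repl_row n (i : 'I_k) (A B : 'M[R]_(k, n)) : 'M[R]_(k, n) :=
  \matrix_(j < k) row j (if j == i then B else A).

Lemma repl_rowE n i (A B : 'M[R]_(k, n)) : repl_row i A B = mixrows [set i]%SET A B.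
Proof. by apply/matrixP => a b; rewrite !mxE inE; case: ifP. Qed.

(* The differential of the determinant at A, in the direction B. *)
Definition ddet A B : R := \sum_i \det (repl_row i A B).

(** Jacobi's formula: expansion along the replaced row i gives the i-th diagonal entry of B *m \adj
    A. *)
Lemma ddetE A B : ddet A B = \tr (B *m \adj A).
Proof.
rewrite /ddet /mxtrace; apply: eq_bigr => i _.
rewrite (expand_det_row _ i) mxE; apply: eq_bigr => j _.
rewrite !mxE eqxx; congr (_ * _); rewrite /cofactor; congr (_ * \det _).
by apply/matrixP => a b; rewrite !mxE eq_sym (negPf (neq_lift _ _)).
Qed.

Lemma ddet_tr A B : ddet A^T B^T = ddet A B.
Proof. by rewrite !ddetE -trmx_adj -trmx_mul mxtrace_tr mxtrace_mulC. Qed.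

Lemma det_mixrowsZ (J : {set 'I_k}) A B (x : R) :
  \det (mixrows J A (x *: B)) = x ^+ #|J| * \det (mixrows J A B).
Proof.
have -> : mixrows J A (x *: B) = diag_mx (\row_i if i \in J then x else 1) *m mixrows J A B.
  by rewrite mul_diag_mx; apply/matrixP => i j; rewrite !mxE; case: ifP; rewrite ?mul1r.
rewrite det_mulmx det_diag; congr (_ * _).
by under eq_bigr do rewrite mxE; rewrite -big_mkcond prodr_const.
Qed.

Lemma map_mixrows (S : comNzRingType) (f : R -> S) n (J : {set 'I_k}) (A B : 'M[R]_(k, n)) :
  map_mx f (mixrows J A B) = mixrows J (map_mx f A) (map_mx f B).
Proof. by apply/matrixP => i j; rewrite !mxE; case: ifP. Qed.

End Differential.

(** In the expansion over sets J of replaced rows, J carries 'X ^+ #|J|, so only singletons remain.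
    Identities of determinants thus give identities of [ddet]. *)
Lemma coef1_det_pencil (R : comNzRingType) k (A B : 'M[R]_k) :
  (\det (map_mx polyC A + 'X *: map_mx polyC B))`_1 = ddet A B.
Proof.
rewrite det_addmx coef_sum.
under eq_bigr => J _ do rewrite det_mixrowsZ -map_mixrows det_map_mx coefMC coefXn.
rewrite (bigID (fun J : {set 'I_k} => #|J| == 1%N)) /= [X in _ + X]big1 ?addr0; last first.
  by move=> J /negPf; rewrite eq_sym => ->; rewrite mul0r.
rewrite (eq_bigl (mem [set [set i]%SET | i : 'I_k]%SET)); last first.
  move=> J /=; apply/cards1P/imsetP => [[i ->]|[i _ ->]]; by exists i.
rewrite big_imset /=; last by move=> i j _ _; exact: set1_inj.
by apply: eq_bigr => i _; rewrite cards1 eqxx mul1r repl_rowE.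
Qed.

Section DifferentialTheory.
Variables (R : comNzRingType) (k : nat).
Implicit Types (A B P : 'M[R]_k).

Lemma ddet_mull P A B : ddet (P *m A) (P *m B) = \det P * ddet A B.
Proof.
rewrite -!coef1_det_pencil !map_mxM /= scalemxAr -mulmxDr det_mulmx det_map_mx.
by rewrite coefCM.
Qed.

Lemma ddet_same A P : ddet A (P *m A) = \tr P * \det A.
Proof.
rewrite ddetE -mulmxA mul_mx_adj -scalemx1 -scalemxAr mulmx1 mxtraceZ.
by rewrite mulrC.
Qed.

Definition repl_col n (j : 'I_k) (A B : 'M[R]_(n, k)) : 'M[R]_(n, k) :=
  (repl_row j A^T B^T)^T.

(** By transposition columns may be replaced instead of rows, and the zero column j survives unless
    it is the one replaced. *)
Lemma ddet_col0 A B j : col j A = 0 -> ddet A B = \det (repl_col j A B).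
Proof.
move=> A0; rewrite -ddet_tr /ddet (bigD1 j) //= big1 ?addr0 ?det_tr // => i ij.
rewrite (expand_det_row _ j) big1 // => l _; rewrite !mxE (negPf (_ : j != i)) 1?eq_sym //.
by move/colP: A0 => /(_ l); rewrite !mxE => ->; rewrite mul0r.
Qed.

End DifferentialTheory.

(** * Vectors of the exterior power as alternating forms on covectors *)

Section Pairing.
Variables (K : fieldType) (k N : nat).
Local Notation extpow := (extpow K k N).
Implicit Types (t u : extpow) (M W : 'M[K]_(k, N)) (C : 'M[K]_(N, k)) (g : 'M[K]_N).

(* The value of t, seen as an alternating k-form on the dual of K^N, at the
   columns of C. *)
Definition pairing t C : K := \sum_a t 0 a * \det (rowsub (idx a) C).

Lemma pairing_is_linear C : linear (fun t => pairing t C : K^o).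
Proof.
move=> c t u; rewrite /pairing scaler_sumr -big_split /=; apply: eq_bigr => a _.
by rewrite !mxE mulrDl -mulrA.
Qed.

Lemma pairingD t u C : pairing (t + u) C = pairing t C + pairing u C.
Proof. by have := pairing_is_linear C 1 t u; rewrite !scale1r. Qed.
Lemma pairing0 C : pairing 0 C = 0.
Proof. by rewrite /pairing big1 // => a _; rewrite mxE mul0r. Qed.
Lemma pairingZ c t C : pairing (c *: t) C = c * pairing t C.
Proof. by have := pairing_is_linear C c t 0; rewrite !addr0 pairing0 addr0. Qed.
Lemma pairing_sum I (r : seq I) (P : pred I) (f : I -> extpow) C :
  pairing (\sum_(i <- r | P i) f i) C = \sum_(i <- r | P i) pairing (f i) C.
Proof.
by elim/big_rec2: _ => [|i x y _ <-]; rewrite ?pairing0 ?pairingD.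
Qed.

Lemma pairing_wedge M C : pairing (wedge M) C = \det (M *m C).
Proof. by rewrite Cauchy_Binet; apply: eq_bigr => a _; rewrite mxE. Qed.

Lemma wedge_basis (a : 'I_#|incr_tuples k N|) :
  wedge (rowsub (idx a) 1%:M : 'M[K]_(k, N)) = delta_mx 0 a.
Proof.
apply/rowP => b; rewrite !mxE eqxx /=; case: eqP => [->|ab].
  rewrite (_ : colsub _ _ = 1%:M) ?det1 //; apply/matrixP => i j.
  by rewrite !mxE (inj_eq (@idx_inj _ _ _)).
(* Two index sets of the same size, one inside the other, would be equal. The index found here gives
   a zero row in the minor. *)
have [i hi] : exists i, idx a i \notin idx b @: 'I_k.
  apply/existsP; rewrite -[X in is_true X]negbK negb_exists; apply/negP => /forallP h.
  apply: ab; apply: idx_image_inj; apply/esym/eqP; rewrite eqEcard.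
  rewrite !(card_imset _ (@idx_inj _ _ _)) leqnn andbT.
  by apply/fintype.subsetP => _ /imsetP [i _ ->]; have := h i; rewrite negbK.
rewrite (expand_det_row _ i) big1 // => j _; rewrite !mxE.
case: eqP => [E|_]; last by rewrite mul0r.
by move: hi; rewrite E imset_f.
Qed.

Lemma pairing_basis t a : pairing t (rowsub (idx a) 1%:M)^T = t 0 a.
Proof.
rewrite /pairing (bigD1 a) //= big1 ?addr0 => [|b ba].
  rewrite -trmx_mxsub det_tr; have := congr1 (fun t : extpow => t 0 a) (wedge_basis a).
  by rewrite !mxE !eqxx => ->; rewrite mulr1.
rewrite -trmx_mxsub det_tr; have := congr1 (fun t : extpow => t 0 b) (wedge_basis a).
by rewrite !mxE (negPf ba) andbF => ->; rewrite mulr0.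
Qed.

(** This reduces identities in the exterior power to identities between k by k determinants. *)
Lemma pairing_inj t u : (forall C, pairing t C = pairing u C) -> t = u.
Proof. by move=> h; apply/rowP => a; rewrite -!pairing_basis h. Qed.

Lemma pairing_act t g C : pairing (t *m extpow_mx k g) C = pairing t (g^T *m C).
Proof.
rewrite /pairing; under eq_bigr do rewrite mxE big_distrl /=.
rewrite exchange_big /=; apply: eq_bigr => a _.
rewrite (_ : rowsub (idx a) (g^T *m C) = rowsub (idx a) g^T *m C); last first.
  by apply/matrixP => i j; rewrite !mxE; apply: eq_bigr => l _; rewrite !mxE.
rewrite Cauchy_Binet big_distrr /=; apply: eq_bigr => b _.
by rewrite !mxE mulrA.
Qed.

Lemma wedge_act M g : wedge M *m extpow_mx k g = wedge (M *m g^T).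
Proof.
by apply: pairing_inj => C; rewrite pairing_act !pairing_wedge mulmxA.
Qed.

Lemma wedge_mull (P : 'M[K]_k) M : wedge (P *m M) = \det P *: wedge M.
Proof.
by apply: pairing_inj => C; rewrite pairingZ !pairing_wedge -mulmxA det_mulmx.
Qed.

Lemma pairing_tangent M W C : pairing (tangent_vector M W) C = ddet (M *m C) (W *m C).
Proof.
rewrite pairing_sum; apply: eq_bigr => i _; rewrite pairing_wedge; congr (\det _).
by rewrite -/(repl_row i M W) !repl_rowE mixrows_mulmx.
Qed.

Lemma tangent_vector_act M W g :
  tangent_vector M W *m extpow_mx k g = tangent_vector (M *m g^T) (W *m g^T).
Proof.
by apply: pairing_inj => C; rewrite pairing_act !pairing_tangent !mulmxA.
Qed.

Lemma tangent_vector_mull (P : 'M[K]_k) M W :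
  tangent_vector (P *m M) (P *m W) = \det P *: tangent_vector M W.
Proof.
by apply: pairing_inj => C; rewrite pairingZ !pairing_tangent -!mulmxA ddet_mull.
Qed.

Lemma tangent_vectorD M W W' :
  tangent_vector M (W + W') = tangent_vector M W + tangent_vector M W'.
Proof.
apply: pairing_inj => C; rewrite pairingD !pairing_tangent !ddetE.
by rewrite !mulmxDl mxtraceD.
Qed.

Lemma tangent_vectorZ M c W : tangent_vector M (c *: W) = c *: tangent_vector M W.
Proof.
apply: pairing_inj => C; rewrite pairingZ !pairing_tangent !ddetE.
by rewrite -!scalemxAl mxtraceZ.
Qed.

(** Directions inside H_p move the point only along its own line, by the trace. This is why W
    matters only modulo H_p, up to a multiple of [wedge M]. *)
Lemma tangent_vector_same M (P : 'M[K]_k) :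
  tangent_vector M (P *m M) = \tr P *: wedge M.
Proof.
apply: pairing_inj => C; rewrite pairingZ pairing_tangent pairing_wedge.
by rewrite -mulmxA ddet_same.
Qed.

Lemma wedge_add M W : wedge (M + W) = \sum_J wedge (mixrows J M W).
Proof.
apply: pairing_inj => C; rewrite pairing_sum pairing_wedge mulmxDl det_addmx.
by apply: eq_bigr => J _; rewrite pairing_wedge mixrows_mulmx.
Qed.

Lemma wedge_mixZ J M W x :
  wedge (mixrows J M (x *: W)) = x ^+ #|J| *: wedge (mixrows J M W).
Proof.
apply: pairing_inj => C; rewrite pairingZ !pairing_wedge !mixrows_mulmx -det_mixrowsZ.
by rewrite scalemxAl.
Qed.

Lemma tangent_vectorE M W : tangent_vector M W = \sum_i wedge (mixrows [set i]%SET M W).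
Proof. by apply: eq_bigr => i _; rewrite -repl_rowE. Qed.

End Pairing.

(** * Annihilators *)

Section Completion.
Variables (K : fieldType).

Lemma row_free_completion r k (V : 'M[K]_(r, k)) : row_free V ->
  exists s (U : 'M[K]_(s, k)), k = (r + s)%N /\ row_free (col_mx V U).
Proof.
move=> fV; have rV : \rank V = r by apply/eqP.
exists (\rank V^C%MS), (row_base V^C%MS).
have e : k = (r + \rank V^C%MS)%N by rewrite mxrank_compl rV subnKC // -{1}rV rank_leq_col.
split=> //; have : row_full (V + V^C)%MS by exact: addsmx_compl_full.
rewrite /row_full /row_free -addsmxE => /eqP fr; apply/eqP.
by rewrite (adds_eqmx (eqmx_refl V) (eq_row_base _)) fr.
Qed.

Lemma row_free_col_mx r k (V : 'M[K]_(r, k)) (v : 'rV[K]_k) :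
  row_free V -> ~~ (v <= V)%MS -> row_free (col_mx V v).
Proof.
move=> fV nv; apply/inj_row_free => w.
rewrite -[w]hsubmxK mul_row_col [rsubmx w]mx11_scalar mul_scalar_mx => E.
set c := rsubmx w 0 0 in E *.
have c0 : c = 0.
  apply/eqP; apply: contraNT nv => c0.
  have -> : v = (- (c^-1) *: lsubmx w) *m V.
    move: E => /eqP; rewrite addrC addr_eq0 => /eqP /(congr1 (fun x => c^-1 *: x)).
    by rewrite scalerA mulVf // scale1r => ->; rewrite scalerN scaleNr mulNmx -scalemxAl.
  exact: submxMl.
move: E; rewrite c0 scale0r addr0 => E.
have := row_free_inj fV (_ : lsubmx w *m V = 0 *m V).
by rewrite E mul0mx => /(_ erefl) ->; rewrite raddf0 row_mx0.
Qed.

(** The left side is the dimension of the covectors killed by B after restriction to the rows of A;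
    those that restrict to 0 are killed by both matrices, and rank-nullity applies. *)
Lemma rank_mul_ker_tr k k' N (A : 'M[K]_(k, N)) (B : 'M[K]_(k', N)) :
  (\rank (kermx B^T *m A^T) = \rank (col_mx A B) - \rank B)%N.
Proof.
have e1 := mxrank_mul_ker (kermx B^T) A^T.
have e2 : \rank (kermx B^T :&: kermx A^T)%MS = (N - \rank (col_mx A B))%N.
  rewrite -[in RHS]mxrank_tr tr_col_mx -mxrank_ker.
  apply: eqmx_rank; apply/rV_eqP => u.
  rewrite sub_capmx !sub_kermx mul_mx_row -row_mx0.
  apply/andP/eqP => [[/eqP -> /eqP ->] //|/eq_row_mx [-> ->]]; by rewrite !eqxx.
move: e1; rewrite e2 !mxrank_ker mxrank_tr => e1.
have h1 : (\rank B <= \rank (col_mx A B))%N by rewrite -addsmxE mxrankS ?addsmxSr.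
have h2 := rank_leq_col (col_mx A B).
by apply/eqP; rewrite -(eqn_add2r (N - \rank (col_mx A B))) e1 addnC addnBA // subnK.
Qed.

Lemma ker_avoid r k k' N (A : 'M[K]_(k, N)) (B : 'M[K]_(k', N)) (U : 'M[K]_(r, k)) :
  (\rank B + \rank U < \rank (col_mx A B))%N ->
  exists c : 'cV[K]_N, B *m c = 0 /\ ~~ ((A *m c)^T <= U)%MS.
Proof.
move=> h.
have /row_subPn [i hi] : ~~ (kermx B^T *m A^T <= U)%MS.
  apply/negP => /mxrankS; rewrite rank_mul_ker_tr leqNgt => /negP; apply.
  by rewrite ltn_subRL.
exists (row i (kermx B^T))^T; split; last by rewrite trmx_mul trmxK -row_mul.
apply: trmx_inj; rewrite trmx_mul trmxK trmx0 -row_mul.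
by rewrite mulmx_ker row0.
Qed.

End Completion.

(** * Tuples of covectors with prescribed columns that detect a secant or a tangent vector *)

Section Separation.
Variables (K : fieldType) (N : nat).

Definition has_cols r k (C : 'M[K]_(N, k)) (D : 'M[K]_(N, r)) :=
  forall i, exists j, col j C = col i D.

(** The columns added to D are lifted through [pinvmx A], so that their images complete E to a
    basis. E is kept apart from A *m D because in the tangent case one of its columns is W *m c. *)
Lemma complete_cols r k (A : 'M[K]_(k, N)) (D : 'M[K]_(N, r)) (E : 'M[K]_(k, r)) :
  row_free A -> row_free E^T ->
  exists C, [/\ has_cols C D &
    exists2 f : 'I_r -> 'I_k, injective f /\ (forall i, col (f i) C = col i D) &
    \det (\matrix_(i, j) if [pick p | f p == j] is Some p then E i p else (A *m C) i j) != 0].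
Proof.
move=> fA /row_free_completion [s [U [e fU]]]; subst k.
pose C := row_mx D (pinvmx A *m U^T).
have hC i : col (lshift s i) C = col i D.
  by apply/colP => a; rewrite !mxE (unsplitK (inl _)).
exists C; split; first by move=> i; exists (lshift s i).
exists (lshift s); first by split=> //; exact: lshift_inj.
rewrite (_ : \matrix_(i, j) _ = (col_mx E^T U)^T).
  by rewrite det_tr -unitfE -unitmxE -row_free_unit.
apply/matrixP => i j; rewrite tr_col_mx trmxK mxE.
case: pickP => [p /eqP <-|np]; first by rewrite row_mxEl.
rewrite mul_mx_row mulmxA mulmxVp // mul1mx.
case: (split_ordP j) => p jp; last by rewrite jp !row_mxEr.
by have := np p; rewrite jp eqxx.
Qed.

Lemma has_cols_row_mx r r' k (C : 'M[K]_(N, k)) (D : 'M[K]_(N, r)) (D' : 'M[K]_(N, r')) :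
  has_cols C (row_mx D D') -> has_cols C D /\ has_cols C D'.
Proof.
move=> h; split=> i.
  have [j E] := h (lshift r' i); exists j; rewrite E; apply/colP => a.
  by rewrite !mxE (unsplitK (inl _)).
have [j E] := h (rshift r i); exists j; rewrite E; apply/colP => a.
by rewrite !mxE (unsplitK (inr _)).
Qed.

Lemma has_col1 k (C : 'M[K]_(N, k)) (c : 'cV[K]_N) :
  has_cols C c -> exists j, col j C = c.
Proof. by move=> /(_ 0) [j E]; exists j; rewrite E; apply/colP => i; rewrite mxE. Qed.

Lemma mulmx_col m k (A : 'M[K]_(m, N)) (C : 'M[K]_(N, k)) j : A *m col j C = col j (A *m C).
Proof. by rewrite !colE mulmxA. Qed.

Lemma det_col0 k (A : 'M[K]_k) j : col j A = 0 -> \det A = 0.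
Proof.
move=> /colP h; rewrite (expand_det_col _ j) big1 // => i _.
by have := h i; rewrite !mxE => ->; rewrite mul0r.
Qed.

(** The rank leaves a covector c killed by B whose image under A is independent of the r columns of
    A *m D. Completing D and c to C makes A *m C invertible, while B *m C has a zero column. *)
Lemma secant_separation r k (A B : 'M[K]_(k, N)) (D : 'M[K]_(N, r)) :
  row_free A -> row_free B -> row_free (A *m D)^T ->
  (k + r < \rank (col_mx A B))%N ->
  exists C, [/\ has_cols C D, \det (A *m C) != 0 & \det (B *m C) = 0].
Proof.
move=> fA /eqP fB fD h.
have [c [Bc Ac]] : exists c : 'cV[K]_N, B *m c = 0 /\ ~~ ((A *m c)^T <= (A *m D)^T)%MS.
  by apply: ker_avoid; rewrite fB (eqP fD).
have fE : row_free (A *m row_mx D c)^T.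
  by rewrite mul_mx_row tr_row_mx; exact: row_free_col_mx.
have [C [hC [f [finj hf] dC]]] := complete_cols (row_mx D c) fA fE.
have [hD /has_col1 [j cj]] := has_cols_row_mx hC.
exists C; split=> //.
  rewrite (_ : A *m C = \matrix_(i, j) if [pick p | f p == j] is Some p
    then (A *m row_mx D c) i p else (A *m C) i j) //.
  apply/matrixP => a b; rewrite [RHS]mxE; case: pickP => // p /eqP <-.
  by have /colP /(_ a) := congr1 (mulmx A) (hf p); rewrite !mulmx_col [LHS]mxE [RHS]mxE.
by apply: (@det_col0 _ _ j); rewrite -mulmx_col cj.
Qed.

(** As M kills c, only the term that replaces this column by W *m c survives in the differential,
    and C is completed so that this term is not 0. *)
Lemma tangent_separation r k (M W : 'M[K]_(k, N)) (D : 'M[K]_(N, r)) (c : 'cV[K]_N) :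
  row_free M -> row_free (M *m D)^T -> M *m c = 0 ->
  ~~ ((W *m c)^T <= (M *m D)^T)%MS ->
  exists C, [/\ has_cols C D, has_cols C c & ddet (M *m C) (W *m C) != 0].
Proof.
move=> fM fD Mc Wc.
have fE : row_free (row_mx (M *m D) (W *m c))^T.
  by rewrite tr_row_mx; exact: row_free_col_mx.
have [C [hC [f [finj hf] dC]]] := complete_cols (row_mx D c) fM fE.
have [hD hc] := has_cols_row_mx hC.
exists C; split=> //.
pose j0 := f (rshift r 0).
have cj0 : col j0 C = c.
  by rewrite hf; apply/colP => a; rewrite !mxE (unsplitK (inr _)).
rewrite (@ddet_col0 _ _ _ _ j0) -?mulmx_col ?cj0 //.
rewrite (_ : repl_col _ _ _ = \matrix_(i, j) if [pick p | f p == j] is Some p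
    then (row_mx (M *m D) (W *m c)) i p else (M *m C) i j) //.
apply/matrixP => a b; rewrite [LHS]mxE [LHS]mxE [RHS]mxE.
case: pickP => [p /eqP <-|np]; last first.
  by rewrite eq_sym (negPf (negbT (np _))) !mxE.
rewrite (inj_eq finj); have /colP hp := hf p; case: (split_ordP p) => q pq.
  rewrite pq row_mxEl (eq_lrshift _ _) !mxE; apply: eq_bigr => l _.
  by have := hp l; rewrite pq !mxE (unsplitK (inl _)) => ->.
rewrite pq row_mxEr (ord1 q) eqxx !mxE; apply: eq_bigr => l _.
by have := hp l; rewrite pq (ord1 q) !mxE (unsplitK (inr _)) => ->.
Qed.

End Separation.

(** * Covectors that annihilate decomposable, secant and tangent vectors *)

Section Annihilator.
Variables (K : fieldType) (k N : nat).
Local Notation extpow := (extpow K k N).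
Implicit Types (t : extpow) (M W A B : 'M[K]_(k, N)) (C : 'M[K]_(N, k)) (c : 'cV[K]_N).

Definition annihilates t c := forall C j, col j C = c -> pairing t C = 0.

Lemma mul0row_free n (U : 'M[K]_(0, n)) : row_free U.
Proof. by rewrite /row_free flatmx0 mxrank0. Qed.

Lemma not_sub_mx0 n (U : 'M[K]_(0, n)) (v : 'rV[K]_n) : v != 0 -> ~~ (v <= U)%MS.
Proof.
apply: contra => /mxrankS; rewrite -mxrank_eq0 -leqn0 => /leq_trans; apply.
exact: rank_leq_row.
Qed.

Lemma row_free_rV n (v : 'rV[K]_n) : v != 0 -> row_free v.
Proof. by move=> v0; rewrite /row_free rank_rV v0. Qed.

Lemma tr_eq0 m n (A : 'M[K]_(m, n)) : (A^T == 0) = (A == 0).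
Proof. by rewrite -[in RHS](inj_eq (@trmx_inj _ _ _)) trmx0. Qed.

Lemma wedge_annihilator M c : row_free M -> annihilates (wedge M) c <-> M *m c = 0.
Proof.
move=> fM; split=> [h|Mc C j Cj]; last first.
  by rewrite pairing_wedge (@det_col0 _ _ _ j) // -mulmx_col Cj.
apply/eqP; rewrite -tr_eq0; apply: contraT => Mc.
have [C [/has_col1 [j Cj] [f [finj hf] ]]] := complete_cols c fM (row_free_rV Mc).
rewrite (_ : \matrix_(i, j) _ = M *m C); last first.
  apply/matrixP => a b; rewrite [LHS]mxE; case: pickP => // p /eqP <-.
  by have /colP /(_ a) := congr1 (mulmx M) (hf p); rewrite (ord1 p) !mulmx_col [LHS]mxE [RHS]mxE.
by rewrite -pairing_wedge (h _ _ Cj) eqxx.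
Qed.

(** If A *m c <> 0, then [secant_separation] puts c among columns C for which only the first
    determinant is nonzero. The rank must leave room for c and for a covector killed by B; at rank k
    + 1 the sum is decomposable and the claim fails. *)
Lemma secant_annihilator A B c : row_free A -> row_free B ->
  (k + 1 < \rank (col_mx A B))%N ->
  annihilates (wedge A + wedge B) c <-> col_mx A B *m c = 0.
Proof.
move=> fA fB h; rewrite mul_col_mx; split=> [ann|E C j Cj]; last first.
  have /eq_col_mx [Ac Bc] : col_mx (A *m c) (B *m c) = col_mx 0 0 by rewrite E col_mx0.
  by rewrite pairingD !pairing_wedge !(@det_col0 _ _ _ j) ?addr0 // -mulmx_col Cj.
have half A' B' : row_free A' -> row_free B' -> (k + 1 < \rank (col_mx A' B'))%N ->
    annihilates (wedge A' + wedge B') c -> A' *m c = 0.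
  move=> fA' fB' h' ann'; apply/eqP; rewrite -tr_eq0; apply: contraT => Ac.
  have [C [/has_col1 [j Cj] dA dB]] := secant_separation fA' fB' (row_free_rV Ac) h'.
  by have := ann' C j Cj; rewrite pairingD !pairing_wedge dB addr0 => /eqP; rewrite (negPf dA).
rewrite (half A B) // (half B A) ?col_mx0 //; last by rewrite addrC.
by move: h; rewrite -!addsmxE addsmxC.
Qed.

(** If M *m c <> 0, the rank gives some c2 killed by M with W *m c2 not proportional to M *m c, and
    a tuple containing both c and c2 detects the tangent vector. *)
Lemma tangent_annihilator M W c : row_free M -> (k + 1 < \rank (col_mx M W))%N ->
  annihilates (tangent_vector M W) c <-> col_mx M W *m c = 0.
Proof.
move=> fM h; rewrite mul_col_mx; split=> [ann|E C j Cj]; last first.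
  have /eq_col_mx [Mc Wc] : col_mx (M *m c) (W *m c) = col_mx 0 0 by rewrite E col_mx0.
  rewrite pairing_tangent (@ddet_col0 _ _ _ _ j) -?mulmx_col ?Cj //.
  apply: (@det_col0 _ _ _ j); apply/colP => i; rewrite !mxE eqxx !mxE.
  by move/colP: Wc => /(_ i); rewrite !mxE -Cj => {2}<-; apply: eq_bigr => l _; rewrite mxE.
have Mc : M *m c = 0.
  apply/eqP; rewrite -tr_eq0; apply: contraT => Mc0.
  have [c2 [Mc2 Wc2]] : exists c2, M *m c2 = 0 /\ ~~ ((W *m c2)^T <= (M *m c)^T)%MS.
    apply: ker_avoid; rewrite (eqP fM) (eqP (row_free_rV Mc0)).
    by move: h; rewrite -!addsmxE addsmxC.
  have [C [/has_col1 [j Cj] _]] := tangent_separation fM (row_free_rV Mc0) Mc2 Wc2.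
  by rewrite -pairing_tangent (ann _ _ Cj) eqxx.
suff Wc : W *m c = 0 by rewrite Mc Wc col_mx0.
apply/eqP; rewrite -tr_eq0; apply: contraT => Wc0.
(* Now M kills c, so c plays the part of c2 and no further column is prescribed. *)
have nsub : ~~ ((W *m c)^T <= (M *m (0 : 'M[K]_(N, 0)))^T)%MS by exact: not_sub_mx0.
have [C [_ /has_col1 [j Cj]]] := tangent_separation fM (mul0row_free _) Mc nsub.
by rewrite -pairing_tangent (ann _ _ Cj) eqxx.
Qed.

(** Each term of the differential replaces one column, hence keeps one of the two zero columns. *)
Lemma tangent_isotropic M W C i j : i != j -> M *m col i C = 0 -> M *m col j C = 0 ->
  pairing (tangent_vector M W) C = 0.
Proof.
move=> ij Mi Mj; rewrite pairing_tangent (@ddet_col0 _ _ _ _ i) -?mulmx_col //.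
apply: (@det_col0 _ _ _ j); apply/colP => a; rewrite !mxE eq_sym (negPf ij) !mxE.
by move/colP: Mj => /(_ a); rewrite !mxE => {2}<-; apply: eq_bigr => l _; rewrite mxE.
Qed.

(** The sum of A + M and B + M contains A + B, and their intersection contains M. For k-dimensional
    spaces this is the triangle inequality for dim (A + B) - k. *)
Lemma rank_col_mx_triangle (A B M : 'M[K]_(k, N)) :
  (\rank (col_mx A B) + \rank M <= \rank (col_mx A M) + \rank (col_mx B M))%N.
Proof.
rewrite -!addsmxE -(mxrank_sum_cap (A + M)%MS (B + M)%MS).
apply: leq_add; apply: mxrankS; last by rewrite sub_capmx !addsmxSr.
rewrite addsmx_sub; apply/andP; split.
  by apply: submx_trans (addsmxSl _ _); apply: addsmxSl.
by apply: submx_trans (addsmxSr _ _); apply: addsmxSl.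
Qed.

(** If dim (A + M) > k + 1, two covectors killed by M are independent on A; completed so that the
    determinant for A is nonzero and that for B is 0, they contradict [tangent_isotropic]. So A and
    B are both at distance at most 1 from M, hence at most 2 from each other. *)
Lemma secant_not_tangent A B M W : row_free A -> row_free B -> row_free M ->
  (k + 2 < \rank (col_mx A B))%N -> wedge A + wedge B <> tangent_vector M W.
Proof.
move=> fA fB fM h E.
have main A' B' : row_free A' -> row_free B' -> (k + 2 < \rank (col_mx A' B'))%N ->
    wedge A' + wedge B' = tangent_vector M W -> (\rank (col_mx A' M) <= k + 1)%N.
  move=> fA' fB' h' E'; rewrite leqNgt; apply/negP => h2.
  have [c1 [Mc1 Ac1]] : exists c1 : 'cV[K]_N, M *m c1 = 0 /\
      ~~ ((A' *m c1)^T <= (0 : 'M[K]_(0, k)))%MS.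
    apply: ker_avoid; rewrite (eqP fM) mxrank0 addn0; apply: leq_trans h2.
    by rewrite addn1 leqnSn.
  have Ac10 : (A' *m c1)^T != 0 by apply: contraNneq Ac1 => ->; exact: sub0mx.
  have [c2 [Mc2 Ac2]] : exists c2 : 'cV[K]_N, M *m c2 = 0 /\
      ~~ ((A' *m c2)^T <= (A' *m c1)^T)%MS.
    by apply: ker_avoid; rewrite (eqP fM) (eqP (row_free_rV Ac10)).
  have fE : row_free (A' *m row_mx c1 c2)^T.
    by rewrite mul_mx_row tr_row_mx; apply: row_free_col_mx => //; exact: row_free_rV.
  have [C [hC dA dB]] := secant_separation fA' fB' fE h'.
  have [/has_col1 [i Ci] /has_col1 [j Cj]] := has_cols_row_mx hC.
  have ij : i != j.
    by apply: contraNneq Ac2 => ij; rewrite -Cj -ij Ci.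
  have := congr1 (fun t => pairing t C) E'.
  rewrite (tangent_isotropic _ ij) ?Ci ?Cj // pairingD !pairing_wedge dB addr0.
  by move/eqP; rewrite (negPf dA).
have hA := main A B fA fB h E.
have hB : (\rank (col_mx B M) <= k + 1)%N.
  apply: (main B A) => //; last by rewrite addrC.
  by move: h; rewrite -!addsmxE addsmxC.
have := leq_trans (rank_col_mx_triangle A B M) (leq_add hA hB).
rewrite (eqP fM); lia.
Qed.

End Annihilator.

(** * Support *)

Section SupportRank.
Variables (K : fieldType) (k N : nat).
Local Notation extpow := (extpow K k N).
Implicit Types (t : extpow) (C : 'M[K]_(N, k)) (c : 'cV[K]_N).

Definition set_col (j : 'I_k) c C : 'M[K]_(N, k) :=
  \matrix_(a, b) if b == j then c a 0 else C a b.

Lemma col_set_col j c C : col j (set_col j c C) = c.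
Proof. by apply/colP => i; rewrite !mxE eqxx. Qed.

Lemma set_col_col j C : set_col j (col j C) C = C.
Proof. by apply/matrixP => a b; rewrite !mxE; case: eqP => // ->. Qed.

Lemma pairing_set_col n t j (D : 'M[K]_(N, n)) (l : 'cV[K]_n) C :
  pairing t (set_col j (D *m l) C) =
  \sum_p l p 0 * pairing t (set_col j (col p D) C).
Proof.
have E c : pairing t (set_col j c C) = \sum_r c r 0 *
    \sum_a t 0 a * \sum_i (idx a i == r)%:R * cofactor (rowsub (idx a) C) i j.
  under [RHS]eq_bigr do rewrite big_distrr.
  rewrite exchange_big /=; apply: eq_bigr => a _.
  under eq_bigr do rewrite mulrCA; rewrite -big_distrr /=; congr (_ * _).
  under eq_bigr do rewrite big_distrr.
  rewrite exchange_big (expand_det_col _ j) /=; apply: eq_bigr => i _.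
  rewrite (bigD1 (idx a i)) //= eqxx mul1r big1 ?addr0; last first.
    by move=> r; rewrite eq_sym => /negPf ->; rewrite mul0r mulr0.
  rewrite !mxE eqxx; congr (_ * _); rewrite /cofactor; congr (_ * \det _).
  by apply/matrixP => x y; rewrite !mxE eq_sym (negPf (neq_lift _ _)).
rewrite E; under [RHS]eq_bigr do rewrite E big_distrr.
rewrite exchange_big /=; apply: eq_bigr => r _.
rewrite mxE big_distrl; apply: eq_bigr => p _ /=.
by rewrite mxE mulrCA mulrA.
Qed.

(* The contraction map (K^N)^* -> \bigwedge^(k-1) K^N defined by t has rank at
   most m; equivalently t is in \bigwedge^k U for some U of dimension at most m. *)
Definition supp_le m t := forall (D : 'M[K]_(N, m.+1)) (C : 'I_m.+1 -> 'M[K]_(N, k))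
  (j : 'I_m.+1 -> 'I_k),
  \det (\matrix_(p, q) pairing t (set_col (j q) (col p D) (C q))) = 0.

(** Any m + 1 covectors are dependent on the rows of Y. A combination of them killed by Y
    annihilates t and gives a relation between the rows of the matrix. *)
Lemma supp_le_upper r m t (Y : 'M[K]_(r, N)) :
  (forall c, Y *m c = 0 -> annihilates t c) -> (\rank Y <= m)%N -> supp_le m t.
Proof.
move=> h rY D C j; set A := \matrix_(p, q) _.
have nf : ~~ row_free (Y *m D)^T.
  apply: contraL rY => /eqP; rewrite mxrank_tr -ltnNge => <-.
  exact: mxrankM_maxl.
apply/eqP; apply: contraNT nf => dA.
have fA : row_free A by rewrite row_free_unit unitmxE unitfE.
apply/inj_row_free => l /(congr1 trmx); rewrite trmx_mul trmxK trmx0 -mulmxA => Yl.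
suff : l *m A = 0 *m A by move/(row_free_inj fA).
rewrite mul0mx; apply/rowP => q; rewrite !mxE.
have := h _ Yl _ _ (col_set_col (j q) _ (C q)).
rewrite pairing_set_col => E; rewrite -[RHS]E.
by apply: eq_bigr => p _; rewrite !mxE.
Qed.

(** Independent functions are told apart by as many points. This converts the rank of the
    contraction map into the nonvanishing of a minor. *)
Lemma evaluation_det (X : Type) n (F : 'I_n -> X -> K) :
  (forall l : 'rV_n, (forall x, \sum_p l 0 p * F p x = 0) -> l = 0) ->
  exists x : 'I_n -> X, \det (\matrix_(p, q) F p (x q)) != 0.
Proof.
elim: n F => [|n IH] F indep.
  by exists (fun i : 'I_0 => False_rect X (notF (ltn_ord i))); rewrite det_mx00 oner_eq0.
have [x dx] : exists x : 'I_n -> X, \det (\matrix_(p, q) F (lift ord0 p) (x q)) != 0.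
  apply: (IH (F \o lift ord0)) => l hl.
  pose l' : 'rV_n.+1 := \row_p if unlift ord0 p is Some q then l 0 q else 0.
  have l'0 : l' = 0.
    apply: indep => y; rewrite big_ord_recl mxE unlift_none mul0r add0r -[RHS](hl y).
    by apply: eq_bigr => p _; rewrite mxE liftK.
  by apply/rowP => p; move/rowP: l'0 => /(_ (lift ord0 p)); rewrite !mxE liftK.
have [x0] : exists x0 : X, True.
  apply: contrapT => /forallNP noX.
  have /rowP/(_ ord0) : const_mx 1 = 0 :> 'rV[K]_n.+1 by apply: indep => y; case: (noX y).
  by rewrite !mxE => /eqP; rewrite oner_eq0.
move=> _; pose x' y q := if unlift ord0 q is Some q' then x q' else y.
apply: contrapT => /forallNP h.
(* If every choice y of the first point gave determinant 0, expansion along its column would be a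
   linear relation between the functions. The cofactors do not depend on y, and the one at ord0 is
   nonzero by induction. *)
pose cof p := cofactor (\matrix_(p, q) F p (x' x0 q)) p ord0.
have l0 : \row_p cof p = 0.
  apply: indep => y; have /negP/negPn/eqP := h (x' y).
  rewrite (expand_det_col _ ord0) => E; rewrite -[RHS]E; apply: eq_bigr => p _.
  rewrite !mxE mulrC {1}/x' unlift_none; congr (_ * _).
  rewrite /cof /cofactor; congr (_ * \det _); apply/matrixP => a b.
  by rewrite !mxE /x' liftK.
have /eqP := congr1 (fun l : 'rV_n.+1 => l 0 ord0) l0.
rewrite !mxE /cof /cofactor mulf_eq0 signr_eq0 /=.
apply/negP; move: dx; congr (~~ (\det _ == 0)).
by apply/matrixP => a b; rewrite !mxE /x' liftK.
Qed.

(** Of m + 1 covectors independent on the rows of Y no combination annihilates t. Their contractions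
    with t are therefore independent, and [evaluation_det] yields a nonzero minor. *)
Lemma supp_le_lower r m t (Y : 'M[K]_(r, N)) :
  (forall c, annihilates t c -> Y *m c = 0) -> supp_le m t -> (\rank Y <= m)%N.
Proof.
move=> h st; rewrite leqNgt; apply/negP => mY.
have [D fD] : exists D : 'M[K]_(N, m.+1), row_free (Y *m D)^T.
  have /submxP [B eB] : (row_base Y^T <= Y^T)%MS by rewrite eq_row_base.
  exists ((pid_mx m.+1 : 'M_(m.+1, \rank Y^T)) *m B)^T.
  rewrite trmx_mul trmxK -mulmxA -eB /row_free mxrankMfree ?row_base_free //.
  by rewrite rank_pid_mx // mxrank_tr.
pose F p (x : 'M[K]_(N, k) * 'I_k) := pairing t (set_col x.2 (col p D) x.1).
suff indep (l : 'rV_m.+1) : (forall x, \sum_p l 0 p * F p x = 0) -> l = 0.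
  have [x] := evaluation_det indep.
  by rewrite (st D (fun q => (x q).1) (fun q => (x q).2)) eqxx.
move=> hl; suff : l *m (Y *m D)^T = 0 *m (Y *m D)^T by move/(row_free_inj fD).
rewrite mul0mx; apply: trmx_inj; rewrite trmx_mul trmxK trmx0 -mulmxA.
apply: h => C j Cj; rewrite -(set_col_col j C) Cj pairing_set_col -[RHS](hl (C, j)).
by apply: eq_bigr => p _; rewrite mxE.
Qed.

Lemma supp_leP r m t (Y : 'M[K]_(r, N)) :
  (forall c, annihilates t c <-> Y *m c = 0) -> supp_le m t <-> (\rank Y <= m)%N.
Proof.
move=> h; split; first by apply: supp_le_lower => c /h.
by apply: supp_le_upper => c /h.
Qed.

Lemma supp_leZ m a t : supp_le m t -> supp_le m (a *: t).
Proof.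
move=> h D C j; rewrite (_ : \matrix_(p, q) _ =
    a *: \matrix_(p, q) pairing t (set_col (j q) (col p D) (C q))).
  by rewrite detZ h mulr0.
by apply/matrixP => p q; rewrite !mxE pairingZ.
Qed.

(** The entries of the matrix are linear in the coordinates of t, so the minors are homogeneous of
    degree m + 1. *)
Lemma zariski_closed_supp_le m :
  zariski_closed [set L : {vspace extpow} | is_point L /\ forall x, x \in L -> supp_le m x].
Proof.
pose lin C : {mpoly K[#|incr_tuples k N|]} := \sum_a \det (rowsub (idx a) C) *: 'X_a.
have linE C (x : extpow) : (lin C).@[fun a => x 0 a] = pairing x C.
  rewrite /lin raddf_sum; apply: eq_bigr => a _ /=.
  by rewrite mevalZ mevalXU mulrC.
pose pol (z : 'M[K]_(N, m.+1) * ('I_m.+1 -> 'M[K]_(N, k)) * ('I_m.+1 -> 'I_k)) :=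
  \det (\matrix_(p, q) lin (set_col (z.2 q) (col p z.1.1) (z.1.2 q))).
have polE z (x : extpow) : (pol z).@[fun a => x 0 a] =
    \det (\matrix_(p, q) pairing x (set_col (z.2 q) (col p z.1.1) (z.1.2 q))).
  rewrite /pol -det_map_mx; congr (\det _); apply/matrixP => p q.
  by rewrite !mxE; exact: linE.
exists [set pol z | z in classical_sets.setT].
  move=> _ [z _ <-]; exists m.+1; rewrite /pol /determinant.
  apply: rpred_sum => s _; rewrite -signr_odd.
  have hp : \prod_i (\matrix_(p, q) lin (set_col (z.2 q) (col p z.1.1) (z.1.2 q))) i (s i) \is m.+1.-homog.
    rewrite -[X in X.-homog](_ : \sum_(i < m.+1) 1 = m.+1)%N; last by rewrite sum1_card card_ord.
    elim/big_ind2: _ => [|d p e q hp hq|i _]; [exact: dhomog1|exact: dhomogM|].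
    rewrite mxE; apply: rpred_sum => a _; apply: dhomogZ.
    by rewrite dhomogX; apply/eqP; exact: mdeg1.
  by case: (odd _); rewrite ?expr0 ?expr1 ?mul1r ?mulN1r ?rpredN.
apply/seteqP; split=> L [pL hL]; split=> //.
  by move=> _ x [z _ <-] xL; rewrite polE; apply: hL.
move=> x xL D C j; have := hL (pol (D, C, j)) x _ xL.
by rewrite polE; apply; exists (D, C, j).
Qed.

End SupportRank.

(** * Normal forms *)

Section ScaleRow.
Variables (K : fieldType) (k : nat).

(** Rescaling a single row multiplies the wedge by c and leaves the other rows alone, in particular
    those shared by two matrices. *)
Definition scale_row (i0 : 'I_k) (c : K) : 'M[K]_k :=
  diag_mx (\row_i if i == i0 then c else 1).

Lemma det_scale_row i0 c : \det (scale_row i0 c) = c.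
Proof.
rewrite det_diag (bigD1 i0) //= big1 ?mulr1 ?mxE ?eqxx // => i ii0.
by rewrite mxE (negPf ii0).
Qed.

Lemma scale_row_unit i0 c : c != 0 -> scale_row i0 c \in unitmx.
Proof. by rewrite unitmxE det_scale_row unitfE. Qed.

Lemma row_scale_row n i0 c (X : 'M[K]_(k, n)) i : i != i0 -> row i (scale_row i0 c *m X) = row i X.
Proof.
by move=> /negPf h; rewrite mul_diag_mx; apply/rowP => a; rewrite !mxE h mul1r.
Qed.

Lemma wedge_scale_row N i0 c (A : 'M[K]_(k, N)) : wedge (scale_row i0 c *m A) = c *: wedge A.
Proof. by rewrite wedge_mull det_scale_row. Qed.

End ScaleRow.

Section NormalForms.
Variables (K : fieldType) (k N : nat).
Implicit Types (M W A B : 'M[K]_(k, N)) (P Q : 'M[K]_k) (g : 'M[K]_N).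

(* With e_0, ..., e_(N-1) the standard basis, frame l has the rows
   e_k, ..., e_(k+l-1), e_l, ..., e_(k-1). *)
Definition frame_idx (l i : nat) : nat := if (i < l)%N then (k + i)%N else i.
Definition frame l : 'M[K]_(k, N) := \matrix_(i, j) ((j : nat) == frame_idx l i)%:R.

Lemma frame_idx_inj l (i j : 'I_k) : frame_idx l i = frame_idx l j -> i = j.
Proof.
rewrite /frame_idx => h; apply: val_inj => /=; move: h (ltn_ord i) (ltn_ord j).
by case: (ltnP i l) => ?; case: (ltnP j l) => ?; lia.
Qed.

Lemma row_frame_mul l n (g : 'M[K]_(N, n)) (i : 'I_k) (j : 'I_N) : frame_idx l i = j :> nat ->
  row i (frame l *m g) = row j g.
Proof.
move=> ij; apply/rowP => a; rewrite !mxE (bigD1 j) //= !mxE ij eqxx mul1r.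
rewrite big1 ?addr0 // => b bj; rewrite mxE ij.
by rewrite (_ : (b == j :> nat) = false) ?mul0r //; apply/negbTE.
Qed.

Lemma frame_idx_lt l (i : 'I_k) : (l <= k)%N -> (k + l <= N)%N -> (frame_idx l i < N)%N.
Proof. by rewrite /frame_idx; move: (ltn_ord i); case: (ltnP i l); lia. Qed.

Lemma frame_row_free l : (l <= k)%N -> (k + l <= N)%N -> row_free (frame l).
Proof.
move=> lk lN; apply/row_freeP; exists (frame l)^T; apply/row_matrixP => i.
rewrite (row_frame_mul _ (j := Ordinal (frame_idx_lt i lk lN))) //.
apply/rowP => j; rewrite !mxE /= eq_sym; case: eqP => [/frame_idx_inj ->|h].
  by rewrite eqxx.
by case: eqP => // E; case: h; rewrite E.
Qed.

Lemma frame_trunc m l : (m <= l)%N -> frame m = frame m *m pid_mx (k + l).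
Proof.
move=> ml; apply/matrixP => i j; have hi := ltn_ord i.
rewrite [RHS]mxE (bigD1 j) //= big1 ?addr0; last first.
  by move=> b bj; rewrite !mxE (_ : (b == j :> nat) = false) ?mulr0 //; apply/negbTE.
rewrite !mxE eqxx /=; case: eqP => [->|_]; last by rewrite mul0r.
have -> : (frame_idx m i < k + l)%N by rewrite /frame_idx; case: ifP; lia.
by rewrite mul1r.
Qed.

Lemma rank_frames l : (l <= k)%N -> (k + l <= N)%N ->
  \rank (col_mx (frame 0) (frame l)) = (k + l)%N.
Proof.
move=> lk lN; apply/eqP; rewrite eqn_leq; apply/andP; split.
  rewrite (_ : col_mx _ _ = col_mx (frame 0) (frame l) *m pid_mx (k + l)); last first.
    by rewrite mul_col_mx -!frame_trunc.
  by rewrite (leq_trans (mxrankM_maxr _ _)) // rank_pid_mx.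
rewrite -{1}(@rank_pid_mx K (k + l) N (k + l)) //; apply: mxrankS.
apply/row_subP => i; case: (ltnP i k) => ik.
  rewrite (_ : row i _ = row (Ordinal ik) (frame 0)).
    by rewrite -addsmxE (submx_trans (row_sub _ _)) // addsmxSl.
  by apply/rowP => j; rewrite !mxE ltn_ord andbT eq_sym.
have il : (i - k < k)%N by have := ltn_ord i; lia.
rewrite (_ : row i _ = row (Ordinal il) (frame l)).
  by rewrite -addsmxE (submx_trans (row_sub _ _)) // addsmxSr.
apply/rowP => j; rewrite !mxE ltn_ord andbT eq_sym /frame_idx /=.
have -> : (i - k < l)%N by have := ltn_ord i; lia.
by rewrite subnKC.
Qed.

(** The matrix f sends basis vectors to the prescribed rows of A and B but need not be invertible.
    By the rank hypothesis it is injective on the span of the two frames, so an invertible g agrees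
    with it there. *)
Lemma frame_normal_form l A B : (l <= k)%N ->
  (forall i : 'I_k, (l <= i)%N -> row i A = row i B) ->
  \rank (col_mx A B) = (k + l)%N ->
  exists2 g, g \in unitmx & A = frame 0 *m g /\ B = frame l *m g.
Proof.
move=> lk agree rAB.
have lN : (k + l <= N)%N by rewrite -rAB rank_leq_col.
pose f : 'M[K]_N := \matrix_j
  if insub (j : nat) is Some i then row (i : 'I_k) A else
  if insub (j - k)%N is Some i then row (i : 'I_k) B else 0.
have eA : frame 0 *m f = A.
  apply/row_matrixP => i; have hi := ltn_ord i.
  rewrite (row_frame_mul _ (j := Ordinal (frame_idx_lt i (leq0n k) (leq_trans (leq_add (leqnn k) (leq0n l)) lN)))) //.
  by rewrite rowK /= /frame_idx /= valK.
have eB : frame l *m f = B.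
  apply/row_matrixP => i; have hi := ltn_ord i.
  rewrite (row_frame_mul _ (j := Ordinal (frame_idx_lt i lk lN))) //.
  rewrite rowK /= /frame_idx; case: ltnP => il; last by rewrite valK agree.
  by rewrite insubF ?addKn ?valK // ltnNge leq_addr.
pose U := col_mx (frame 0) (frame l).
have Uf : U *m f = col_mx A B by rewrite mul_col_mx eA eB.
have rU : \rank U = (k + l)%N by exact: rank_frames.
have [g ug Ug] : {g | g \in unitmx & U *m f = U *m g}.
  by apply: complete_unitmx; rewrite Uf rAB rU.
exists g => //; move: Ug; rewrite Uf mul_col_mx => /eq_col_mx [-> ->].
by [].
Qed.

Definition select s l : 'M[K]_(s, k) := \matrix_(i, j) ((j : nat) == l + i)%N%:R.

Lemma select_mul s l n (X : 'M[K]_(k, n)) (i : 'I_s) (j : 'I_k) : (j = l + i :> nat)%N ->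
  row i (select s l *m X) = row j X.
Proof.
move=> ji; apply/rowP => a; rewrite !mxE (bigD1 j) //= !mxE ji eqxx mul1r.
rewrite big1 ?addr0 // => b bj; rewrite mxE -ji.
by rewrite (_ : (b == j :> nat) = false) ?mul0r //; apply/negbTE.
Qed.

Lemma select_trK s l : (l + s <= k)%N -> select s l *m (select s l)^T = 1%:M.
Proof.
move=> e; apply/row_matrixP => i; have hi := ltn_ord i.
have h : (l + i < k)%N by lia.
rewrite (select_mul _ (j := Ordinal h)) //; apply/rowP => j; rewrite !mxE /=.
by rewrite eqn_add2l.
Qed.

Lemma select_extend s l (D : 'M[K]_(s, k)) : (l + s <= k)%N -> row_free D ->
  exists2 P, P \in unitmx & select s l *m P = D.
Proof.
move=> e fD.
have E : select s l *m ((select s l)^T *m D) = D by rewrite mulmxA select_trK // mul1mx.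
have fS : row_free (select s l) by apply/row_freeP; exists (select s l)^T; exact: select_trK.
have [P uP h] : {P | P \in unitmx & select s l *m ((select s l)^T *m D) = select s l *m P}.
  by apply: complete_unitmx; rewrite E (eqP fD) (eqP fS).
by exists P => //; rewrite -h.
Qed.

Lemma rank_col_mx_lblock P Q (X : 'M[K]_k) A B : P \in unitmx -> Q \in unitmx ->
  \rank (col_mx (P *m A) (X *m A + Q *m B)) = \rank (col_mx A B).
Proof.
move=> uP uQ.
have -> : col_mx (P *m A) (X *m A + Q *m B) = block_mx P 0 X Q *m col_mx A B.
  by rewrite mul_block_col mul0mx addr0.
rewrite eqmxMfull // row_full_unit unitmxE det_lblock unitrM.
by rewrite -!unitmxE uP.
Qed.

(** A basis of the intersection, whose dimension is k - l, is made the last k - l rows of both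
    matrices; these are the common rows that [frame_normal_form] requires. *)
Lemma pair_normal_form l A B : row_free A -> row_free B ->
  \rank (col_mx A B) = (k + l)%N ->
  (l <= k)%N /\ exists P Q g, [/\ P \in unitmx, Q \in unitmx, g \in unitmx,
    P *m A = frame 0 *m g & Q *m B = frame l *m g].
Proof.
move=> fA fB rAB.
have := mxrank_sum_cap A B; rewrite addsmxE rAB (eqP fA) (eqP fB) => rcap.
have lk : (l <= k)%N by lia.
split=> //; set s := \rank (A :&: B)%MS in rcap.
have e : (l + s = k)%N by lia.
have base X : row_free X -> ((A :&: B)%MS <= X)%MS ->
    exists2 P, P \in unitmx & select s l *m (P *m X) = row_base (A :&: B)%MS.
  move=> fX sX.
  have /submxP [D eD] : (row_base (A :&: B)%MS <= X)%MS by rewrite eq_row_base.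
  have fD : row_free D.
    by rewrite /row_free -(mxrankMfree D fX) -eD; apply: row_base_free.
  by have [P uP eP] := select_extend (eq_leq e) fD; exists P => //; rewrite mulmxA eP.
have [P uP eP] := base A fA (capmxSl _ _).
have [Q uQ eQ] := base B fB (capmxSr _ _).
have rPQ : \rank (col_mx (P *m A) (Q *m B)) = (k + l)%N.
  by have := rank_col_mx_lblock 0 A B uP uQ; rewrite mul0mx add0r rAB.
have [|g ug [hA hB]] := frame_normal_form lk _ rPQ; last by exists P, Q, g.
move=> i li; have hi := ltn_ord i; have h : (i - l < s)%N by lia.
by rewrite -!(select_mul (l := l) _ (i := Ordinal h)) ?subnKC // eP eQ.
Qed.

Lemma rank_col_mx_coker M W :
  row_free M -> (\rank (col_mx M W) = k + \rank (W *m cokermx M))%N.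
Proof.
move=> /eqP fM; have := mxrank_mul_ker W (cokermx M).
have -> : \rank (W :&: kermx (cokermx M))%MS = \rank (M :&: W)%MS.
  rewrite capmxC; apply/eqmx_rank/eqmxP/cap_eqmx => //.
  apply/eqmxP/rV_eqP => u; by rewrite sub_kermx -submxE.
by have := mxrank_sum_cap M W; rewrite addsmxE fM; lia.
Qed.

(** The last k - l rows of P *m M span the kernel of the map from H_p to K^N / H_p. After W is
    corrected by elements of H_p so as to vanish there, M and M + W have k - l common rows and
    [frame_normal_form] applies. *)
Lemma tangent_normal_form l M W : (0 < l)%N -> row_free M ->
  \rank (col_mx M W) = (k + l)%N ->
  (l <= k)%N /\ exists2 c, c != 0 & exists2 g, g \in unitmx &
    tangent_vector M W = c *: tangent_vector (frame 0 *m g) ((frame l - frame 0) *m g).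
Proof.
move=> l0 fM rMW; have rc := rank_col_mx_coker W fM.
have lk : (l <= k)%N by have := rank_leq_row (W *m cokermx M); lia.
split=> //.
set X := kermx (W *m cokermx M).
have rX : \rank X = (k - l)%N by rewrite mxrank_ker; lia.
have e : (l + \rank X = k)%N by rewrite rX subnKC.
have [P uP eP] := select_extend (eq_leq e) (row_base_free X).
set S := select _ _ in eP.
have /submxP [Y eY] : (S *m P *m W <= M)%MS.
  rewrite submxE -!mulmxA (mulmxA S P) eP; apply/eqP/sub_kermxP; by rewrite eq_row_base.
pose T := S^T *m Y *m invmx P.
pose c := \tr T.
pose i0 : 'I_k := Ordinal (leq_trans l0 lk).
(* The subtraction clears the rows from l on and costs \tr T times the wedge. The last summand
   restores this in row 0, which is not among the cleared rows because 0 < l. *)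
pose W' := P *m W - T *m (P *m M) + c *: (delta_mx i0 i0 *m (P *m M)).
have eW : tangent_vector (P *m M) (P *m W) = tangent_vector (P *m M) W'.
  rewrite /W' scalemxAl; set R := P *m W - _.
  have -> : P *m W = R + T *m (P *m M) by rewrite subrK.
  clearbody R.
  rewrite !tangent_vectorD !tangent_vector_same mxtraceZ; congr (_ + _).
  congr (_ *: _); rewrite -/c /mxtrace (bigD1 i0) //= big1 ?addr0.
    by rewrite !mxE eqxx mulr1.
  by move=> i ii0; rewrite mxE (negPf ii0).
have SW' : S *m W' = 0.
  rewrite /W' mulmxDr mulmxBr /T !mulmxA select_trK ?e // mul1mx mulmxKV // -eY subrr add0r.
  rewrite -scalemxAr !mulmxA (_ : S *m delta_mx i0 i0 = 0) ?mul0mx ?mul0mx ?scaler0 //.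
  apply/matrixP => i j; rewrite !mxE big1 // => a _; rewrite !mxE.
  case: eqP => [E|_]; last by rewrite mul0r.
  by case: eqP => [E'|_]; rewrite ?mulr0 //; move: E; rewrite E' /=; lia.
have agree (i : 'I_k) : (l <= i)%N -> row i (P *m M) = row i (P *m M + W').
  move=> li; have hi := ltn_ord i; have h : (i - l < \rank X)%N by lia.
  rewrite linearD /= -[row i W'](select_mul (l := l) _ (i := Ordinal h)) ?subnKC //.
  by rewrite -/S SW' row0 addr0.
have rk' : \rank (col_mx (P *m M) (P *m M + W')) = (k + l)%N.
  rewrite -rMW -(rank_col_mx_lblock (P - T *m P + c *: (delta_mx i0 i0 *m P)) M W uP uP).
  congr (\rank (col_mx _ _)); rewrite /W' !mulmxDl mulNmx -scalemxAl !mulmxA.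
  by rewrite -!addrA; congr (_ + _); rewrite addrC -!addrA; congr (_ + _); rewrite addrC.
have [g ug [hM hW]] := frame_normal_form lk agree rk'.
exists (\det P)^-1; first by rewrite invr_eq0 -unitfE -unitmxE.
exists g => //; rewrite mulmxBl -hM -hW addrAC subrr add0r -eW tangent_vector_mull.
by rewrite scalerA mulVf ?scale1r // -unitfE -unitmxE.
Qed.

(** For every right inverse C of M the pairing is \tr (W *m C). Adding z to column i of C keeps it a
    right inverse and adds the i-th entry of W *m z. *)
Lemma tangent_vector_eq0 M W (z : 'cV[K]_N) :
  row_free M -> tangent_vector M W = 0 -> M *m z = 0 -> W *m z = 0.
Proof.
move=> fM t0 Mz; apply/colP => i; rewrite [RHS]mxE.
have h C : M *m C = 1%:M -> \tr (W *m C) = 0.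
  move=> MC; have := congr1 (fun t => pairing t C) t0.
  by rewrite pairing0 pairing_tangent MC ddetE adj1 mulmx1.
have h1 := h _ (mulmxVp fM).
have := h (pinvmx M + z *m delta_mx 0 i) _.
rewrite mulmxDr mulmxA Mz mul0mx addr0 mulmxVp // => /(_ erefl).
rewrite mulmxDr mxtraceD h1 add0r mulmxA /mxtrace (bigD1 i) //= big1 ?addr0; last first.
  by move=> j ji; rewrite mxE big1 // => a _; rewrite [X in _ * X]mxE (negPf ji) andbF mulr0.
move=> E; rewrite -[RHS]E [RHS]mxE big_ord1 [X in _ = _ * X]mxE !eqxx mulr1.
by [].
Qed.

End NormalForms.

(** * Hamming distance *)

Section Hamming.
Variables (K : fieldType) (k N : nat).
Local Notation extpow := (extpow K k N).
Implicit Types (M W A B : 'M[K]_(k, N)) (P Q : 'M[K]_k) (g : 'M[K]_N) (t : extpow).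

Lemma line_eqP (t u : extpow) : u != 0 ->
  <[t]>%VS = <[u]>%VS -> exists2 c, c != 0 & u = c *: t.
Proof.
move=> u0 E; have : u \in <[t]>%VS by rewrite E memv_line.
move=> /vlineP [c uc]; exists c => //.
by apply: contraNneq u0 => c0; rewrite uc c0 scale0r.
Qed.

Lemma line_scale (t : extpow) c : c != 0 -> <[c *: t]>%VS = <[t]>%VS.
Proof.
move=> c0; apply/eqP; rewrite eqEsubv; apply/andP; split; apply/vlineP.
  by exists c.
by exists c^-1; rewrite scalerA mulVf // scale1r.
Qed.

Lemma is_point_line (t : extpow) : is_point <[t]>%VS <-> t != 0.
Proof. by rewrite /is_point dim_vline; case: eqP; split. Qed.

Lemma is_pointP (L : {vspace extpow}) : is_point L -> exists2 t, t != 0 & L = <[t]>%VS.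
Proof.
move=> dL; have L0 : L != 0%VS by rewrite -dimv_eq0 dL.
exists (vpick L); first by rewrite vpick0.
by apply/esym/eqP; rewrite eqEdim -memvE memv_pick dim_vline vpick0 L0 dL.
Qed.

Lemma wedge_neq0 M : (wedge M != 0) = row_free M.
Proof.
apply/idP/idP => [w0|fM].
  apply: contraNT w0 => nf; apply/eqP; apply: pairing_inj => C.
  rewrite pairing_wedge pairing0; apply/eqP; apply: contraNT nf => d.
  have u : row_free (M *m C) by rewrite row_free_unit unitmxE unitfE.
  by apply/inj_row_free => v vM; apply: (row_free_inj u); rewrite mulmxA vM !mul0mx.
apply/eqP => w0; have := congr1 (fun t => pairing t (pinvmx M)) w0.
by rewrite pairing_wedge pairing0 mulmxVp // det1 => /eqP; rewrite oner_eq0.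
Qed.

Lemma GrP (L : {vspace extpow}) : Gr L <-> exists2 M, row_free M & L = <[wedge M]>%VS.
Proof. by split=> [[M fM <-]|[M fM ->]]; exists M. Qed.

Lemma annihilatesZ a t c : a != 0 -> annihilates (a *: t) c <-> annihilates t c.
Proof.
move=> a0; split=> h C j Cj; last by rewrite pairingZ (h C j Cj) mulr0.
by have := h C j Cj; rewrite pairingZ => /eqP; rewrite mulf_eq0 (negPf a0) => /eqP.
Qed.

Lemma submx_annihilator A B : (forall c : 'cV[K]_N, A *m c = 0 -> B *m c = 0) -> (B <= A)%MS.
Proof.
move=> h; rewrite submxE; apply/eqP/matrixP => i j.
have /colP /(_ i) : B *m col j (cokermx A) = 0.
  by apply: h; rewrite mulmx_col mulmx_coker; apply/colP => a; rewrite !mxE.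
by rewrite mulmx_col !mxE.
Qed.

Lemma wedge_line_inj A B : row_free A -> row_free B ->
  <[wedge A]>%VS = <[wedge B]>%VS -> (B <= A)%MS.
Proof.
move=> fA fB /line_eqP [|c c0 E]; first by rewrite wedge_neq0.
apply: submx_annihilator => x /(wedge_annihilator x fA) h.
by apply/(wedge_annihilator x fB); rewrite E; apply/annihilatesZ.
Qed.

Lemma wedge_line_mul P M : P \in unitmx -> <[wedge (P *m M)]>%VS = <[wedge M]>%VS.
Proof. by move=> uP; rewrite wedge_mull line_scale // -unitfE -unitmxE. Qed.

Lemma rank_col_mx_sub A B : (B <= A)%MS -> \rank (col_mx A B) = \rank A.
Proof. by move=> s; rewrite -addsmxE; apply/eqmx_rank/eqmxP/addsmx_idPl. Qed.

Lemma secant_neq0 A B : row_free A -> row_free B -> (k < \rank (col_mx A B))%N ->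
  wedge A + wedge B != 0.
Proof.
move=> fA fB; apply: contraTneq => /eqP; rewrite addr_eq0 => /eqP E.
rewrite -leqNgt rank_col_mx_sub ?(eqP fA) //; apply: wedge_line_inj => //.
by rewrite E -scaleN1r line_scale // oppr_eq0 oner_eq0.
Qed.

(** Otherwise [wedge A + wedge B] would be a point of the line whose support has dimension at least
    k + 2, against k for points of G. *)
Lemma line_in_Gr_rank A B : row_free A -> row_free B ->
  line_in_Gr <[wedge A]>%VS <[wedge B]>%VS -> (\rank (col_mx A B) <= k + 1)%N.
Proof.
move=> fA fB h; rewrite leqNgt; apply/negP => r.
have n0 : wedge A + wedge B != 0 by apply: secant_neq0 => //; lia.
have /GrP [M fM] : Gr <[wedge A + wedge B]>%VS.
  apply: h; first exact/is_point_line.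
  rewrite -memvE; apply: memv_add; exact: memv_line.
move=> /esym /(line_eqP n0) [c c0 E].
have : supp_le k (wedge A + wedge B).
  rewrite E; apply: supp_leZ; apply/(supp_leP _ (fun x => wedge_annihilator x fM)).
  by rewrite (eqP fM).
move/(supp_leP _ (fun x => secant_annihilator x fA fB r)).
by move: r; lia.
Qed.

Lemma line_chain_rank A B r : row_free A -> row_free B ->
  line_chain <[wedge A]>%VS <[wedge B]>%VS r -> (\rank (col_mx A B) <= k + r)%N.
Proof.
move=> fA fB [c [c0 cr cG cl]].
suff h i : (i <= r)%N -> forall X, row_free X -> c i = <[wedge X]>%VS -> (\rank (col_mx A X) <= k + i)%N.
  by apply: h.
elim: i => [|i IH] ir X fX ci.
  rewrite rank_col_mx_sub ?(eqP fA) ?addn0 //.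
  by apply: wedge_line_inj => //; rewrite -c0.
have /GrP [Y fY cY] := cG i (ltnW ir).
have h1 := IH (ltnW ir) Y fY cY.
have [_ /[!cY] /[!ci] /(line_in_Gr_rank fY fX) h2] := cl i ir.
have := rank_col_mx_triangle A X Y; rewrite (eqP fY).
have -> : \rank (col_mx X Y) = \rank (col_mx Y X) by rewrite -!addsmxE addsmxC.
by lia.
Qed.

Lemma wedge_row_lin (i : 'I_k) a b A B M :
  (forall j, j != i -> row j A = row j M) -> (forall j, j != i -> row j B = row j M) ->
  row i M = a *: row i A + b *: row i B ->
  wedge M = a *: wedge A + b *: wedge B.
Proof.
move=> hA hB hi; apply/rowP => x; rewrite !mxE.
have lift_neq u : lift i u != i by rewrite eq_sym neq_lift.
apply: (determinant_multilinear (i0 := i)).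
- by apply/rowP => y; move/rowP: hi => /(_ (idx x y)); rewrite !mxE.
- apply/matrixP => u v; rewrite !mxE.
  by have /rowP/(_ (idx x v)) := hA (lift i u) (lift_neq u); rewrite !mxE.
- apply/matrixP => u v; rewrite !mxE.
  by have /rowP/(_ (idx x v)) := hB (lift i u) (lift_neq u); rewrite !mxE.
Qed.

Lemma line_in_Gr_row (i : 'I_k) A B : row_free A -> row_free B ->
  (forall j, j != i -> row j A = row j B) ->
  line_in_Gr <[wedge A]>%VS <[wedge B]>%VS.
Proof.
move=> fA fB hAB L /is_pointP [t t0 ->]; rewrite -memvE => /memv_addP.
move=> [_ /vlineP [a ->] [_ /vlineP [b ->] E]].
pose M := \matrix_j if j == i then a *: row i A + b *: row i B else row j A.
have eM : wedge M = t.
  rewrite E; apply: (@wedge_row_lin i); last by rewrite rowK eqxx.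
    by move=> j /negPf ji; rewrite rowK ji.
  by move=> j ji; rewrite rowK (negPf ji) hAB.
by apply/GrP; exists M; rewrite -?wedge_neq0 eM.
Qed.

Lemma frame_line_chain l g : (l <= k)%N -> (k + l <= N)%N -> g \in unitmx ->
  line_chain <[wedge (frame K k N 0 *m g)]>%VS <[wedge (frame K k N l *m g)]>%VS l.
Proof.
move=> lk lN ug; exists (fun i => <[wedge (frame K k N i *m g)]>%VS).
have fr i : (i <= l)%N -> row_free (frame K k N i *m g).
  move=> il; rewrite /row_free mxrankMfree ?row_free_unit //.
  by apply: frame_row_free; lia.
split=> // [i il|i il]; first by apply/GrP; exists (frame K k N i *m g) => //; exact: fr.
pose oi := Ordinal (leq_trans il lk).
have hk : (k + i < N)%N by lia.
have frow j : (j != oi) -> row j (frame K k N i *m g) = row j (frame K k N i.+1 *m g).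
  move=> ji; have lt : (frame_idx k i j < N)%N by apply: frame_idx_lt; lia.
  rewrite !(row_frame_mul _ (j := Ordinal lt)) //=.
  have : (j : nat) <> i by move=> E; move/eqP: ji; apply; exact: val_inj.
  by rewrite /frame_idx; case: ifP; case: ifP; lia.
split; last by apply: (@line_in_Gr_row oi) => //; apply: fr => //; exact: ltnW.
(* Consecutive points differ: row i of frame i.+1 is e_(k+i), which is outside the span of frame
   i. *)
move=> /(wedge_line_inj (fr _ (ltnW il)) (fr _ il)).
move=> /submxP [X]; rewrite mulmxA => /(congr1 (mulmx^~ (invmx g))).
rewrite !mulmxK // => /matrixP /(_ oi (Ordinal hk)); rewrite !mxE /= {1}/frame_idx ltnSn eqxx.
rewrite big1 => [/eqP|j _]; first by rewrite oner_eq0.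
rewrite !mxE /= (_ : (_ == _) = false) ?mulr0 //; apply/eqP; have := ltn_ord j.
by rewrite /frame_idx; case: ifP; lia.
Qed.

(** The distance is dim (A + B) - k: the frames between 0 and l give a chain of this length, and
    [line_chain_rank] excludes shorter ones. *)
Lemma hamming_wedgeP l A B : row_free A -> row_free B ->
  hamming_dist <[wedge A]>%VS <[wedge B]>%VS l <->
  (0 < l)%N /\ \rank (col_mx A B) = (k + l)%N.
Proof.
move=> fA fB.
have chain m : \rank (col_mx A B) = (k + m)%N ->
    line_chain <[wedge A]>%VS <[wedge B]>%VS m.
  move=> h; have [mk [P [Q [g [uP uQ ug eA eB]]]]] := pair_normal_form fA fB h.
  rewrite -(wedge_line_mul A uP) -(wedge_line_mul B uQ) eA eB.
  by apply: frame_line_chain => //; rewrite -h rank_leq_col.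
have ge : (k <= \rank (col_mx A B))%N by rewrite -{1}(eqP fA) -addsmxE mxrankS ?addsmxSl.
set m := (\rank (col_mx A B) - k)%N.
have rm : \rank (col_mx A B) = (k + m)%N by rewrite subnKC.
split=> [[pq ch minch]|[l0 rl]].
  have := line_chain_rank fA fB ch; have := minch m (chain m rm); rewrite rm => h1 h2.
  have lm : l = m by lia.
  split; last by rewrite lm.
  rewrite lt0n; apply/eqP => l0; apply: pq; have [c [<- <- _ _]] := ch.
  by rewrite l0.
split; [|exact: chain|].
  by move=> /(wedge_line_inj fA fB)/rank_col_mx_sub; rewrite rl (eqP fA); lia.
by move=> r ch; have := line_chain_rank fA fB ch; rewrite rl; lia.
Qed.

End Hamming.

(** * Tangent spaces *)

Section TangentCone.
Variables (K : fieldType) (k N : nat).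
Local Notation extpow := (extpow K k N).
Implicit Types (M W A B : 'M[K]_(k, N)) (P Q : 'M[K]_k) (g : 'M[K]_N) (t : extpow).

Lemma tangent_vector_is_linear M : linear (tangent_vector M).
Proof. by move=> c W W'; rewrite tangent_vectorD tangent_vectorZ. Qed.

HB.instance Definition _ M :=
  GRing.isLinear.Build K 'M[K]_(k, N) extpow *:%R (tangent_vector M)
    (tangent_vector_is_linear M).

Lemma wedge_row0 M i : row i M = 0 -> wedge M = 0.
Proof.
move=> /rowP h; apply/rowP => a; rewrite !mxE (expand_det_row _ i) big1 // => j _.
by have := h (idx a j); rewrite !mxE => ->; rewrite mul0r.
Qed.

Lemma tangent_vector_row i M W : (forall j, j != i -> row j W = 0) ->
  tangent_vector M W = wedge (mixrows [set i]%SET M W).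
Proof.
move=> h; rewrite tangent_vectorE (bigD1 i) //= big1 ?addr0 // => j ji.
apply: (@wedge_row0 _ j); rewrite -(h j ji); apply/rowP => a.
by rewrite !mxE inE eqxx.
Qed.

(** A nonzero generator [wedge A] has k - 1 independent rows in H_p. Completed to a basis P *m M,
    they show it to be a tangent vector that replaces only the last row. Conversely a transposition
    moves the replaced row of each summand to the last place. *)
Lemma tangent_coneP M t : (0 < k)%N -> row_free M ->
  tangent_cone M t <-> exists W, t = tangent_vector M W.
Proof.
move=> k0 fM; split=> [h|[W ->] U hU].
  suff : t \in limg (linfun (tangent_vector M)).
    by move=> /memv_imgP [W _ ->]; exists W; rewrite lfunE.
  apply: h => _ [A hA <-].
  have [->|wA] := eqVneq (wedge A) 0; first exact: mem0v.
  have fA : row_free A by rewrite -wedge_neq0.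
  have /submxP [D eD] : (select K k k.-1 0 *m A <= M)%MS.
    apply/row_subP => i; have hi := ltn_ord i.
    have ik : (i < k)%N by lia.
    rewrite (select_mul _ (j := Ordinal ik)) //; apply: hA => /=; lia.
  have l1 : (0 + k.-1 <= k)%N by rewrite add0n leq_pred.
  have fS : row_free (select K k k.-1 0).
    by apply/row_freeP; exists (select K k k.-1 0)^T; exact: select_trK.
  have fD : row_free D by rewrite /row_free -(mxrankMfree D fM) -eD mxrankMfree.
  have [P uP eP] := select_extend l1 fD.
  have lk : (k.-1 < k)%N by lia.
  pose last := Ordinal lk.
  pose W : 'M[K]_(k, N) := \matrix_j if j == last then row j A else 0.
  have -> : wedge A = tangent_vector (P *m M) (P *m (invmx P *m W)).
    rewrite mulKVmx // (@tangent_vector_row last) => [|j jl]; last by rewrite rowK (negPf jl).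
    congr wedge; apply/row_matrixP => j; apply/rowP => a; rewrite !mxE inE.
    case: eqP => [->|jl]; first by rewrite !mxE.
    have hj : (j < k.-1)%N.
      by have := ltn_ord j; have : (j : nat) <> k.-1 by [move=> E; apply: jl; exact: val_inj]; lia.
    have /rowP/(_ a) : row (Ordinal hj) (select K k k.-1 0 *m A) =
                      row (Ordinal hj) (select K k k.-1 0 *m (P *m M)).
      by rewrite eD mulmxA eP.
    by rewrite !(select_mul _ (j := j)) // !mxE.
  rewrite tangent_vector_mull; apply: memvZ; rewrite -lfunE; exact: memv_img (memvf _).
rewrite tangent_vectorE; apply: memv_suml => i _.
have lk : (k.-1 < k)%N by lia.
pose last := Ordinal lk.
pose s := tperm i last.
have -> : mixrows [set i]%SET M W = row_perm s (row_perm s (mixrows [set i]%SET M W)).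
  by apply/matrixP => a b; rewrite !mxE tpermK.
rewrite row_permE wedge_mull; apply: memvZ; apply: hU; exists (row_perm s (mixrows [set i]%SET M W)) => //.
move=> j jk; have si : s j != i.
  apply/eqP => E; have jl : j = last by rewrite -(tpermK i last j) -/s E tpermL.
  by move: jk; rewrite jl /=; lia.
rewrite (_ : row j _ = row (s j) M) ?row_sub //.
by apply/rowP => a; rewrite !mxE inE (negPf si).
Qed.

End TangentCone.

(** * Orbits *)

Section Orbits.
Variables (K : numClosedFieldType) (k N : nat).
Local Notation extpow := (extpow K k N).
Local Notation frame := (frame K k N).
Implicit Types (M W A B : 'M[K]_(k, N)) (P Q : 'M[K]_k) (g : 'M[K]_N) (t : extpow).
Implicit Types (L : {vspace extpow}) (O : set {vspace extpow}).

Definition GL_orbit t : set {vspace extpow} :=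
  [set <[t *m extpow_mx k g]>%VS | g in [set g | g \in unitmx]].

Lemma extpow_mxM t g h : t *m extpow_mx k g *m extpow_mx k h = t *m extpow_mx k (h *m g).
Proof. by apply: pairing_inj => C; rewrite !pairing_act trmx_mul mulmxA. Qed.

Lemma extpow_mx1 t : t *m extpow_mx k 1%:M = t.
Proof. by apply: pairing_inj => C; rewrite pairing_act trmx1 mul1mx. Qed.

Lemma extpow_mxZ t c g : t *m extpow_mx k (c *: g) = c ^+ k *: (t *m extpow_mx k g).
Proof.
apply: pairing_inj => C; rewrite pairingZ !pairing_act linearZ /= -scalemxAl.
rewrite /pairing mulr_sumr; apply: eq_bigr => a _.
rewrite (_ : rowsub _ _ = c *: rowsub (idx a) (g^T *m C)); first by rewrite detZ mulrCA.
by apply/matrixP => i j; rewrite !mxE.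
Qed.

Lemma extpow_mx_neq0 t g : g \in unitmx -> (t *m extpow_mx k g != 0) = (t != 0).
Proof.
move=> ug; apply/idP/idP; apply: contraNneq => E; first by rewrite E mul0mx.
by rewrite -(extpow_mx1 t) -(mulVmx ug) -extpow_mxM E mul0mx.
Qed.

Lemma GL_orbit_refl t : GL_orbit t <[t]>%VS.
Proof. by exists 1%:M; rewrite /= ?unitmx1 // extpow_mx1. Qed.

Lemma GL_orbit_eq t u c g : c != 0 -> g \in unitmx ->
  u = c *: (t *m extpow_mx k g) -> GL_orbit u = GL_orbit t.
Proof.
move=> c0 ug ->; apply/seteqP; split=> _ [h /= uh <-].
  exists (h *m g) => /=; first by rewrite unitmx_mul uh.
  by rewrite -scalemxAl line_scale // extpow_mxM.
exists (h *m invmx g) => /=; first by rewrite unitmx_mul uh unitmx_inv.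
by rewrite -scalemxAl line_scale // extpow_mxM mulmxKV.
Qed.

Lemma GL_orbit_mem t u : u != 0 -> GL_orbit t <[u]>%VS -> GL_orbit u = GL_orbit t.
Proof.
by move=> u0 [g /= ug /(line_eqP u0) [c c0 E]]; exact: GL_orbit_eq c0 ug E.
Qed.

Lemma GL_orbit_point t L : t != 0 -> GL_orbit t L -> is_point L.
Proof. by move=> t0 [g /= ug <-]; apply/is_point_line; rewrite extpow_mx_neq0. Qed.

Lemma extpow_act_line g t : (extpow_act k g @: <[t]>)%VS = <[t *m extpow_mx k g]>%VS.
Proof. by rewrite limg_line /extpow_act lfunE. Qed.

(** A scalar c acts on the exterior power by c ^+ k, hence trivially on lines, and an N-th root of
    (\det g)^-1 corrects the determinant. *)
Lemma SL_orbit_GL t : (0 < N)%N ->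
  [set (extpow_act k g @: <[t]>)%VS | g in [set g | \det g = 1]] = GL_orbit t.
Proof.
move=> N0; apply/seteqP; split=> _ [g /= dg <-].
  by exists g; rewrite /= ?extpow_act_line // unitmxE dg unitr1.
have d0 : \det g != 0 by rewrite -unitfE -unitmxE.
pose c := N.-root (\det g)^-1.
have cN : c ^+ N = (\det g)^-1 by rewrite rootCK.
have c0 : c != 0 by rewrite /c rootC_eq0 // invr_eq0.
exists (c *: g); first by rewrite /= detZ cN mulVf.
by rewrite extpow_act_line extpow_mxZ line_scale // expf_neq0.
Qed.

Lemma is_SL_orbitP O : (0 < N)%N -> is_SL_orbit O <-> exists2 t, t != 0 & O = GL_orbit t.
Proof.
move=> N0; split=> [[L /is_pointP [t t0 ->] ->]|[t t0 ->]].
  by exists t => //; rewrite SL_orbit_GL.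
by exists <[t]>%VS; [apply/is_point_line|rewrite SL_orbit_GL].
Qed.

(** Strata known to be orbits are identified below by exhibiting one common point. *)
Lemma SL_orbit_meet O O' L : (0 < N)%N ->
  is_SL_orbit O -> is_SL_orbit O' -> O L -> O' L -> O = O'.
Proof.
move=> N0 /(is_SL_orbitP _ N0) [t t0 ->] /(is_SL_orbitP _ N0) [t' t'0 ->] OL OL'.
have /is_pointP [u u0 E] := GL_orbit_point t0 OL; move: OL OL'; rewrite E.
by move=> /(GL_orbit_mem u0) <- /(GL_orbit_mem u0) <-.
Qed.

Lemma Gr_GL_orbit : (k <= N)%N -> @Gr K k N = GL_orbit (wedge (frame 0)).
Proof.
move=> kN; apply/seteqP; split=> [L /GrP [M fM ->]|_ [g /= ug <-]].
  have rM : \rank (col_mx M M) = (k + 0)%N by rewrite rank_col_mx_sub // (eqP fM) addn0.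
  have [g ug [eM _]] := frame_normal_form (leq0n k) (fun _ _ => erefl) rM.
  by exists g^T; rewrite /= ?unitmx_tr // wedge_act trmxK eM.
rewrite wedge_act; apply/GrP; exists (frame 0 *m g^T) => //.
rewrite /row_free mxrankMfree ?row_free_unit ?unitmx_tr //.
by apply: frame_row_free; lia.
Qed.

Definition secant_rep l : extpow := wedge (frame 0) + wedge (frame l).
Definition tangent_rep l : extpow := tangent_vector (frame 0) (frame l - frame 0).

Lemma SigmaP l L : (0 < l)%N -> Sigma l L <-> exists A B,
  [/\ row_free A, row_free B, \rank (col_mx A B) = (k + l)%N & L = <[wedge A + wedge B]>%VS].
Proof.
move=> l0; split=> [[u [v [[[A ->] /eqP uA] [[B ->] /eqP uB] h ->]]]|[A [B [fA fB r ->]]]].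
  rewrite !wedge_neq0 in uA uB; exists A, B; split=> //.
  by have [] := (hamming_wedgeP l uA uB).1 h.
exists (wedge A), (wedge B); split=> //.
- by split; [exists A|apply/eqP; rewrite wedge_neq0].
- by split; [exists B|apply/eqP; rewrite wedge_neq0].
- by apply/hamming_wedgeP.
Qed.

(** The factors \det P and \det Q left by [pair_normal_form] are absorbed into row 0, which is not
    shared as 0 < l. The rows from l on still agree, so [frame_normal_form] applies again, now
    without scalars. *)
Lemma secant_normal_form l A B : (0 < l)%N -> row_free A -> row_free B ->
  \rank (col_mx A B) = (k + l)%N ->
  (l <= k)%N /\ exists2 g, g \in unitmx &
    wedge A = wedge (frame 0 *m g) /\ wedge B = wedge (frame l *m g).
Proof.
move=> l0 fA fB r; have [lk [P [Q [g [uP uQ ug eA eB]]]]] := pair_normal_form fA fB r.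
split=> //; pose i0 : 'I_k := Ordinal (leq_trans l0 lk).
have dP : \det P != 0 by rewrite -unitfE -unitmxE.
have dQ : \det Q != 0 by rewrite -unitfE -unitmxE.
pose A' := scale_row i0 (\det P)^-1 *m (P *m A).
pose B' := scale_row i0 (\det Q)^-1 *m (Q *m B).
have eA' : wedge A' = wedge A by rewrite wedge_scale_row wedge_mull scalerA mulVf ?scale1r.
have eB' : wedge B' = wedge B by rewrite wedge_scale_row wedge_mull scalerA mulVf ?scale1r.
have [||h uh [hA hB]] := @frame_normal_form _ _ _ l A' B' lk.
- move=> i li; have ii0 : i != i0 by rewrite -(inj_eq val_inj) /=; lia.
  rewrite !row_scale_row // eA eB; have hi := ltn_ord i.
  have lt : (i < N)%N by rewrite (leq_trans hi) // -(eqP fA) rank_leq_col.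
  by rewrite !(row_frame_mul _ (j := Ordinal lt)) // /frame_idx ltnNge li.
- have := @rank_col_mx_lblock K k N (scale_row i0 (\det P)^-1 *m P)
    (scale_row i0 (\det Q)^-1 *m Q) 0 A B.
  rewrite mul0mx add0r -!mulmxA r => -> //;
    by rewrite unitmx_mul ?uP ?uQ andbT scale_row_unit // invr_eq0.
by exists h => //; rewrite -eA' -eB' hA hB.
Qed.

Lemma Sigma_GL_orbit l : (0 < l <= k)%N -> (k + k <= N)%N ->
  @Sigma K k N l = GL_orbit (secant_rep l).
Proof.
move=> /andP [l0 lk] kN; apply/seteqP; split=> [L /(SigmaP _ l0) [A [B [fA fB r ->]]]|_ [g /= ug <-]].
  have [_ [g ug [-> ->]]] := secant_normal_form l0 fA fB r.
  by exists g^T; rewrite /= ?unitmx_tr // mulmxDl !wedge_act trmxK.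
rewrite mulmxDl !wedge_act; apply/(SigmaP _ l0); exists (frame 0 *m g^T), (frame l *m g^T).
rewrite -mul_col_mx /row_free !mxrankMfree ?row_free_unit ?unitmx_tr //.
split=> //; [apply: frame_row_free; lia|apply: frame_row_free; lia|].
by apply: rank_frames; lia.
Qed.

Lemma tangent_vector_neq0 M W : row_free M -> (k < \rank (col_mx M W))%N ->
  tangent_vector M W != 0.
Proof.
move=> fM; apply: contraTneq => t0; rewrite -leqNgt rank_col_mx_sub ?(eqP fM) //.
by apply: submx_annihilator => c Mc; exact: tangent_vector_eq0 t0 Mc.
Qed.

Lemma ThetaP l L : (0 < l)%N -> (0 < k)%N -> Theta l L <-> exists M W,
  [/\ row_free M, \rank (col_mx M W) = (k + l)%N & L = <[tangent_vector M W]>%VS].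
Proof.
move=> l0 k0; split=> [[_ [M [t [phi [fM -> _ [W -> ->] r]]]]]|[M [W [fM r ->]]]].
  by exists M, W; rewrite rank_col_mx_coker // r.
have t0 : tangent_vector M W != 0 by apply: tangent_vector_neq0; rewrite ?r; lia.
have cone t : t \in <[tangent_vector M W]>%VS -> tangent_cone M t.
  by move=> /vlineP [c ->]; apply/tangent_coneP => //; exists (c *: W); rewrite tangent_vectorZ.
split; first by split; [apply/is_point_line|exists M].
exists M, (tangent_vector M W), (W *m cokermx M); split=> //.
- exact/cone/memv_line.
- by exists W.
- by apply/eqP; rewrite -(eqn_add2l k) -rank_col_mx_coker // r.
Qed.

Lemma rank_tangent_frames l : (l <= k)%N -> (k + k <= N)%N ->
  \rank (col_mx (frame 0) (frame l - frame 0)) = (k + l)%N.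
Proof.
move=> lk kN; rewrite -(@rank_frames K k N l) //; last by lia.
have := @rank_col_mx_lblock K k N 1%:M 1%:M (- 1%:M) (frame 0) (frame l).
by rewrite !unitmx1 !mul1mx mulNmx mul1mx addrC => ->.
Qed.

Lemma Theta_GL_orbit l : (0 < l <= k)%N -> (k + k <= N)%N ->
  @Theta K k N l = GL_orbit (tangent_rep l).
Proof.
move=> /andP [l0 lk] kN; have k0 := leq_trans l0 lk.
apply/seteqP; split=> [L /(ThetaP _ l0 k0) [M [W [fM r ->]]]|_ [g /= ug <-]].
  have [_ [c c0 [g ug ->]]] := tangent_normal_form l0 fM r.
  exists g^T; rewrite /= ?unitmx_tr // line_scale // tangent_vector_act trmxK.
  by [].
rewrite tangent_vector_act; apply/(ThetaP _ l0 k0).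
exists (frame 0 *m g^T), ((frame l - frame 0) *m g^T).
rewrite -mul_col_mx /row_free !mxrankMfree ?row_free_unit ?unitmx_tr //.
split=> //; [apply: frame_row_free; lia|exact: rank_tangent_frames].
Qed.

Lemma secant_rep_neq0 l : (0 < l <= k)%N -> (k + k <= N)%N -> secant_rep l != 0.
Proof.
move=> hl kN; have r : \rank (col_mx (frame 0) (frame l)) = (k + l)%N by apply: rank_frames; lia.
by apply: secant_neq0; rewrite ?r; [apply: frame_row_free; lia|apply: frame_row_free; lia|lia].
Qed.

Lemma tangent_rep_neq0 l : (0 < l <= k)%N -> (k + k <= N)%N -> tangent_rep l != 0.
Proof.
move=> hl kN; apply: tangent_vector_neq0; first by apply: frame_row_free; lia.
by rewrite rank_tangent_frames //; lia.
Qed.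

Lemma Gr_SL_orbit : (0 < k)%N -> (k + k <= N)%N -> is_SL_orbit (@Gr K k N).
Proof.
move=> k0 kN; apply/is_SL_orbitP; first by lia.
exists (wedge (frame 0)); last by apply: Gr_GL_orbit; lia.
by rewrite wedge_neq0; apply: frame_row_free; lia.
Qed.

Lemma Sigma_SL_orbit l : (0 < l <= k)%N -> (k + k <= N)%N -> is_SL_orbit (@Sigma K k N l).
Proof.
move=> hl kN; apply/is_SL_orbitP; first by lia.
by exists (secant_rep l); [exact: secant_rep_neq0|exact: Sigma_GL_orbit].
Qed.

Lemma Theta_SL_orbit l : (0 < l <= k)%N -> (k + k <= N)%N -> is_SL_orbit (@Theta K k N l).
Proof.
move=> hl kN; apply/is_SL_orbitP; first by lia.
by exists (tangent_rep l); [exact: tangent_rep_neq0|exact: Theta_GL_orbit].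
Qed.

Lemma row_frame_agree m l i : (m <= k)%N -> (l <= k)%N -> (k + k <= N)%N ->
  frame_idx k m (i : 'I_k) = frame_idx k l i -> row i (frame m) = row i (frame l).
Proof. by move=> *; apply/rowP => j; rewrite !mxE; congr (_ == _)%:R. Qed.

Lemma Sigma1 : (0 < k)%N -> (k + k <= N)%N -> @Sigma K k N 1 = @Gr K k N.
Proof.
move=> k0 kN; have h1 : (0 < 1 <= k)%N by lia.
apply: (@SL_orbit_meet _ _ <[secant_rep 1]>%VS); first by lia.
- exact: Sigma_SL_orbit.
- exact: Gr_SL_orbit.
- by rewrite Sigma_GL_orbit //; exact: GL_orbit_refl.
have f0 : row_free (frame 0) by apply: frame_row_free; lia.
have f1 : row_free (frame 1) by apply: frame_row_free; lia.
apply: (@line_in_Gr_row _ _ _ (Ordinal k0) (frame 0) (frame 1)) => //.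
- move=> j j0; apply: row_frame_agree; try lia.
  rewrite /frame_idx ltn0 ltnS leqn0; case: eqP => // E.
  by move: j0; rewrite -(inj_eq val_inj) /= E.
- by apply/is_point_line; exact: secant_rep_neq0.
- by rewrite -memvE; apply: memv_add; exact: memv_line.
Qed.

Lemma Theta1 : (0 < k)%N -> (k + k <= N)%N -> @Theta K k N 1 = @Gr K k N.
Proof.
move=> k0 kN; have h1 : (0 < 1 <= k)%N by lia.
apply: (@SL_orbit_meet _ _ <[tangent_rep 1]>%VS); first by lia.
- exact: Theta_SL_orbit.
- exact: Gr_SL_orbit.
- by rewrite Theta_GL_orbit //; exact: GL_orbit_refl.
have := tangent_rep_neq0 h1 kN; rewrite /tangent_rep.
rewrite (@tangent_vector_row _ _ _ (Ordinal k0)) => [|j j0].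
  by rewrite wedge_neq0 => f; apply/GrP; eexists; first exact: f.
rewrite linearB /= (@row_frame_agree 1 0) ?subrr //; try lia.
rewrite /frame_idx ltn0 ltnS leqn0; case: eqP => // E.
by move: j0; rewrite -(inj_eq val_inj) /= E.
Qed.

(** Write w for e_2 /\ ... /\ e_(k-1). Exchanging e_0 and e_k turns the secant vector e_0 /\ e_1 /\
    w + e_k /\ e_(k+1) /\ w into e_k /\ e_1 /\ w + e_0 /\ e_(k+1) /\ w, which is tangent at e_0 /\
    e_1 /\ w. *)
Lemma Sigma2 : (1 < k)%N -> (k + k <= N)%N -> @Sigma K k N 2 = @Theta K k N 2.
Proof.
move=> k1 kN; have k0 : (0 < k)%N by lia.
have h2 : (0 < 2 <= k)%N by lia.
pose i0 := Ordinal k0; pose i1 := Ordinal k1.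
pose W : 'M[K]_(k, N) := mixrows [set i0; i1]%SET 0 (frame 2).
have idx i : (i \in [set i0; i1]%SET) = ((i : 'I_k) < 2)%N.
  by rewrite !inE -!(inj_eq val_inj) /=; lia.
have rW : \rank (col_mx (frame 0) W) = (k + 2)%N.
  rewrite -(@rank_tangent_frames 2) //.
  (* X *m frame 0 + (frame 2 - frame 0) is W, so the two directions differ by vectors of H_p. *)
  pose X : 'M[K]_k := diag_mx (\row_i (i < 2)%N%:R).
  have <- := @rank_col_mx_lblock K k N 1%:M 1%:M X (frame 0) (frame 2 - frame 0).
  - rewrite !mul1mx; congr (\rank (col_mx _ _)); apply/matrixP => i j.
    rewrite mul_diag_mx !mxE idx; case: ltnP => hi; rewrite ?mul1r ?mul0r ?add0r //.
      by rewrite addrC subrK.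
    by rewrite /frame_idx ltn0 ltnNge hi /= subrr.
  - by rewrite unitmx1.
  - by rewrite unitmx1.
have hN0 : (0 < N)%N by lia.
have hNk : (k < N)%N by lia.
pose s := tperm (Ordinal hN0) (Ordinal hNk).
pose h : 'M[K]_N := perm_mx s.
have rowh l i (lt : (frame_idx k l (i : 'I_k) < N)%N) :
    row i (frame l *m h) = \row_j (j == s (Ordinal lt))%:R.
  rewrite (row_frame_mul _ (j := Ordinal lt)) //; apply/rowP => j.
  by rewrite !mxE eq_sym.
have Theta2 : @Theta K k N 2 <[tangent_vector (frame 0) W]>%VS.
  by apply/ThetaP => //; exists (frame 0), W; split=> //; apply: frame_row_free; lia.
apply: (SL_orbit_meet hN0 (Sigma_SL_orbit h2 kN) (Theta_SL_orbit h2 kN) _ Theta2).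
suff -> : tangent_vector (frame 0) W = secant_rep 2 *m extpow_mx k h^T.
  by rewrite Sigma_GL_orbit //; exists h^T; rewrite /= ?unitmx_tr ?unitmx_perm.
rewrite mulmxDl !wedge_act trmxK tangent_vectorE (bigD1 i0) //= (bigD1 i1) //= big1 ?addr0.
  have sE x : s x = (if x == 0 :> nat then k else if x == k :> nat then 0 else x)%N :> nat.
    rewrite permE /= -!(inj_eq val_inj) /=.
    by case: eqP => // _; case: eqP.
  have lt0 (i : 'I_k) : (frame_idx k 0 i < N)%N by apply: frame_idx_lt; lia.
  have lt2 (i : 'I_k) : (frame_idx k 2 i < N)%N by apply: frame_idx_lt; lia.
  congr (wedge _ + wedge _); apply/row_matrixP => i; have hi := ltn_ord i.
    rewrite (rowh _ _ (lt0 i)); apply/rowP => j; rewrite !mxE idx inE.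
    rewrite -!(inj_eq val_inj) /= sE /= /frame_idx ltn0.
    case: eqP => [->|i_0]; first by rewrite /= !addn0.
    by rewrite (ltn_eqF hi).
  rewrite (rowh _ _ (lt2 i)); apply/rowP => j; rewrite !mxE idx inE.
  rewrite -!(inj_eq val_inj) /= sE /= /frame_idx ltn0.
  case: (ltnP i 2) => i2; last first.
    have -> : (i == 1 :> nat) = false by apply/eqP; lia.
    have -> : (i == 0 :> nat) = false by apply/eqP; lia.
    by rewrite (ltn_eqF hi).
  have -> : (k + i == 0)%N = false by apply/eqP; lia.
  have [i_1|i_1] := eqVneq (i : nat) 1%N.
    by rewrite i_1 (_ : (k + 1 == k)%N = false) //; apply/eqP; lia.
  have -> : (i : nat) = 0%N by move/eqP: i_1; lia.
  by rewrite addn0 eqxx.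
move=> i /andP [ii0 ii1]; apply: (@wedge_row0 _ _ _ _ i); apply/rowP => j.
by rewrite !mxE !inE eqxx (negPf ii0) (negPf ii1).
Qed.

End Orbits.

(** * Degenerations *)

Section Closures.
Variables (K : numClosedFieldType) (k N : nat).
Local Notation extpow := (extpow K k N).
Local Notation frame := (frame K k N).
Implicit Types (M W A B : 'M[K]_(k, N)) (P Q : 'M[K]_k) (g : 'M[K]_N) (t : extpow).
Implicit Types (L : {vspace extpow}) (S Z : set {vspace extpow}).

Lemma Sigma_comb l A B a b : (0 < l)%N -> row_free A -> row_free B ->
  \rank (col_mx A B) = (k + l)%N -> a != 0 -> b != 0 ->
  Sigma l <[a *: wedge A + b *: wedge B]>%VS.
Proof.
move=> l0 fA fB r a0 b0; have [lk _] := pair_normal_form fA fB r.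
pose i0 : 'I_k := Ordinal (leq_trans l0 lk).
apply/SigmaP => //; exists (scale_row i0 a *m A), (scale_row i0 b *m B).
rewrite !wedge_scale_row.
have := rank_col_mx_lblock 0 A B (scale_row_unit i0 a0) (scale_row_unit i0 b0).
rewrite mul0mx add0r r => ->.
by split=> //; rewrite -wedge_neq0 wedge_scale_row scaler_eq0 negb_or wedge_neq0 ?a0 ?b0.
Qed.

Lemma zclosure_min S Z : zariski_closed Z -> S `<=` Z -> zclosure S `<=` Z.
Proof. exact: smallest_sub. Qed.

Lemma sub_zclosure S : S `<=` zclosure S.
Proof. exact: sub_gen_smallest. Qed.

Lemma zclosure_trans (S S' S'' : set {vspace extpow}) :
  S `<=` zclosure S' -> S' `<=` zclosure S'' -> S `<=` zclosure S''.
Proof. by move=> h h' L SL Z [cZ sZ]; apply: (h L SL); split=> // M /h'; apply. Qed.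

Lemma zclosureS S S' : S `<=` S' -> zclosure S `<=` zclosure S'.
Proof. by move=> h L SL Z [cZ sZ]; apply: SL; split=> // M /h; exact: sZ. Qed.

Lemma zariski_closed_points : zariski_closed [set L : {vspace extpow} | is_point L].
Proof. by exists set0 => //; apply/seteqP; split=> L; [split|case]. Qed.

Lemma poly_eq0_nonzero_roots (q : {poly K}) : (forall s, s != 0 -> root q s) -> q = 0.
Proof.
move=> h; apply/eqP; apply: contraT => q0.
have := @max_poly_roots _ q [seq i.+1%:R | i <- iota 0 (size q)] q0.
rewrite size_map size_iota ltnn; apply.
  by apply/allP => _ /mapP [i _ ->]; apply: h; rewrite pnatr_eq0.
rewrite map_inj_uniq ?iota_uniq // => i j /eqP.
by rewrite eqr_nat => /eqP [].
Qed.

Lemma horner_mmap n (p : 'I_n -> {poly K}) (f : {mpoly K[n]}) s :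
  (mmap polyC p f).[s] = f.@[fun a => (p a).[s]].
Proof.
rewrite /meval /mmap horner_sum; apply: eq_bigr => m _.
rewrite hornerM hornerC; congr (_ * _).
by rewrite /mmap1 horner_prod; apply: eq_bigr => i _; rewrite horner_exp.
Qed.

(** Along the curve every equation of a closed set containing S becomes a polynomial in s that
    vanishes for all s <> 0, hence also at 0. *)
Lemma curve_zclosure S (p : 'I_#|incr_tuples k N| -> {poly K}) :
  (forall s, s != 0 -> S <[\row_a (p a).[s]]>%VS) -> \row_a (p a).[0] != 0 ->
  zclosure S <[\row_a (p a).[0]]>%VS.
Proof.
move=> h x0 _ [[F _ ->] sZ]; split; first exact/is_point_line.
move=> f x Ff /vlineP [c ->].
pose q := mmap polyC (fun a => c%:P * p a) f.
have qE s : q.[s] = f.@[fun a => (c *: \row_a (p a).[s]) 0 a].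
  by rewrite /q horner_mmap; apply: meval_eq => a; rewrite hornerM hornerC !mxE.
have q0 : q = 0.
  apply: poly_eq0_nonzero_roots => s s0; apply/rootP; rewrite qE.
  have [_ hf] := sZ _ (h s s0); apply: hf => //.
  by apply/vlineP; exists c.
by rewrite -qE q0 horner0.
Qed.

(** One limit point is enough: translates of the curve by g reach the rest of the orbit of u. *)
Lemma curve_GL_orbit t u (p : 'I_#|incr_tuples k N| -> {poly K}) :
  t != 0 -> (forall s, s != 0 -> GL_orbit t <[\row_a (p a).[s]]>%VS) ->
  u = \row_a (p a).[0] -> u != 0 -> GL_orbit u `<=` zclosure (GL_orbit t).
Proof.
move=> t0 h eu u0 _ [g /= ug <-].
pose q b := \sum_a p a * (extpow_mx k g a b)%:P.
have qE s : \row_b (q b).[s] = (\row_a (p a).[s]) *m extpow_mx k g.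
  apply/rowP => b; rewrite [LHS]mxE [RHS]mxE /q horner_sum; apply: eq_bigr => a _.
  by rewrite hornerM hornerC [X in _ = X * _]mxE.
rewrite eu -qE; apply: curve_zclosure => [s s0|]; last by rewrite qE extpow_mx_neq0 // -eu.
have OS := h s s0.
have x0 : \row_a (p a).[s] != 0 by apply/is_point_line; exact: GL_orbit_point OS.
by rewrite -(GL_orbit_mem x0 OS) qE; exists g.
Qed.

(** For i < k in T this sends e_(k+i) to (1 - s) e_i + s e_(k+i) and fixes the other basis vectors.
    It is invertible for s <> 0 and merges e_(k+i) with e_i at s = 0, which degenerates a frame into
    one of smaller index. *)
Definition shear (T : pred nat) (s : K) : 'M[K]_N := \matrix_(i, j)
  if [&& k <= i, i < k + k & T (i - k)]%N
  then (1 - s) * (j == i - k :> nat)%N%:R + s * (j == i)%:R else (j == i)%:R.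

Lemma shear_unit T s : s != 0 -> shear T s \in unitmx.
Proof.
move=> s0; rewrite unitmxE unitfE det_trig.
  apply/prodf_neq0 => i _; rewrite mxE eqxx mulr1; case: ifP; rewrite ?oner_eq0 //.
  move=> /and3P [ki ik _]; rewrite (_ : (i == i - k :> nat)%N = false) ?mulr0 ?add0r //.
  by apply/eqP; lia.
apply/is_trig_mxP => i j ij; rewrite mxE -(inj_eq val_inj) /= (gtn_eqF ij).
case: ifP => // /and3P [ki ik _]; rewrite (_ : (j == i - k :> nat)%N = false) ?mulr0 ?addr0 //.
by apply/eqP; lia.
Qed.

Lemma shear_frame l T s (i : 'I_k) : (l <= k)%N -> (k + k <= N)%N ->
  row i (frame l *m shear T s) =
  if (i < l)%N && T i then (1 - s) *: row i (frame 0) + s *: row i (frame l) else row i (frame l).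
Proof.
move=> lk kN; have hi := ltn_ord i.
have lt : (frame_idx k l i < N)%N by apply: frame_idx_lt; lia.
rewrite (row_frame_mul _ (j := Ordinal lt)) //; apply/rowP => j; rewrite !mxE /=.
rewrite -(inj_eq val_inj) /=; move: lt; rewrite {1 2 3 4 5 6}/frame_idx.
case: (ltnP i l) => il lt /=.
  rewrite leq_addr ltn_add2l hi addKn /=.
  case: ifP => _; last by rewrite !mxE /frame_idx il.
  by rewrite !mxE /frame_idx il.
by rewrite leqNgt hi /= !mxE /frame_idx ltnNge il.
Qed.

Lemma shear_frame0 T s : (k + k <= N)%N -> frame 0 *m shear T s = frame 0.
Proof. by move=> kN; apply/row_matrixP => i; rewrite shear_frame. Qed.

Lemma shear_frameS l s : (l < k)%N -> (k + k <= N)%N ->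
  frame l.+1 *m shear (pred1 l) s = frame l + s *: (frame l.+1 - frame l).
Proof.
move=> lk kN; apply/row_matrixP => i; rewrite shear_frame //=.
have agree : (i : nat) != l -> row i (frame l.+1) = row i (frame l).
  move=> il; apply: row_frame_agree => //; first exact: ltnW.
  by rewrite /frame_idx ltnS leq_eqVlt (negPf il).
rewrite [in RHS]linearD /= [in RHS]linearZ /= [in RHS]linearB /=.
case: eqP => [il|/eqP il]; last by rewrite andbF agree // subrr scaler0 addr0.
rewrite il ltnSn /= (_ : row i (frame l) = row i (frame 0)).
  by rewrite scalerBl scale1r scalerBr addrA addrAC.
by apply: row_frame_agree => //; [exact: ltnW|rewrite /frame_idx il ltnn ltn0].
Qed.

Lemma shear_frame_all l s : (l <= k)%N -> (k + k <= N)%N ->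
  frame l *m shear xpredT s = frame 0 + s *: (frame l - frame 0).
Proof.
move=> lk kN; apply/row_matrixP => i; rewrite shear_frame // andbT.
rewrite [in RHS]linearD /= [in RHS]linearZ /= [in RHS]linearB /=.
case: ltnP => il; first by rewrite scalerBl scale1r scalerBr addrA addrAC.
rewrite (_ : row i (frame l) = row i (frame 0)) ?subrr ?scaler0 ?addr0 //.
by apply: row_frame_agree => //; rewrite /frame_idx ltn0 ltnNge il.
Qed.

Lemma linear_curve (u v : extpow) (s : K) :
  \row_a ((u 0 a)%:P + 'X * (v 0 a)%:P).[s] = u + s *: v.
Proof. by apply/rowP => a; rewrite !mxE hornerD hornerC hornerM hornerX hornerC. Qed.

(** Only row l moves with s, so by multilinearity the curve is linear in s; its value at 0 is
    [secant_rep l]. *)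
Lemma Sigma_sub_closure l : (0 < l < k)%N -> (k + k <= N)%N ->
  @Sigma K k N l `<=` zclosure (Sigma l.+1).
Proof.
move=> hl kN; rewrite !Sigma_GL_orbit //; try lia.
pose v := wedge (frame l.+1) - wedge (frame l).
apply: (@curve_GL_orbit _ _ (fun a => (secant_rep K k N l 0 a)%:P + 'X * (v 0 a)%:P)).
- by apply: secant_rep_neq0; lia.
- move=> s s0; rewrite linear_curve; exists (shear (pred1 l) s)^T.
    by rewrite /= unitmx_tr shear_unit.
  rewrite mulmxDl !wedge_act trmxK shear_frame0 // shear_frameS //; last by lia.
  congr (<[_]>%VS); rewrite -addrA; congr (_ + _).
  have lk : (l < k)%N by lia.
  have agree (j : 'I_k) : j != Ordinal lk -> row j (frame l.+1) = row j (frame l).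
    move=> jl; apply: row_frame_agree; try lia.
    rewrite /frame_idx ltnS leq_eqVlt; case: eqP => // E.
    by move: jl; rewrite -(inj_eq val_inj) /= E eqxx.
  rewrite (@wedge_row_lin _ _ _ (Ordinal lk) (1 - s) s (frame l) (frame l.+1)).
  - by rewrite scalerBl scale1r scalerBr addrA addrAC.
  - move=> j /agree E; rewrite linearD /= linearZ /= linearB /= E.
    by rewrite subrr scaler0 addr0.
  - move=> j /agree E; rewrite linearD /= linearZ /= linearB /= E.
    by rewrite subrr scaler0 addr0.
  - rewrite linearD /= linearZ /= linearB /=.
    by rewrite scalerBl scale1r scalerBr addrA addrAC.
- by rewrite linear_curve scale0r addr0.
- by apply: secant_rep_neq0; lia.
Qed.

Lemma Theta_sub_closure l : (0 < l < k)%N -> (k + k <= N)%N ->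
  @Theta K k N l `<=` zclosure (Theta l.+1).
Proof.
move=> hl kN; rewrite !Theta_GL_orbit //; try lia.
pose v := tangent_vector (frame 0) (frame l.+1 - frame l).
apply: (@curve_GL_orbit _ _ (fun a => (tangent_rep K k N l 0 a)%:P + 'X * (v 0 a)%:P)).
- by apply: tangent_rep_neq0; lia.
- move=> s s0; rewrite linear_curve; exists (shear (pred1 l) s)^T.
    by rewrite /= unitmx_tr shear_unit.
  rewrite tangent_vector_act trmxK mulmxBl shear_frame0 // shear_frameS //; last by lia.
  by rewrite addrAC tangent_vectorD tangent_vectorZ.
- by rewrite linear_curve scale0r addr0.
- by apply: tangent_rep_neq0; lia.
Qed.

Lemma Theta_sub_closure_Sigma l : (0 < l <= k)%N -> (k + k <= N)%N ->
  @Theta K k N l `<=` zclosure (Sigma l).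
Proof.
move=> hl kN; rewrite Theta_GL_orbit // Sigma_GL_orbit //.
pose w (J : {set 'I_k}) := wedge (mixrows J (frame 0) (frame l - frame 0)).
(* x s is the difference quotient of wedge along the line from frame 0 to frame l. *)
pose x (s : K) := \sum_(J | J != finset.set0) s ^+ #|J|.-1 *: w J.
pose p a := \sum_(J : {set 'I_k} | J != finset.set0) 'X^(#|J|.-1) * (w J 0 a)%:P.
have pE s : \row_a (p a).[s] = x s.
  apply/rowP => a; rewrite !mxE /p horner_sum summxE; apply: eq_bigr => J _.
  by rewrite hornerM hornerXn hornerC [RHS]mxE.
apply: (@curve_GL_orbit _ _ p).
- exact: secant_rep_neq0.
- move=> s s0; rewrite pE -Sigma_GL_orbit // -(line_scale _ s0).
  have -> : s *: x s = 1 *: wedge (frame l *m shear xpredT s) +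
                       (-1) *: wedge (frame 0 *m shear xpredT s).
    rewrite shear_frame0 // shear_frame_all //; last by lia.
    rewrite scale1r scaleN1r wedge_add (bigD1 finset.set0) //=.
    rewrite (_ : mixrows finset.set0 _ _ = frame 0); last by apply/matrixP => i j; rewrite !mxE inE.
    rewrite addrAC subrr add0r /x scaler_sumr; apply: eq_bigr => J J0.
    rewrite scalerA -exprS prednK ?wedge_mixZ //.
    by rewrite card_gt0.
  have ug := shear_unit xpredT s0.
  apply: Sigma_comb; rewrite ?oppr_eq0 ?oner_eq0 //; first by lia.
  - by rewrite /row_free mxrankMfree ?row_free_unit //; apply: frame_row_free; lia.
  - by rewrite /row_free mxrankMfree ?row_free_unit //; apply: frame_row_free; lia.
  - rewrite -mul_col_mx mxrankMfree ?row_free_unit // -addsmxE addsmxC addsmxE.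
    by apply: rank_frames; lia.
(* At s = 0 only the sets J with one element remain, and they add up to the tangent vector. *)
- rewrite pE /x /tangent_rep tangent_vectorE (bigID (fun J : {set 'I_k} => #|J| == 1%N)) /=.
  rewrite [X in _ = _ + X]big1 ?addr0; last first.
    move=> J /andP []; rewrite -card_gt0 expr0n.
    by case: #|J| => [|[|n]] //= _ _; rewrite scale0r.
  rewrite (eq_bigl (mem [set [set i]%SET | i : 'I_k]%SET)); last first.
    move=> J /=; apply/andP/imsetP => [[_ /cards1P [i ->]]|[i _ ->]]; first by exists i.
    by rewrite cards1 -card_gt0 cards1.
  rewrite big_imset /=; last by move=> i j _ _; exact: set1_inj.
  by apply: eq_bigr => i _; rewrite cards1 expr0 scale1r.
- exact: tangent_rep_neq0.
Qed.

End Closures.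

(** * Limits of secants and tangents *)

Section Specialization.
Variables (K : numClosedFieldType) (k N : nat).
Local Notation extpow := (extpow K k N).
Local Notation n := #|incr_tuples k N|.
Implicit Types (t v : extpow) (L : {vspace extpow}) (S : set {vspace extpow}) (f : {mpoly K[n]}).

Lemma meval_homog d (p : {mpoly K[n]}) c (v : 'I_n -> K) : p \is d.-homog ->
  p.@[fun a => c * v a] = c ^+ d * p.@[v].
Proof.
move=> /dhomogP hp; rewrite !mevalE big_distrr [LHS]big_seq [RHS]big_seq /=.
apply: eq_bigr => m mp.
rewrite mulrCA; congr (_ * _); under eq_bigr do rewrite exprMn; rewrite big_split /=.
by rewrite -(hp m mp) prodrXr -mdegE.
Qed.

(** Closed sets are cut out by homogeneous polynomials, while f is arbitrary. As f vanishes on s *: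
    v for all s, each of its homogeneous components vanishes on S, and then on the closure. *)
Lemma homog_components_vanish S f : (forall L, S L -> is_point L) ->
  (forall L v, S L -> v \in L -> f.@[fun a => v 0 a] = 0) ->
  forall L t, zclosure S L -> t \in L -> f.@[fun a => t 0 a] = 0.
Proof.
move=> pS vanish L t cL tL.
pose comp d : {mpoly K[n]} := pihomog mdeg d f.
have fE : f = \sum_(d < msize f) comp d by apply: pihomog_partitionE; rewrite mmeasureE.
have compv M v (d : 'I_(msize f)) : S M -> v \in M -> (comp d).@[fun a => v 0 a] = 0.
  move=> SM vM; pose q := \poly_(d < msize f) (comp d).@[fun a => v 0 a].
  have q0 : q = 0.
    apply: poly_eq0_nonzero_roots => s _; apply/rootP; rewrite horner_poly.
    have E := vanish M (s *: v) SM (memvZ _ vM); rewrite fE raddf_sum /= in E.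
    rewrite -[RHS]E; apply: eq_bigr => e _.
    rewrite mulrC -(@meval_homog e) ?pihomogP //.
    by apply: meval_eq => a; rewrite mxE.
  by have /polyP/(_ d) := q0; rewrite coef_poly coef0 ltn_ord.
pose F := [set comp (d : nat) | d in [set: 'I_(msize f)]].
pose Z := [set M : {vspace extpow} | is_point M /\
  forall f x, F f -> x \in M -> f.@[fun a => x 0 a] = 0].
have [_ ZL] : Z L.
  apply: (zclosure_min _ _ cL); first by exists F => // _ [d _ <-]; exists d; exact: pihomogP.
  move=> M SM; split; first exact: pS.
  by move=> _ x [d _ <-] xM; exact: compv xM.
rewrite fE raddf_sum big1 // => d _; apply: (ZL _ _ _ tL).
by exists d.
Qed.

Lemma meval_mmap m (X : 'I_n -> {mpoly K[m]}) f (p : 'I_m -> K) :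
  (mmap (@mpolyC m K) X f).@[p] = f.@[fun a => (X a).@[p]].
Proof.
rewrite {1}/mmap raddf_sum [RHS]mevalE; apply: eq_bigr => e _ /=.
rewrite rmorphM /= mevalC; congr (_ * _); rewrite /mmap1 rmorph_prod.
by apply: eq_bigr => i _; rewrite rmorphXn.
Qed.

(** X has to parametrize all vectors of each line of S, not only a representative, so that a
    relation between the X a vanishes on whole lines. *)
Lemma zclosure_specialization m (X : 'I_n -> {mpoly K[m]}) S L t :
  (forall L, S L -> is_point L) ->
  (forall L v, S L -> v \in L -> exists p, forall a, (X a).@[p] = v 0 a) ->
  zclosure S L -> t \in L ->
  exists2 G : set ({fraction {mpoly K[m]}} * K), place G &
    forall a, G (tofrac (X a), t 0 a).
Proof.
move=> pS param cL tL.
pose ev f := mmap (@mpolyC m K) X f.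
have vanish f : ev f = 0 -> f.@[fun a => t 0 a] = 0.
  move=> f0; apply: (homog_components_vanish pS _ cL tL) => M v SM vM.
  have [p hp] := param M v SM vM.
  have := meval_mmap X f p; rewrite -/(ev f) f0 meval0 => ->.
  by apply: meval_eq => a; rewrite hp.
pose G0 := [set (tofrac (ev f), f.@[fun a => t 0 a]) | f in [set: {mpoly K[n]}]].
have hG0 : partial_hom G0.
  split.
  - by exists 1 => //; rewrite /ev !rmorph1.
  - by move=> _ _ _ _ [f _ [<- <-]] [h _ [<- <-]]; exists (f - h) => //; rewrite /ev !rmorphB.
  - by move=> _ _ _ _ [f _ [<- <-]] [h _ [<- <-]]; exists (f * h) => //; rewrite /ev !rmorphM.
  - by move=> c [f _ [/eqP]]; rewrite tofrac_eq0 => /eqP /vanish -> <-.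
have [G pG sG] := place_extension hG0; exists G => // a.
apply: sG; exists 'X_a => //.
by rewrite /ev [mmap _ _ _]mmapX mmap1U mevalXU.
Qed.

End Specialization.

(** * Reduction of scalars and matrices along a place *)

Section Limits.
Variables (F : fieldType) (K : closedFieldType) (G : set (F * K)) (pG : place G).
Variables (k N : nat).
Let hG : partial_hom G := pG.1.

Definition integral x := exists c, G (x, c).

Lemma integralM x y : integral x -> integral y -> integral (x * y).
Proof. by move=> [c h] [d h']; exists (c * d); apply: phomM. Qed.

Lemma integralB x y : integral x -> integral y -> integral (x - y).
Proof. by move=> [c h] [d h']; exists (c - d); apply: phomB. Qed.

Lemma place_inv x c : G (x, c) -> c != 0 -> G (x^-1, c^-1).
Proof.
move=> h c0; have x0 : x != 0.
  by apply: contraNneq c0 => x0; move: h; rewrite x0 => /(phom_eq0 hG) ->.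
have [_ /(_ x^-1)] := pG; rewrite invrK => -[[d h']|h'].
  have := phomM hG h h'; rewrite divff // => /(phom_inj hG (phom1 hG)) /esym E.
  by rewrite -[c^-1](mulr1) -E mulKf.
by move: c0; rewrite (phom_inj hG h h') eqxx.
Qed.

(** Integrality of x j / x i stands in for a comparison of valuations. If x a / x i is not integral,
    its inverse has the value 0 and a takes the place of i. *)
Lemma place_max (I : finType) (x : I -> F) : (exists i, x i != 0) ->
  exists2 i, x i != 0 & forall j, integral (x j / x i).
Proof.
move=> [i0 h0].
suff h (s : seq I) : has (fun i => x i != 0) s ->
    exists2 i, x i != 0 & forall j, j \in s -> integral (x j / x i).
  have [|i xi hi] := h (enum I); first by apply/hasP; exists i0; rewrite ?mem_enum.
  by exists i => // j; apply: hi; rewrite mem_enum.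
have int0 : integral 0 by exists 0; exact: phom0.
elim: s => //= a s IH; have [/IH [i xi hi] _|ns] := boolP (has (fun i => x i != 0) s).
  have [_ /(_ (x a / x i))] := pG; move=> [h|h].
    by exists i => // j; rewrite inE => /orP [/eqP ->|/hi].
  have [xa|xa] := eqVneq (x a) 0.
    by exists i => // j; rewrite inE => /orP [/eqP ->|/hi //]; rewrite xa mul0r.
  exists a => // j; rewrite inE => /orP [/eqP ->|/hi hj].
    by rewrite divff //; exists 1; exact: phom1.
  rewrite (_ : x j / x a = (x j / x i) * (x a / x i)^-1).
    by apply: integralM => //; exists 0.
  by rewrite invf_div mulrA divfK.
rewrite orbF => xa; exists a => // j; rewrite inE => /orP [/eqP ->|js].
  by rewrite divff //; exists 1; exact: phom1.
have /hasPn/(_ j js)/negPn/eqP -> := ns.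
by rewrite mul0r.
Qed.

Definition reduces m n (A : 'M[F]_(m, n)) (B : 'M[K]_(m, n)) := forall i j, G (A i j, B i j).

Lemma reduces_exists m n (A : 'M[F]_(m, n)) : (forall i j, integral (A i j)) ->
  exists B, reduces A B.
Proof.
move=> h; have /choice [b hb] : forall z : 'I_m * 'I_n, exists c, G (A z.1 z.2, c) by move=> z; exact: h.
by exists (\matrix_(i, j) b (i, j)) => i j; rewrite mxE; exact: hb (i, j).
Qed.

Lemma reduces_inj m n (A : 'M[F]_(m, n)) B B' : reduces A B -> reduces A B' -> B = B'.
Proof. by move=> h h'; apply/matrixP => i j; exact: phom_inj (h i j) (h' i j). Qed.

Lemma phom_sign (s : bool) : G ((-1) ^+ s, (-1) ^+ s).
Proof. by apply: phomX => //; apply: phomN => //; exact: phom1. Qed.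

Lemma phom_nat b : G (b%:R, b%:R).
Proof.
elim: b => [|b IH]; first exact: phom0.
by rewrite -!natr1; apply: phomD => //; exact: phom1.
Qed.

Lemma reduces_det m (A : 'M[F]_m) B : reduces A B -> G (\det A, \det B).
Proof.
move=> h; apply: phom_sum => // s _; apply: phomM => //; first exact: phom_sign.
by apply: phom_prod => // i _; exact: h.
Qed.

Lemma reduces_mulmx m n p (A : 'M[F]_(m, n)) (B : 'M[F]_(n, p)) A' B' :
  reduces A A' -> reduces B B' -> reduces (A *m B) (A' *m B').
Proof. by move=> h h' i j; rewrite !mxE; apply: phom_sum => // l _; apply: phomM. Qed.

Lemma reduces_mxsub m n m' n' (f : 'I_m' -> 'I_m) (g : 'I_n' -> 'I_n) (A : 'M[F]_(m, n)) B :
  reduces A B -> reduces (mxsub f g A) (mxsub f g B).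
Proof. by move=> h i j; rewrite !mxE; exact: h. Qed.

Lemma reduces_wedge (M : 'M[F]_(k, N)) A : reduces M A -> reduces (wedge M) (wedge A).
Proof. by move=> h i j; rewrite !mxE; apply/reduces_det/reduces_mxsub. Qed.

Lemma reduces_pairing (t : extpow F k N) t' C C' :
  reduces t t' -> reduces C C' -> G (pairing t C, pairing t' C').
Proof.
move=> h h'; apply: phom_sum => // a _; apply: phomM => //.
by apply/reduces_det/reduces_mxsub.
Qed.

Lemma reduces_invmx m (A : 'M[F]_m) B : reduces A B -> B \in unitmx ->
  A \in unitmx /\ reduces (invmx A) (invmx B).
Proof.
move=> h uB; have d := reduces_det h.
have dB : \det B != 0 by rewrite -unitfE -unitmxE.
have dA : \det A != 0.
  by apply: contraNneq dB => E; move: d; rewrite E => /(phom_eq0 hG) ->.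
have uA : A \in unitmx by rewrite unitmxE unitfE.
split=> //; rewrite /invmx uA uB => i j; rewrite !mxE.
apply: phomM => //; first exact: place_inv.
apply: phomM => //; first by apply: phomX => //; apply: phomN => //; exact: phom1.
by apply: reduces_det => a b; rewrite !mxE; exact: h.
Qed.

Lemma reduces_mixrows n (J : {set 'I_k}) (A B : 'M[F]_(k, n)) A' B' :
  reduces A A' -> reduces B B' -> reduces (mixrows J A B) (mixrows J A' B').
Proof. by move=> h h' i j; rewrite !mxE; case: ifP. Qed.

End Limits.

(** * Normalization of a matrix at a minor *)

Section Pivots.
Variables (k N : nat).
Implicit Types (f : {ffun 'I_k -> 'I_N}).

Definition select_cols (R : pzSemiRingType) f : 'M[R]_(N, k) := \matrix_(i, j) (i == f j)%:R.
(** Pivots are arbitrary maps and not increasing tuples, so that one column can be exchanged without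
    sorting again. *)
Definition repl_idx f (i : 'I_k) (j : 'I_N) : {ffun 'I_k -> 'I_N} :=
  [ffun a => if a == i then j else f a].

Lemma mul_select_cols (R : pzSemiRingType) m (M : 'M[R]_(m, N)) f : M *m select_cols R f = colsub f M.
Proof.
apply/matrixP => i j; rewrite !mxE (bigD1 (f j)) //= !mxE eqxx mulr1 big1 ?addr0 // => a /negPf h.
by rewrite mxE h mulr0.
Qed.

(** Next to a pivot equal to 1, the minors with one column exchanged are the entries of the matrix.
    Bounds on coordinates become bounds on entries in this way. *)
Lemma det_repl_col1 (R : comNzRingType) (i : 'I_k) (v : 'I_k -> R) :
  \det (\matrix_(a, b) if b == i then v a else (a == b)%:R) = v i.
Proof.
rewrite (expand_det_row _ i) (bigD1 i) //= !mxE eqxx big1 ?addr0 => [|b bi]; last first.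
  by rewrite mxE (negPf bi) eq_sym (negPf bi) mul0r.
rewrite ?addr0 /cofactor -signr_odd addnn odd_double expr0 mul1r.
rewrite (_ : row' i (col' i _) = 1%:M) ?det1 ?mulr1 //.
by apply/matrixP => a b; rewrite !mxE eq_sym (negPf (neq_lift _ _)) (inj_eq lift_inj).
Qed.

Lemma colsub_repl_idx (R : pzSemiRingType) (M : 'M[R]_(k, N)) f i j : colsub f M = 1%:M ->
  colsub (repl_idx f i j) M = \matrix_(a, b) if b == i then M a j else (a == b)%:R.
Proof.
move=> /matrixP h; apply/matrixP => a b; rewrite !mxE ffunE; case: eqP => // _.
by have := h a b; rewrite !mxE.
Qed.

Lemma pivot_row_free (K : fieldType) (M : 'M[K]_(k, N)) f : colsub f M = 1%:M -> row_free M.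
Proof. by move=> h; apply/row_freeP; exists (select_cols K f); rewrite mul_select_cols. Qed.

End Pivots.

(** * Limits of secant and tangent vectors along a place *)

Section SecantLimit.
Variables (F : fieldType) (K : closedFieldType) (G : set (F * K)) (pG : place G).
Variables (k N : nat).
Let hG : partial_hom G := pG.1.
Local Notation reduces := (reduces G).
Local Notation integral := (integral G).

Lemma pivot_exists (M : 'M[F]_(k, N)) : row_free M ->
  exists f : {ffun 'I_k -> 'I_N}, exists2 P : 'M[F]_k, P \in unitmx &
    colsub f (P *m M) = 1%:M /\ forall i j, integral ((P *m M) i j).
Proof.
rewrite -wedge_neq0 => w0.
have [|f df hf] := @place_max F K G pG _ (fun f : {ffun 'I_k -> 'I_N} => \det (colsub f M)).
  have [a ha] : exists a, wedge M 0 a != 0.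
    apply/existsP; apply: contraNT w0; rewrite negb_exists => /forallP h.
    by apply/eqP/rowP => a; rewrite [RHS]mxE; apply/eqP; have := h a; rewrite negbK.
  exists (finfun (idx a)); move: ha; rewrite mxE; congr (~~ (\det _ == 0)).
  by apply/matrixP => i j; rewrite !mxE ffunE.
have uf : colsub f M \in unitmx by rewrite unitmxE unitfE.
have colM (g : {ffun 'I_k -> 'I_N}) : colsub g (invmx (colsub f M) *m M) = invmx (colsub f M) *m colsub g M.
  by rewrite -!mul_select_cols mulmxA.
exists f, (invmx (colsub f M)); first by rewrite unitmx_inv.
have h1 : colsub f (invmx (colsub f M) *m M) = 1%:M by rewrite colM mulVmx.
split=> // i j.
(* Each entry is a minor of M divided by the chosen one, hence integral by the choice of f. *)
have := det_repl_col1 i (fun a => (invmx (colsub f M) *m M) a j).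
rewrite -(colsub_repl_idx i j h1) colM det_mulmx det_inv mulrC => <-.
exact: hf.
Qed.

Lemma reduces_pivot (M : 'M[F]_(k, N)) (A : 'M[K]_(k, N)) (f : {ffun 'I_k -> 'I_N}) :
  reduces M A -> colsub f M = 1%:M -> colsub f A = 1%:M.
Proof.
move=> h e; apply: (reduces_inj pG (A := colsub f M)); first exact: reduces_mxsub.
by rewrite e => i j; rewrite !mxE; exact: phom_nat.
Qed.

Lemma reduces_select_cols f : reduces (select_cols F f) (select_cols K (f : {ffun 'I_k -> 'I_N})).
Proof. by move=> i j; rewrite !mxE; exact: phom_nat. Qed.

Lemma integral_pairing (t : extpow F k N) t' f : reduces t t' ->
  integral (pairing t (select_cols F f)).
Proof.
by move=> h; eexists; apply: (reduces_pairing pG h (reduces_select_cols f)).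
Qed.

Lemma wedge_scaled_row (L : fieldType) (i : 'I_k) c (X Y : 'M[L]_(k, N)) :
  (forall j, j != i -> row j Y = row j X) -> row i Y = c *: row i X -> wedge Y = c *: wedge X.
Proof.
move=> h hi; rewrite (@wedge_row_lin _ _ _ i c 0 X X Y) ?scale0r ?addr0 // => j ji.
  by rewrite h.
by rewrite h.
Qed.

(** The factor b is given to one row i of J, where b *: D has a finite value. Any further row of J
    reduces to 0. *)
Lemma mixed_wedge_reduces (M D : 'M[F]_(k, N)) (A W : 'M[K]_(k, N)) b (J : {set 'I_k}) :
  reduces M A -> reduces D 0 -> reduces (b *: D) W -> J != finset.set0 ->
  reduces (b *: wedge (mixrows J M D))
          (if #|J| == 1%N then wedge (mixrows J A W) else 0).
Proof.
move=> hM hD hW /set0Pn [i iJ].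
pose Y (L : fieldType) (M D D' : 'M[L]_(k, N)) : 'M[L]_(k, N) :=
  \matrix_(j, l) if j == i then D' j l else mixrows J M D j l.
have eY : b *: wedge (mixrows J M D) = wedge (Y _ M D (b *: D)).
  symmetry; apply: (@wedge_scaled_row _ i).
    by move=> j /negPf ji; apply/rowP => l; rewrite !mxE ji.
  by apply/rowP => l; rewrite !mxE eqxx iJ.
have hY : reduces (Y _ M D (b *: D)) (Y _ A 0 W).
  move=> j l; rewrite [Y _ _ _ _ _ _]mxE [Y _ A _ _ _ _]mxE; case: ifP => _; first exact: hW.
  by apply: reduces_mixrows.
rewrite eY (_ : (if _ then _ else _) = wedge (Y _ A 0 W)); first exact: reduces_wedge.
case: eqP => [/eqP/cards1P [i' eJ]|J1].
  have ii : i' = i by move: iJ; rewrite eJ inE => /eqP ->.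
  subst i'; congr wedge; apply/matrixP => j l; rewrite !mxE eJ inE.
  by case: ifP => // ji; rewrite !mxE eJ inE ji.
have [j jJ ji] : exists2 j, j \in J & j != i.
  apply: contrapT => h; apply: J1; apply/eqP/cards1P; exists i.
  apply/setP => j; rewrite inE; apply/idP/eqP => [jJ|-> //].
  by apply/eqP; apply: contrapT => /negP ji; apply: h; exists j.
symmetry; apply: (@wedge_row0 _ _ _ _ j); apply/rowP => l.
by rewrite !mxE (negPf ji) ?mxE jJ ?mxE.
Qed.

Lemma tangent_absorb (L : fieldType) c (A W : 'M[L]_(k, N)) : (0 < k)%N ->
  exists W', c *: wedge A + tangent_vector A W = tangent_vector A W'.
Proof.
move=> k0; pose i0 := Ordinal k0.
exists (c *: (delta_mx i0 i0 *m A) + W).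
rewrite tangent_vectorD tangent_vectorZ tangent_vector_same.
rewrite (_ : \tr _ = 1) ?scale1r // /mxtrace (bigD1 i0) //= big1 ?addr0 ?mxE ?eqxx //.
by move=> i ii0; rewrite mxE (negPf ii0).
Qed.

(* Both points degenerate to the same point of the Grassmannian. *)
Lemma confluent_secant_limit (M M' : 'M[F]_(k, N)) (A : 'M[K]_(k, N)) (f : {ffun 'I_k -> 'I_N})
    a b t : (0 < k)%N ->
  colsub f M = 1%:M -> colsub f M' = 1%:M -> reduces M A -> reduces M' A ->
  reduces (a *: wedge M + b *: wedge M') t -> exists W, t = tangent_vector A W.
Proof.
move=> k0 eM eM' hM hM' ht.
set tau := _ + _ in ht; pose D := M' - M; pose s := a + b.
(* Both pivot minors are 1, so s is the pairing of the secant vector at f. Exchanging a column of f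
   gives a * M i j + b * M' i j, that is s * M i j + (b *: D) i j; hence b *: D is integral as
   well. *)
have hs : integral s.
  have := integral_pairing f ht.
  by rewrite pairingD !pairingZ !pairing_wedge !mul_select_cols eM eM' det1 !mulr1.
have hD : reduces D 0.
  move=> i j; rewrite !mxE -(subrr (A i j)); apply: (phomB hG); [exact: hM'|exact: hM].
have hbD i j : integral ((b *: D) i j).
  have := integral_pairing (repl_idx f i j) ht.
  rewrite pairingD !pairingZ !pairing_wedge !mul_select_cols !colsub_repl_idx // !det_repl_col1.
  move=> h; rewrite (_ : (b *: D) i j = a * M i j + b * M' i j - s * M i j).
    by apply: (integralB pG) => //; apply: (integralM pG) => //; exists (A i j); exact: hM.
  by rewrite !mxE /s; ring.
have [W hW] := reduces_exists hbD; have [c hc] := hs.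
have [W' eW'] := tangent_absorb c A W k0; exists W'; rewrite -eW'.
apply: (reduces_inj pG ht) => i j.
have -> : tau = s *: wedge M + \sum_(J | J != finset.set0) b *: wedge (mixrows J M D).
  rewrite -scaler_sumr /tau (_ : M' = M + D); last by rewrite addrC subrK.
  rewrite wedge_add (bigD1 finset.set0) //= (_ : mixrows finset.set0 M D = M); last first.
    by apply/matrixP => x y; rewrite !mxE inE.
  by rewrite scalerDr addrA -scalerDl.
have -> : c *: wedge A + tangent_vector A W = c *: wedge A +
    \sum_(J : {set 'I_k} | J != finset.set0) (if #|J| == 1%N then wedge (mixrows J A W) else 0).
  congr (_ + _); rewrite tangent_vectorE -big_mkcondr /=.
  rewrite [RHS](eq_bigl (mem [set [set i]%SET | i : 'I_k]%SET)); last first.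
    move=> J /=; apply/andP/imsetP => [[_ /cards1P [x ->]]|[x _ ->]]; first by exists x.
    by rewrite cards1 -card_gt0 cards1.
  by rewrite big_imset //= => x y _ _; exact: set1_inj.
rewrite [in X in G (X, _)]mxE [in X in G (_, X)]mxE; apply: (phomD hG).
  by rewrite !mxE; apply: (phomM hG) => //; have := reduces_wedge pG hM i j; rewrite !mxE.
by rewrite !summxE; apply: (phom_sum hG) => J J0; exact: mixed_wedge_reduces.
Qed.

Lemma unbounded_secant_limit (M M' : 'M[F]_(k, N)) (A B : 'M[K]_(k, N))
    (f f' : {ffun 'I_k -> 'I_N}) a b t : (0 < k)%N ->
  colsub f M = 1%:M -> colsub f' M' = 1%:M -> reduces M A -> reduces M' B ->
  reduces (a *: wedge M + b *: wedge M') t -> ~ integral a -> integral (b / a) ->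
  exists W, t = tangent_vector A W.
Proof.
move=> k0 eM eM' hM hM' ht na [r hr].
have a0 : a != 0 by apply/eqP => a0; apply: na; rewrite a0; exists 0; exact: phom0.
have Ga : G (a^-1, 0) by have [_ /(_ a) []] := pG.
have fA := pivot_row_free (reduces_pivot hM eM).
have fB := pivot_row_free (reduces_pivot hM' eM').
(* After division by a the secant vector has the value 0, since t is finite and a^-1 has the value
   0. *)
have E : wedge A + r *: wedge B = 0.
  apply: (reduces_inj pG (A := a^-1 *: (a *: wedge M + b *: wedge M'))) => i j.
    rewrite scalerDr !scalerA mulVf // scale1r (mulrC _ b) [in X in G (X, _)]mxE [in X in G (_, X)]mxE.
    apply: (phomD hG); first exact: reduces_wedge.
    by rewrite [in X in G (X, _)]mxE [in X in G (_, X)]mxE; apply: (phomM hG) => //; exact: reduces_wedge.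
  rewrite [in X in G (X, _)]mxE [in X in G (_, X)]mxE -(mul0r (t i j)).
  exact: (phomM hG).
have r0 : r != 0.
  apply: contraTneq fA => r0; move: E; rewrite r0 scale0r addr0 => w0.
  by rewrite -wedge_neq0 w0 eqxx.
have /submxP [Q eB] : (B <= A)%MS.
  apply: wedge_line_inj => //; move/eqP: E; rewrite addr_eq0 => /eqP ->.
  by rewrite -scaleNr line_scale // oppr_eq0.
have uQ : Q \in unitmx.
  rewrite -row_free_unit /row_free -(mxrankMfree Q fA) -eB.
  exact: fB.
(* M' is normalized at f', but at f it has the columns C, which reduce to the invertible Q because
   [colsub f A] is the identity. So M' can be normalized again at f, and then reduces to A. *)
pose C := colsub f M'.
have hC : reduces C Q.
  rewrite (_ : Q = colsub f B); first exact: reduces_mxsub.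
  by rewrite eB -!mul_select_cols -mulmxA mul_select_cols (reduces_pivot hM eM) mulmx1.
have [uC hC'] := reduces_invmx pG hC uQ.
apply: (@confluent_secant_limit M (invmx C *m M') A f a (b * \det C) t) => //.
- by rewrite -mul_select_cols -mulmxA mul_select_cols mulVmx.
- by rewrite (_ : A = invmx Q *m B); [exact: reduces_mulmx|rewrite eB mulKmx].
- by rewrite wedge_mull det_inv scalerA mulfK // -unitfE -unitmxE.
Qed.

Lemma secant_limit (M M' : 'M[F]_(k, N)) (t : extpow K k N) : (0 < k)%N ->
  row_free M -> row_free M' -> reduces (wedge M + wedge M') t ->
  (exists A B a b, [/\ row_free A, row_free B & t = a *: wedge A + b *: wedge B]) \/
  (exists A W, row_free A /\ t = tangent_vector A W).
Proof.
move=> k0 fM fM' ht.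
have [f [P uP [eM iM]]] := pivot_exists fM.
have [f' [P' uP' [eM' iM']]] := pivot_exists fM'.
have [A hA] := reduces_exists iM; have [B hB] := reduces_exists iM'.
have fA := pivot_row_free (reduces_pivot hA eM).
have fB := pivot_row_free (reduces_pivot hB eM').
set a := (\det P)^-1; set b := (\det P')^-1.
have wM : wedge M = a *: wedge (P *m M).
  by rewrite wedge_mull scalerA mulVf ?scale1r // -unitfE -unitmxE.
have wM' : wedge M' = b *: wedge (P' *m M').
  by rewrite wedge_mull scalerA mulVf ?scale1r // -unitfE -unitmxE.
rewrite wM wM' in ht.
have a0 : a != 0 by rewrite invr_eq0 -unitfE -unitmxE.
have b0 : b != 0 by rewrite invr_eq0 -unitfE -unitmxE.
have inv_int x : ~ integral x -> G (x^-1, 0) by have [_ /(_ x) []] := pG.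
have swapped : ~ integral b -> integral (a / b) -> exists W, t = tangent_vector B W.
  move=> nb iab; apply: (unbounded_secant_limit k0 eM' eM hB hA _ nb iab).
  by rewrite addrC.
have [ib|nb] := pselect (integral b); have [ia|na] := pselect (integral a).
- left; have [c hc] := ia; have [d hd] := ib; exists A, B, c, d; split=> //.
  apply: (reduces_inj pG ht) => i j.
  rewrite [in X in G (X, _)]mxE [in X in G (_, X)]mxE; apply: (phomD hG);
    rewrite [in X in G (X, _)]mxE [in X in G (_, X)]mxE; apply: (phomM hG) => //;
    exact: reduces_wedge.
- right; exists A; have [|W ->] := unbounded_secant_limit k0 eM eM' hA hB ht na; last by exists W.
  by apply: (integralM pG) => //; exists 0; exact: inv_int.
- right; exists B; have [|W ->] := swapped nb; last by exists W.
  by apply: (integralM pG) => //; exists 0; exact: inv_int.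
(* If b / a has no value then a / b has the value 0, and the two matrices exchange their roles. *)
- right; have [iba|nba] := pselect (integral (b / a)).
    by exists A; have [W ->] := unbounded_secant_limit k0 eM eM' hA hB ht na iba; exists W.
  exists B; have [|W ->] := swapped nb; last by exists W.
  by exists 0; rewrite -invf_div; exact: inv_int.
Qed.

Lemma reduces_tangent_vector (M W : 'M[F]_(k, N)) A V :
  reduces M A -> reduces W V -> reduces (tangent_vector M W) (tangent_vector A V).
Proof.
move=> hM hW i j; rewrite !tangent_vectorE !summxE; apply: (phom_sum hG) => x _.
by apply: reduces_wedge => //; exact: reduces_mixrows.
Qed.

(** No unbounded case remains here: once M is normalized at f and W vanishes in the columns f, the
    trace and all entries of W2 are integral, being computed from coordinates of the tangent vector
    and entries of M'. *)
Lemma tangent_limit (M W : 'M[F]_(k, N)) (t : extpow K k N) : (0 < k)%N -> row_free M ->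
  reduces (tangent_vector M W) t -> exists A V, row_free A /\ t = tangent_vector A V.
Proof.
move=> k0 fM ht; have [f [P uP [eM iM]]] := pivot_exists fM.
have [A hA] := reduces_exists iM.
have fA := pivot_row_free (reduces_pivot hA eM).
set M' := P *m M in eM iM hA.
(* The scalar compensates for the change of basis by P. Subtracting X *m M' clears the columns f and
   costs only the trace of X. *)
pose W1 := (\det P)^-1 *: (P *m W); pose X := colsub f W1; pose W2 := W1 - X *m M'.
have dP : \det P != 0 by rewrite -unitfE -unitmxE.
have eW : tangent_vector M W = \tr X *: wedge M' + tangent_vector M' W2.
  rewrite -tangent_vector_same -tangent_vectorD addrC subrK /W1 tangent_vectorZ.
  by rewrite tangent_vector_mull scalerA mulVf ?scale1r.
rewrite eW in ht.
have fW2 : colsub f W2 = 0.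
  by rewrite -mul_select_cols mulmxBl -mulmxA !mul_select_cols eM mulmx1 subrr.
clearbody W2.
have int_tr : integral (\tr X).
  have := integral_pairing f ht.
  rewrite pairingD pairingZ pairing_wedge pairing_tangent !mul_select_cols eM fW2 det1 mulr1.
  by rewrite ddetE mul0mx mxtrace0 addr0.
have int_W2 i j : integral (W2 i j).
  have := integral_pairing (repl_idx f i j) ht.
  rewrite pairingD pairingZ pairing_wedge pairing_tangent !mul_select_cols.
  rewrite [X in _ * \det X](colsub_repl_idx i j eM) det_repl_col1.
  rewrite (_ : ddet _ _ = W2 i j) => [h|].
    rewrite -(addrK (\tr X * M' i j) (W2 i j)) [W2 i j + _]addrC.
    by apply: (integralB pG) => //; apply: (integralM pG) => //; exists (A i j); exact: hA.
  have cW2 : colsub (repl_idx f i j) W2 = \matrix_(a, b) if b == i then W2 a j else 0.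
    apply/matrixP => a b; rewrite !mxE ffunE; case: eqP => // _.
    by move/matrixP: fW2 => /(_ a b); rewrite !mxE.
  rewrite -ddet_tr /ddet (bigD1 i) //= big1 ?addr0 => [|a ai].
    rewrite -[RHS](det_repl_col1 i (fun a => W2 a j)) -[RHS]det_tr; congr (\det _).
    apply/matrixP => a b; rewrite !mxE; case: (eqVneq a i) => [->|ai].
      by rewrite !mxE ffunE eqxx.
    by move/matrixP: eM => /(_ b a); rewrite !mxE ffunE (negPf ai).
  rewrite (expand_det_row _ a) big1 // => b _.
  by rewrite !mxE eqxx cW2 !mxE (negPf ai) mul0r.
have [V hV] := reduces_exists int_W2; have [c hc] := int_tr.
have [V' eV'] := tangent_absorb c A V k0; exists A, V'; split=> //; rewrite -eV'.
apply: (reduces_inj pG ht) => i j.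
rewrite [in X in G (X, _)]mxE [in X in G (_, X)]mxE; apply: (phomD hG).
  by rewrite [in X in G (X, _)]mxE [in X in G (_, X)]mxE; apply: (phomM hG) => //; exact: reduces_wedge.
exact: reduces_tangent_vector.
Qed.

End SecantLimit.

(** * The generic secant and tangent vectors, and the points of the two closures *)

Section GenericPoints.
Variables (K : numClosedFieldType) (k N : nat).
Hypotheses (k0 : (0 < k)%N) (kN : (k + k <= N)%N).
Local Notation extpow := (extpow K k N).
Local Notation frame := (frame K k N).
Local Notation nvar := (k * N + k * N)%N.
Implicit Types (M W A B : 'M[K]_(k, N)) (t : extpow).
Implicit Types (L : {vspace extpow}) (S : set {vspace extpow}).

Definition generic1 : 'M[{mpoly K[nvar]}]_(k, N) := \matrix_(i, j) 'X_(lshift _ (mxvec_index i j)).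
Definition generic2 : 'M[{mpoly K[nvar]}]_(k, N) := \matrix_(i, j) 'X_(rshift _ (mxvec_index i j)).
Definition valuation_at A B : 'I_nvar -> K := fun x => row_mx (mxvec A) (mxvec B) 0 x.

Lemma eval_generic1 A B : map_mx (meval (valuation_at A B)) generic1 = A.
Proof. by apply/matrixP => i j; rewrite !mxE mevalXU /valuation_at row_mxEl mxvecE. Qed.

Lemma eval_generic2 A B : map_mx (meval (valuation_at A B)) generic2 = B.
Proof. by apply/matrixP => i j; rewrite !mxE mevalXU /valuation_at row_mxEr mxvecE. Qed.

Local Notation F := {fraction {mpoly K[nvar]}}.
Local Notation frac := (map_mx (@tofrac {mpoly K[nvar]})).

Lemma generic_row_free (M : 'M[{mpoly K[nvar]}]_(k, N)) (p : 'I_nvar -> K) :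
  row_free (map_mx (meval p) M) -> row_free (frac M).
Proof.
rewrite -!wedge_neq0; apply: contraNneq => w0; apply/eqP/rowP => a.
rewrite !mxE -map_mxsub det_map_mx.
have := congr1 (fun w : 'rV_#|incr_tuples k N| => w 0 a) w0.
rewrite !mxE -map_mxsub det_map_mx => /eqP; rewrite tofrac_eq0 => /eqP ->.
exact: meval0.
Qed.

Lemma generic1_free : row_free (frac generic1).
Proof.
apply: (@generic_row_free _ (valuation_at (frame 0) (frame 0))).
by rewrite eval_generic1; apply: frame_row_free; lia.
Qed.

Lemma generic2_free : row_free (frac generic2).
Proof.
apply: (@generic_row_free _ (valuation_at (frame 0) (frame 0))).
by rewrite eval_generic2; apply: frame_row_free; lia.
Qed.

Definition secants : set {vspace extpow} :=
  [set L | is_point L /\ exists p q, [/\ Gr p, Gr q & (L <= p + q)%VS]].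

Lemma wedge_scale c A : exists A', c *: wedge A = wedge A'.
Proof. by exists (scale_row (Ordinal k0) c *m A); rewrite wedge_scale_row. Qed.

Lemma zclosure_secants L t : zclosure secants L -> t \in L ->
  (exists A B a b, [/\ row_free A, row_free B & t = a *: wedge A + b *: wedge B]) \/
  (exists A W, row_free A /\ t = tangent_vector A W).
Proof.
move=> cL tL.
pose X a := \det (colsub (@idx k N a) generic1) + \det (colsub (idx a) generic2).
have [||G pG hG] := @zclosure_specialization K k N nvar X secants L t _ _ cL tL.
- by move=> M [].
- move=> M v [_ [_ [_ [/GrP [A fA ->] /GrP [B fB ->] sM]]]] vM.
  have /memv_addP [_ /vlineP [a ->] [_ /vlineP [b ->] ->]] := subvP sM _ vM.
  (* The coefficients are absorbed into the matrices, so that a sum of two generic wedges, without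
     coefficients, parametrizes all secant points. *)
  have [A' ->] := wedge_scale a A; have [B' ->] := wedge_scale b B.
  exists (valuation_at A' B') => c.
  by rewrite /X rmorphD /= -!det_map_mx !map_mxsub eval_generic1 eval_generic2 !mxE.
apply: (@secant_limit F K G pG k N (frac generic1) (frac generic2) t k0 generic1_free generic2_free).
move=> i a; rewrite (ord1 i); have := hG a.
by rewrite /X rmorphD /= -!det_map_mx !map_mxsub !mxE.
Qed.

Lemma zclosure_tangents S L t : S `<=` @tau K k N -> zclosure S L -> t \in L ->
  exists A W, row_free A /\ t = tangent_vector A W.
Proof.
move=> St cL tL.
pose X a := \sum_i \det (colsub (@idx k N a) (mixrows [set i]%SET generic1 generic2)).
have [||G pG hG] := @zclosure_specialization K k N nvar X S L t _ _ cL tL.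
- by move=> M /St [].
- move=> M v /St [_ [A fA h]] vM.
  have [W ->] := (tangent_coneP v k0 fA).1 (h v vM).
  exists (valuation_at A W) => c; rewrite /X rmorph_sum tangent_vectorE summxE.
  apply: eq_bigr => i _ /=.
  by rewrite -det_map_mx map_mxsub map_mixrows eval_generic1 eval_generic2 !mxE.
apply: (@tangent_limit F K G pG k N (frac generic1) (frac generic2) t k0 generic1_free).
move=> i a; rewrite (ord1 i); have := hG a.
rewrite /X rmorph_sum tangent_vectorE summxE; congr (G (_, _)).
by apply: eq_bigr => j _; rewrite /= -det_map_mx map_mxsub map_mixrows !mxE.
Qed.

Lemma secant_point_cases A B a b : row_free A -> row_free B -> a *: wedge A + b *: wedge B != 0 ->
  Gr <[a *: wedge A + b *: wedge B]>%VS \/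
  exists2 l, (1 < l <= k)%N & Sigma l <[a *: wedge A + b *: wedge B]>%VS.
Proof.
move=> fA fB t0.
have ge : (k <= \rank (col_mx A B))%N by rewrite -{1}(eqP fA) -addsmxE mxrankS ?addsmxSl.
have GrZ M c : row_free M -> c *: wedge M != 0 -> Gr <[c *: wedge M]>%VS.
  move=> fM; rewrite scaler_eq0 negb_or => /andP [c0 _]; rewrite line_scale //.
  by apply/GrP; exists M.
have [a0|a0] := eqVneq a 0.
  by left; move: t0; rewrite a0 scale0r add0r; exact: GrZ.
have [b0|b0] := eqVneq b 0.
  by left; move: t0; rewrite b0 scale0r addr0; exact: GrZ.
have [l rl] : exists l, \rank (col_mx A B) = (k + l)%N.
  by exists (\rank (col_mx A B) - k)%N; rewrite subnKC.
have [lk _] := pair_normal_form fA fB rl.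
have [l0|l0] := posnP l.
  left; have [Q eB] : exists Q, B = Q *m A.
    apply/submxP; have := mxrank_leqif_sup (addsmxSl A B).
    by move=> /geq_leqif; rewrite addsmxE rl l0 addn0 (eqP fA) leqnn => /esym; rewrite addsmx_sub => /andP [].
  by move: t0; rewrite eB wedge_mull scalerA -scalerDl; exact: GrZ.
have Sl := Sigma_comb l0 fA fB rl a0 b0.
have [l1|l1] := leqP l 1; last by right; exists l; rewrite ?l1.
by left; rewrite -Sigma1 //; move: Sl; rewrite (_ : l = 1%N) //; lia.
Qed.

Lemma tangent_point_cases M W : row_free M -> tangent_vector M W != 0 ->
  exists2 l, (0 < l <= k)%N & Theta l <[tangent_vector M W]>%VS.
Proof.
move=> fM t0.
have ge : (k <= \rank (col_mx M W))%N by rewrite -{1}(eqP fM) -addsmxE mxrankS ?addsmxSl.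
have [l rl] : exists l, \rank (col_mx M W) = (k + l)%N.
  by exists (\rank (col_mx M W) - k)%N; rewrite subnKC.
have [l0|l0] := posnP l; last first.
  have [lk _] := tangent_normal_form l0 fM rl; exists l; rewrite ?l0 //.
  by apply/ThetaP => //; exists M, W.
(* For l = 0 the vector is a multiple of [wedge M]; its line is a point of G and so is counted in
   Theta 1. *)
exists 1%N => //; rewrite Theta1 //.
have [Q eW] : exists Q, W = Q *m M.
  apply/submxP; have := mxrank_leqif_sup (addsmxSl M W).
  by move=> /geq_leqif; rewrite addsmxE rl l0 addn0 (eqP fM) leqnn => /esym; rewrite addsmx_sub => /andP [].
move: t0; rewrite eW tangent_vector_same scaler_eq0 negb_or => /andP [c0 _].
by rewrite line_scale //; apply/GrP; exists M.
Qed.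

Lemma tau_cases L : tau L -> exists2 l, (0 < l <= k)%N & Theta l L.
Proof.
move=> [/is_pointP [t t0 ->] [M fM h]].
have [W e] := (tangent_coneP t k0 fM).1 (h t (memv_line t)); rewrite e in t0 *.
exact: tangent_point_cases.
Qed.

Lemma zclosure_tau S : S `<=` @tau K k N -> zclosure S `<=` @tau K k N.
Proof.
move=> St L cL.
have pL : is_point L.
  by apply: (zclosure_min (zariski_closed_points K k N) _ cL) => M /St [].
split=> //; have /is_pointP [t t0 eL] := pL.
have tL : t \in L by rewrite eL memv_line.
have [A [W [fA e]]] := zclosure_tangents St cL tL.
exists A => // x; rewrite eL => /vlineP [c ->]; apply/tangent_coneP => //.
by exists (c *: W); rewrite tangent_vectorZ e.
Qed.

End GenericPoints.

(** * Strata *)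

Section Strata.
Variables (K : numClosedFieldType) (k N : nat).
Hypotheses (k3 : (3 <= k)%N) (kN : (k + k <= N)%N).
Local Notation extpow := (extpow K k N).
Local Notation Gr := (@Gr K k N).
Local Notation Sigma := (@Sigma K k N).
Local Notation Theta := (@Theta K k N).
Local Notation tau := (@tau K k N).
Local Notation strata := (@strata K k N).
Local Notation secants := (@secants K k N).
Implicit Types (t : extpow) (L : {vspace extpow}) (O S : set {vspace extpow}).

Let k0 : (0 < k)%N. Proof. by lia. Qed.
Let N0 : (0 < N)%N. Proof. by lia. Qed.

Definition support_le m L := forall x, x \in L -> supp_le m x.

Lemma support_le_line m t : support_le m <[t]>%VS <-> supp_le m t.
Proof.
split=> [|h x /vlineP [c ->]]; first by apply; exact: memv_line.
exact: supp_leZ.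
Qed.

Lemma zclosure_support_le m S L : (forall L', S L' -> is_point L' /\ support_le m L') ->
  zclosure S L -> support_le m L.
Proof. by move=> h cL; have [] := zclosure_min (zariski_closed_supp_le K k N m) h cL. Qed.

Lemma Gr_support m L : Gr L -> support_le m L <-> (k <= m)%N.
Proof.
move=> /GrP [M fM ->]; have h := supp_leP m (fun c => wedge_annihilator c fM).
by rewrite (eqP fM) in h; split=> [/support_le_line/h|/h/support_le_line].
Qed.

Lemma Sigma_support l m L : (1 < l)%N -> Sigma l L -> support_le m L <-> (k + l <= m)%N.
Proof.
move=> l1 /(SigmaP _ (ltnW l1)) [A [B [fA fB r ->]]].
have r1 : (k + 1 < \rank (col_mx A B))%N by rewrite r ltn_add2l.
have h := supp_leP m (fun c => secant_annihilator c fA fB r1).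
by rewrite r in h; split=> [/support_le_line/h|/h/support_le_line].
Qed.

Lemma Theta_support l m L : (1 < l)%N -> Theta l L -> support_le m L <-> (k + l <= m)%N.
Proof.
move=> l1 /(ThetaP _ (ltnW l1) k0) [M [W [fM r ->]]].
have r1 : (k + 1 < \rank (col_mx M W))%N by rewrite r ltn_add2l.
have h := supp_leP m (fun c => tangent_annihilator c fM r1).
by rewrite r in h; split=> [/support_le_line/h|/h/support_le_line].
Qed.

Lemma Theta_sub_tau l : Theta l `<=` tau.
Proof. by move=> L []. Qed.

Lemma Sigma_disjoint_tau l L : (2 < l)%N -> Sigma l L -> ~ tau L.
Proof.
move=> l2 /SigmaP [|A [B [fA fB r ->]]]; first by lia.
move=> [_ [M fM h]].
have [W e] := (tangent_coneP _ k0 fM).1 (h _ (memv_line _)).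
by apply: (secant_not_tangent fA fB fM _ e); rewrite r ltn_add2l.
Qed.

Lemma size_strata : size strata = (k + (k - 2))%N.
Proof. by rewrite /strata /= size_cat !size_map !size_iota; lia. Qed.

(** The shifts arise because the Sigma start at l = 2 after one entry, and the Theta at l = 3 after
    k entries. *)
Lemma nth_strata i : (i < size strata)%N -> nth set0 strata i =
  if i == 0%N then Gr else if (i < k)%N then Sigma i.+1 else Theta (i - k + 3).
Proof.
rewrite size_strata; case: i => [//|i] ik; rewrite /strata /= nth_cat size_map size_iota.
case: ifP => h1; case: ifP => h2; try lia.
  rewrite (nth_map 0%N) ?size_iota // nth_iota //; congr Sigma; lia.
rewrite (nth_map 0%N) ?size_iota ?nth_iota; try lia.
by congr Theta; lia.
Qed.

Lemma stratum_Gr L : Gr L -> exists2 i, (i < size strata)%N & nth set0 strata i L.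
Proof. by move=> h; exists 0%N; rewrite ?nth_strata // size_strata; lia. Qed.

Lemma stratum_Sigma l L : (1 < l <= k)%N -> Sigma l L ->
  exists2 i, (i < size strata)%N & nth set0 strata i L.
Proof.
move=> hl h; have li : (l.-1 < size strata)%N by rewrite size_strata; lia.
exists l.-1 => //; rewrite nth_strata // ifF; last by apply/eqP; lia.
by rewrite ifT ?prednK //; lia.
Qed.

Lemma stratum_Theta l L : (0 < l <= k)%N -> Theta l L ->
  exists2 i, (i < size strata)%N & nth set0 strata i L.
Proof.
move=> hl h; have [l3|l3] := ltnP l 3; last first.
  have li : (l - 3 + k < size strata)%N by rewrite size_strata; lia.
  exists (l - 3 + k)%N => //; rewrite nth_strata // ifF; last by apply/eqP; lia.
  rewrite ifF; last by apply/negbTE; lia.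
  by rewrite (_ : (_ + 3 = l)%N) //; lia.
have [l2|l2] := eqVneq l 2%N.
  by apply: (@stratum_Sigma 2); [lia|rewrite Sigma2 -?l2 //; lia].
apply: stratum_Gr; rewrite -Theta1 //; move: h; rewrite (_ : l = 1%N) //; lia.
Qed.

Lemma stratum_SL_orbit i : (i < size strata)%N -> is_SL_orbit (nth set0 strata i).
Proof.
move=> ii; have := ii; rewrite nth_strata // size_strata => ik.
case: eqP => [_|i0]; first exact: Gr_SL_orbit.
by case: ifP => ik'; [apply: Sigma_SL_orbit|apply: Theta_SL_orbit] => //; lia.
Qed.

(* The dimension of the smallest U such that the stratum consists of points of
   \bigwedge^k U. *)
Definition stratum_rank i := if i == 0%N then k else if (i < k)%N then (k + i.+1)%N else (i + 3)%N.

Lemma stratum_support i m L : (i < size strata)%N -> nth set0 strata i L ->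
  support_le m L <-> (stratum_rank i <= m)%N.
Proof.
move=> ii; rewrite nth_strata // /stratum_rank.
case: eqP => [_|i0]; first exact: Gr_support.
case: ifP => ik; first by apply: Sigma_support; lia.
rewrite (_ : (i + 3 = k + (i - k + 3))%N); last by lia.
by apply: Theta_support; lia.
Qed.

Lemma stratum_point i L : (i < size strata)%N -> nth set0 strata i L -> is_point L.
Proof.
move=> ii /=; have /is_SL_orbitP [//|t t0 ->] := stratum_SL_orbit ii.
exact: GL_orbit_point.
Qed.

(** The dimension of the support separates all strata except Sigma_l from Theta_l with the same l >=
    3, and there tangency decides. *)
Lemma strata_trivIset : trivIset `I_(size strata) (nth set0 strata).
Proof.
move=> i j /= ii jj [L [iL jL]].
wlog ij : i j ii jj iL jL / (i <= j)%N.
  by move=> wl; have [/wl|/ltnW/wl h] := leqP i j; [apply|apply/esym/h].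
have e : stratum_rank i = stratum_rank j.
  by apply/eqP; rewrite eqn_leq; apply/andP; split;
    [apply/(stratum_support _ ii iL)/(stratum_support _ jj jL)
    |apply/(stratum_support _ jj jL)/(stratum_support _ ii iL)].
have [jk|jk] := ltnP j k; first by move: e; rewrite /stratum_rank; do ! case: ifP; lia.
have [ik|ik] := ltnP i k; last by move: e; rewrite /stratum_rank; do ! case: ifP; lia.
have tL : tau L.
  move: jL; rewrite nth_strata // ifF; last by apply/eqP; lia.
  by rewrite ltnNge jk; exact: Theta_sub_tau.
have i2 : (1 < i)%N by move: e; rewrite /stratum_rank; do ! case: ifP; lia.
case: (@Sigma_disjoint_tau i.+1 L) => //.
by move: iL; rewrite nth_strata // ifF ?ik //; apply/eqP; lia.
Qed.

Lemma Sigma_sub_secants l : (0 < l)%N -> Sigma l `<=` secants.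
Proof.
move=> l0 L /SigmaP [//|A [B [fA fB r ->]]].
split; first by apply/is_point_line; apply: secant_neq0 => //; rewrite r; lia.
exists <[wedge A]>%VS, <[wedge B]>%VS; split; [by apply/GrP; exists A|by apply/GrP; exists B|].
by rewrite -memvE; apply: memv_add; exact: memv_line.
Qed.

Lemma sigma2_strata L : @sigma2 K k N L -> exists2 i, (i < size strata)%N & nth set0 strata i L.
Proof.
move=> cL; have pL : is_point L.
  by apply: (zclosure_min (zariski_closed_points K k N) _ cL) => M [].
have /is_pointP [t t0 eL] := pL.
have tL : t \in L by rewrite eL memv_line.
have [[A [B [a [b [fA fB e]]]]]|[A [W [fA e]]]] := zclosure_secants k0 kN cL tL.
  rewrite e in t0 eL; rewrite eL.
  have [/stratum_Gr //|[l hl /stratum_Sigma]] := secant_point_cases k0 kN fA fB t0.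
  by apply.
rewrite e in t0 eL; rewrite eL.
have [l hl h] := tangent_point_cases k0 kN fA t0.
exact: stratum_Theta h.
Qed.

Lemma Sigma_closure_le l m : (0 < l <= m)%N -> (m <= k)%N -> Sigma l `<=` zclosure (Sigma m).
Proof.
move=> /andP [l0 /subnK <-]; elim: (m - l)%N => [|d IH] h; first exact: sub_zclosure.
have h' : (d + l <= k)%N by lia.
by apply: (zclosure_trans (IH h')); rewrite addSn; apply: Sigma_sub_closure => //; lia.
Qed.

Lemma Theta_closure_le l m : (0 < l <= m)%N -> (m <= k)%N -> Theta l `<=` zclosure (Theta m).
Proof.
move=> /andP [l0 /subnK <-]; elim: (m - l)%N => [|d IH] h; first exact: sub_zclosure.
have h' : (d + l <= k)%N by lia.
by apply: (zclosure_trans (IH h')); rewrite addSn; apply: Theta_sub_closure => //; lia.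
Qed.

Lemma stratum_sub_closure i : (i < size strata)%N -> nth set0 strata i `<=` zclosure (Sigma k).
Proof.
move=> ii; have := ii; rewrite nth_strata // size_strata => ik.
case: eqP => [_|i0].
  by rewrite -Sigma1 //; apply: Sigma_closure_le => //; lia.
case: ifP => ik'; first by apply: Sigma_closure_le => //; lia.
apply: (@zclosure_trans _ _ _ _ (Sigma (i - k + 3))).
  by apply: Theta_sub_closure_Sigma => //; lia.
by apply: Sigma_closure_le => //; lia.
Qed.

Lemma sigma2E : @sigma2 K k N = \bigcup_(i < size strata) nth set0 strata i.
Proof.
apply/seteqP; split=> [L /sigma2_strata [i ii iL]|L [i /= ii iL]]; first by exists i.
apply: (zclosureS _ (stratum_sub_closure ii iL)).
by apply: Sigma_sub_secants.
Qed.

Lemma SL_orbit_nonempty O : is_SL_orbit O -> exists2 L, O L & is_point L.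
Proof.
move=> /(is_SL_orbitP _ N0) [t t0 ->]; exists <[t]>%VS; last exact/is_point_line.
exact: GL_orbit_refl.
Qed.

Lemma tau_dense_orbit : is_dense_orbit (Theta k) tau.
Proof.
split; [apply: Theta_SL_orbit => //; lia|exact: Theta_sub_tau|].
move=> L /(tau_cases k0 kN) [l hl]; apply: Theta_closure_le => //; lia.
Qed.

Lemma tau_dense_orbit_unique O : is_dense_orbit O tau -> O = Theta k.
Proof.
move=> [hO Ot dO]; have [L OL pL] := SL_orbit_nonempty hO.
have [l hl TL] := tau_cases k0 kN (Ot L OL).
have eO : O = Theta l by apply: (SL_orbit_meet N0 hO _ OL TL); exact: Theta_SL_orbit.
have [lk|lk] := ltnP l k; last by rewrite eO; congr Theta; lia.
have kk : (0 < k <= k)%N by lia.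
have [M TM pM] := SL_orbit_nonempty (Theta_SL_orbit K kk kN).
have cM := dO M (Theta_sub_tau TM); rewrite eO in cM.
(* Points of Theta l have support of dimension at most k + l < 2k, for l = 1 because they are in G.
   The bound passes to the closure, but M has support of dimension 2k. *)
have sM : support_le (k + k).-1 M.
  apply: (zclosure_support_le _ cM) => L' TL'; split; first by have [] := Theta_sub_tau TL'.
  have [l1|l1] := leqP l 1.
    have e1 : l = 1%N by lia.
    by rewrite e1 Theta1 // in TL'; apply/(Gr_support _ TL'); lia.
  by apply/(Theta_support _ l1 TL'); lia.
have k1 : (1 < k)%N by lia.
by move: sM => /(Theta_support _ k1 TM); lia.
Qed.

Lemma sigma2_dense_orbit : is_dense_orbit (Sigma k) (@sigma2 K k N).
Proof.
split; [by apply: Sigma_SL_orbit => //; lia| |].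
  by move=> L SL; exact: (sub_zclosure (Sigma_sub_secants k0 SL)).
move=> L; rewrite sigma2E => -[i /= ii]; exact: stratum_sub_closure.
Qed.

(** A stratum whose closure contains Sigma k has support of dimension at least 2k, so it is Sigma k
    or Theta k. The closure of the latter stays in tau, which does not meet Sigma k as k >= 3. *)
Lemma sigma2_dense_orbit_unique O : is_dense_orbit O (@sigma2 K k N) -> O = Sigma k.
Proof.
move=> [hO Os dO]; have [L OL pL] := SL_orbit_nonempty hO.
have [i ii iL] := sigma2_strata (Os L OL).
have eO : O = nth set0 strata i by exact: (SL_orbit_meet N0 hO (stratum_SL_orbit ii) OL iL).
have kk : (0 < k <= k)%N by lia.
have k1 : (1 < k)%N by lia.
have [_ Ss _] := sigma2_dense_orbit.
have [M SM pM] := SL_orbit_nonempty (Sigma_SL_orbit K kk kN).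
have cM := dO M (Ss M SM); rewrite eO in cM.
have rk : (k + k <= stratum_rank i)%N.
  apply/(Sigma_support _ k1 SM); apply: (zclosure_support_le _ cM) => L' iL'.
  by split; [exact: stratum_point iL'|apply/(stratum_support _ ii iL')].
have := ii; rewrite size_strata => ik.
rewrite eO nth_strata //; move: rk; rewrite /stratum_rank.
case: eqP => [_|i0]; first by lia.
case: ltnP => ik' rk; first by congr Sigma; lia.
case: (@Sigma_disjoint_tau k M) => //.
apply: (zclosure_tau k0 kN _ cM); rewrite nth_strata // ifF; last by apply/eqP.
by rewrite ltnNge ik'; exact: Theta_sub_tau.
Qed.

End Strata.

Theorem theorem3p3p5 (R : realType) (k N : nat) (hk : (3 <= k)%N)
    (hkN : (2 * k <= N)%N) :
  let G := @Gr R[i] k N in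
  let S := @Sigma R[i] k N in
  let T := @Theta R[i] k N in
  let sigma := @sigma2 R[i] k N in
  let orbits := @strata R[i] k N in
  [/\ [/\ S 1%N = G, T 1%N = G & S 2%N = T 2%N],
      [/\ sigma = \bigcup_(i < size orbits) nth set0 orbits i,
          trivIset `I_(size orbits) (nth set0 orbits) &
          forall i, (i < size orbits)%N -> is_SL_orbit (nth set0 orbits i)],
      [/\ G `<=` zclosure (S 2%N),
          (forall l, (2 <= l <= k - 1)%N -> T l `<=` zclosure (T l.+1)),
          (forall l, (3 <= l <= k - 1)%N -> S l `<=` zclosure (S l.+1)) &
          (forall l, (3 <= l <= k)%N -> T l `<=` zclosure (S l))],
      (is_dense_orbit (T k) (@tau R[i] k N) /\
       forall O, is_dense_orbit O (@tau R[i] k N) -> O = T k) &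
      (is_dense_orbit (S k) sigma /\
       forall O, is_dense_orbit O sigma -> O = S k)].
Proof.
have kN : (k + k <= N)%N by lia.
move=> G S T sigma orbits; split.
- by split; [apply: Sigma1 => //; lia|apply: Theta1 => //; lia|apply: Sigma2 => //; lia].
- by split; [exact: sigma2E|exact: strata_trivIset|exact: stratum_SL_orbit].
- split=> [|l hl|l hl|l hl].
  + by rewrite /G -Sigma1 //; [apply: Sigma_sub_closure => //; lia|lia].
  + by apply: Theta_sub_closure => //; lia.
  + by apply: Sigma_sub_closure => //; lia.
  + by apply: Theta_sub_closure_Sigma => //; lia.
- by split; [exact: tau_dense_orbit|exact: tau_dense_orbit_unique].
- by split; [exact: sigma2_dense_orbit|exact: sigma2_dense_orbit_unique].
Qed.
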